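(* Let $\mathbb{F}$ be a field of characteristic different from $2$, let $n\ge 1$, and let $\mathcal{C}^1,\dots,\mathcal{C}^n$ be Cayley algebras over $\mathbb{F}$. Then there exist isomorphisms of affine group schemes $\Phi$ and $\varphi$, $$\mathbf{Aut}(\mathcal{C}^1\otimes\cdots\otimes\mathcal{C}^n)\xrightarrow{\ \Phi\ }\mathbf{Aut}(\mathcal{C}^1_0\times\cdots\times\mathcal{C}^n_0)\xleftarrow{\ \varphi\ }\mathbf{Aut}(\mathcal{C}^1\times\cdots\times\mathcal{C}^n),$$ given, for every commutative associative unital $\mathbb{F}$-algebra $R$, by restriction: $\Phi(R)(f)$ is the restriction of $f$ to $N'_{alt}(\mathcal{C}^1\otimes\cdots\otimes\mathcal{C}^n)$ (extended by scalars to $R$) for $f\in\mathbf{Aut}(\mathcal{C}^1\otimes\cdots\otimes\mathcal{C}^n)(R)$, and $\varphi(R)(g)$ is the restriction of $g$ to $[\mathcal{C}^1\times\cdots\times\mathcal{C}^n,\ \mathcal{C}^1\times\cdots\times\mathcal{C}^n]$ (extended by scalars to $R$) for $g\in\mathbf{Aut}(\mathcal{C}^1\times\cdots\times\mathcal{C}^n)(R)$. Moreover, $$\mathbf{Aut}(\mathcal{C}^1\otimes\cdots\otimes\mathcal{C}^n)=\mathbf{Aut}(\mathcal{C}^1\otimes\cdots\otimes\mathcal{C}^n,\sigma),$$ where $\sigma$ is the tensor product of the standard involutions of $\mathcal{C}^1,\dots,\mathcal{C}^n$.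
   Context: A Hurwitz algebra is a unital (not necessarily associative) algebra with a nondegenerate multiplicative quadratic form $n$ (the norm), where nondegenerate means that $n(x,y)=n(x+y)-n(x)-n(y)$ is a nondegenerate bilinear form; a Cayley algebra is a Hurwitz algebra of dimension $8$. Its standard involution is $\bar x=n(x,1)1-x$. For a Cayley algebra $\mathcal{C}$, $\mathcal{C}_0=\{x\in\mathcal{C}:\bar x=-x\}$, regarded as an algebra with product the commutator $[x,y]=xy-yx$; products $\mathcal{C}^1_0\times\cdots\times\mathcal{C}^n_0$ carry the componentwise commutator product. For a finite-dimensional nonassociative algebra $\mathcal{A}$ over $\mathbb{F}$, $\mathbf{Aut}(\mathcal{A})$ is the affine group scheme $R\mapsto\mathrm{Aut}_{R}(\mathcal{A}\otimes R)$ (automorphisms of $R$-algebras). For an involution $\sigma$ on $\mathcal{A}$, $\mathbf{Aut}(\mathcal{A},\sigma)(R)$ is the subgroup of those $f\in\mathrm{Aut}_R(\mathcal{A}\otimes R)$ with $f\circ(\sigma\otimes \mathrm{id}_R)=(\sigma\otimes \mathrm{id}_R)\circ f$. The generalized alternative nucleus of an algebra $\mathcal{A}$ is $N_{alt}(\mathcal{A})=\{a\in\mathcal{A}:(a,x,y)=-(x,a,y)=(x,y,a)\ \forall x,y\in\mathcal{A}\}$, with $(a,x,y)=(ax)y-a(xy)$, and $N'_{alt}(\mathcal{A})=[N_{alt}(\mathcal{A}),N_{alt}(\mathcal{A})]$ (span of commutators). It is known that, identifying $\mathcal{C}^i$ with $1\otimes\cdots\otimes\mathcal{C}^i\otimes\cdots\otimes1$,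 one has $N_{alt}(\mathcal{C}^1\otimes\cdots\otimes\mathcal{C}^n)=\mathbb{F}1\oplus\mathcal{C}^1_0\oplus\cdots\oplus\mathcal{C}^n_0$ and $N'_{alt}(\mathcal{C}^1\otimes\cdots\otimes\mathcal{C}^n)=\mathcal{C}^1_0\oplus\cdots\oplus\mathcal{C}^n_0$, which is identified with $\mathcal{C}^1_0\times\cdots\times\mathcal{C}^n_0$; similarly $[\mathcal{C}^1\times\cdots\times\mathcal{C}^n,\mathcal{C}^1\times\cdots\times\mathcal{C}^n]=\mathcal{C}^1_0\times\cdots\times\mathcal{C}^n_0$. *)

(* Defs.v *)
From HB Require Import structures.
From mathcomp Require Import all_boot all_algebra sesquilinear.
From mathcomp Require Import ring.
From mathcomp Require Import boolp classical_sets.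

Set Implicit Arguments.
Unset Strict Implicit.
Unset Printing Implicit Defensive.

Import GRing.Theory passmx.

Local Open Scope ring_scope.
Local Open Scope classical_set_scope.

Record fdAlgebra (F : fieldType) := FdAlgebra {
  fd_carrier :> vectType F;
  amul : {bilinear fd_carrier -> fd_carrier -> fd_carrier} }.
Arguments amul {F A} : rename.

Section AlgebraNotions.
Variables (F : fieldType) (A : fdAlgebra F).
Implicit Types a x y : A.

Definition acomm x y := amul x y - amul y x.

Definition associator a x y := amul (amul a x) y - amul a (amul x y).

Definition Nalt : set A := [set a | forall x y,
  associator a x y = - associator x a y /\
  - associator x a y = associator x y a].

Definition linspan (S : set A) : set A := [set v | exists s : seq A,
  (forall x, x \in s -> S x) /\ v \in <<s>>%VS].

Definition comm_span (S : set A) : set A :=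
  linspan [set z | exists x y, [/\ S x, S y & z = acomm x y]].

Definition Nalt' : set A := comm_span Nalt.

End AlgebraNotions.
Arguments Nalt {F} A _.
Arguments Nalt' {F} A _.

Definition polar (F : fieldType) (V : vectType F) (q : V -> F) (x y : V) : F :=
  q (x + y) - q x - q y.

(** Since [polar q] is symmetric, linearity in its first argument is
    bilinearity. *)
Definition quadratic_form (F : fieldType) (V : vectType F) (q : V -> F) :=
  (forall a x, q (a *: x) = a ^+ 2 * q x) /\
  (forall y, scalar (fun x => polar q x y)).

Record hurwitzAlgebra (F : fieldType) := HurwitzAlgebra {
  hw_algebra :> fdAlgebra F;
  hone : hw_algebra;
  hnorm : hw_algebra -> F;
  hmul1l : forall x, amul hone x = x;
  hmul1r : forall x, amul x hone = x;
  hnorm_quad : quadratic_form hnorm;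
  hnorm_nondeg : forall x, (forall y, polar hnorm x y = 0) -> x = 0;
  hnormM : forall x y, hnorm (amul x y) = hnorm x * hnorm y }.
Arguments hone {F} _.
Arguments hnorm {F} _ _.

Record cayleyAlgebra (F : fieldType) := CayleyAlgebra {
  cayley_hurwitz :> hurwitzAlgebra F;
  cayley_dim : \dim {: cayley_hurwitz} = 8 }.

Section Hurwitz.
Variables (F : fieldType) (C : hurwitzAlgebra F).

Definition hconj (x : C) : C := polar (hnorm C) x (hone C) *: hone C - x.

Fact hconj_is_linear : linear hconj.
Proof.
move=> a x y; have [_ /(_ (hone C)) qL] := hnorm_quad C.
rewrite /hconj qL scalerDl scalerBr scalerA opprD.
by rewrite -!addrA; congr (_ + _); rewrite addrCA.
Qed.
HB.instance Definition _ :=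
  GRing.isLinear.Build F C C _ hconj hconj_is_linear.

Definition skew_space : {vspace C} := lker (linfun hconj + \1)%VF.

Lemma mem_skew_space x : (x \in skew_space) = (hconj x == - x).
Proof. by rewrite memv_ker !lfunE/= !lfunE/= addr_eq0. Qed.

Lemma polarC x y : polar (hnorm C) x y = polar (hnorm C) y x.
Proof. by rewrite /polar [x + y]addrC addrAC. Qed.

Lemma polarDl x y z :
  polar (hnorm C) (x + y) z = polar (hnorm C) x z + polar (hnorm C) y z.
Proof.
by have [_ qL] := hnorm_quad C; have := qL z 1 x y; rewrite scale1r mul1r.
Qed.

Lemma polarNl x z : polar (hnorm C) (- x) z = - polar (hnorm C) x z.
Proof.
have [_ qL] := hnorm_quad C.
have p0 : polar (hnorm C) 0 z = 0.
  by have := qL z (-1) 0 0; rewrite scaler0 addr0 mulN1r addNr.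
by have := qL z (-1) x 0; rewrite scaleN1r p0 mulN1r !addr0.
Qed.

Lemma skew_space_polar x :
  polar (hnorm C) x (hone C) = 0 -> x \in skew_space.
Proof. by move=> px; rewrite mem_skew_space /hconj px scale0r sub0r. Qed.

Lemma amulDl (x y z : C) : amul (x + y) z = amul x z + amul y z.
Proof. by rewrite linearDl. Qed.

Lemma amulDr (x y z : C) : amul z (x + y) = amul z x + amul z y.
Proof. by rewrite linearDr. Qed.

Lemma acomm_polar1 (x y : C) : polar (hnorm C) (acomm x y) (hone C) = 0.
Proof.
suff sym u v : polar (hnorm C) (amul u v) (hone C) =
    polar (hnorm C) u (hone C) * polar (hnorm C) v (hone C)
    - polar (hnorm C) u v.
  by rewrite /acomm polarDl polarNl !sym [polar _ y x]polarC mulrC subrr.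
pose p := polar (hnorm C).
have pDr a b c : p c (a + b) = p c a + p c b.
  by rewrite /p ![polar _ c _]polarC polarDl.
have pM1 a b c : p (amul a c) (amul b c) = p a b * hnorm C c.
  by rewrite /p /polar -amulDl !hnormM !mulrBl.
have pM a b c d :
    p (amul a c) (amul b d) + p (amul a d) (amul b c) = p a b * p c d.
  have := pM1 a b (c + d); rewrite !amulDr pDr /p !polarDl -/p !pM1.
  rewrite [hnorm C (c + d)](_ : _ = p c d + hnorm C c + hnorm C d); last first.
    by rewrite /p /polar; ring.
  by move/eqP; rewrite -subr_eq0 => /eqP E; apply/subr0_eq; rewrite -E; ring.
have := pM u (hone C) v (hone C); rewrite !hmul1l !hmul1r => <-.
by rewrite addrK.
Qed.

End Hurwitz.

Section SkewAlgebra.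
Variables (F : fieldType) (C : hurwitzAlgebra F).

Definition skew_carrier : vectType F := subvs_of (skew_space C).

Lemma acomm_skew (x y : C) : acomm x y \in skew_space C.
Proof. exact/skew_space_polar/acomm_polar1. Qed.

Definition skew_mul (x y : skew_carrier) : skew_carrier :=
  Subvs (acomm_skew (vsval x) (vsval y)).

Fact skew_mul_bilinear : bilinear_for *:%R *:%R skew_mul.
Proof.
have e (a : F) (u v u' v' : C) : a *: u + v - (a *: u' + v') =
    a *: (u - u') + (v - v') by rewrite scalerBr opprD addrACA.
split=> z a x y; apply/val_inj; rewrite [RHS]linearP/= /acomm linearP/=.
  by rewrite linearPl e.
by rewrite linearPl e.
Qed.
HB.instance Definition _ := bilinear_isBilinear.Build F
  skew_carrier skew_carrier skew_carrier _ _ skew_mul skew_mul_bilinear.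

Definition skewAlgebra : fdAlgebra F := FdAlgebra skew_mul.

End SkewAlgebra.

Definition dprod (F : fieldType) n (V : 'I_n -> vectType F) : Type :=
  {dffun forall i, V i}.

Section DirectProduct.
Variables (F : fieldType) (n : nat) (V : 'I_n -> vectType F).
Implicit Types x y z : dprod V.

HB.instance Definition _ := Choice.on (dprod V).

Lemma dprodP x y : (forall i, x i = y i) -> x = y.
Proof. by move=> e; apply/ffunP. Qed.

Let add x y : dprod V := [ffun i => x i + y i].
Let opp x : dprod V := [ffun i => - x i].
Let zero : dprod V := [ffun i => 0].
Let scale (a : F) x : dprod V := [ffun i => a *: x i].

Fact dprod_addA : associative add.
Proof. by move=> x y z; apply/dprodP => i; rewrite !ffunE addrA. Qed.
Fact dprod_addC : commutative add.
Proof. by move=> x y; apply/dprodP => i; rewrite !ffunE addrC. Qed.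
Fact dprod_add0 : left_id zero add.
Proof. by move=> x; apply/dprodP => i; rewrite !ffunE add0r. Qed.
Fact dprod_addN : left_inverse zero opp add.
Proof. by move=> x; apply/dprodP => i; rewrite !ffunE addNr. Qed.
HB.instance Definition _ := GRing.isZmodule.Build (dprod V)
  dprod_addA dprod_addC dprod_add0 dprod_addN.

Fact dprod_scaleA a b x : scale a (scale b x) = scale (a * b) x.
Proof. by apply/dprodP => i; rewrite !ffunE scalerA. Qed.
Fact dprod_scale1 : left_id 1 scale.
Proof. by move=> x; apply/dprodP => i; rewrite !ffunE scale1r. Qed.
Fact dprod_scaleDr : right_distributive scale +%R.
Proof. by move=> a x y; apply/dprodP => i; rewrite !ffunE scalerDr. Qed.
Fact dprod_scaleDl x : {morph scale^~ x : a b / a + b}.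
Proof. by move=> a b; apply/dprodP => i; rewrite !ffunE scalerDl. Qed.
HB.instance Definition _ := GRing.Zmodule_isLmodule.Build F (dprod V)
  dprod_scaleA dprod_scale1 dprod_scaleDr dprod_scaleDl.

Lemma dprodDE x y i : (x + y) i = x i + y i. Proof. by rewrite ffunE. Qed.
Lemma dprodZE a x i : (a *: x) i = a *: x i. Proof. by rewrite ffunE. Qed.

Let to_row x : 'rV[F]_(\sum_i \dim {:V i}) :=
  \mxrow_i (rVof (vbasis {:V i}) (x i)).

Fact dprod_vect_iso : Vector.axiom (\sum_i \dim {:V i}) (dprod V).
Proof.
exists to_row.
  move=> a x y; apply/rowP => k; rewrite !mxE.
  by rewrite dprodDE dprodZE linearP.
exists (fun r => [ffun i => vecof (vbasis {:V i}) (submxrow r i)]); [move=> x|move=> r].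
  by apply/dprodP => i; rewrite ffunE mxrowK rVofK// vbasisP.
by apply/mxrowP => i; rewrite mxrowK ffunE vecofK// vbasisP.
Qed.
HB.instance Definition _ := Lmodule_hasFinDim.Build F (dprod V) dprod_vect_iso.

End DirectProduct.

Section ProductAlgebra.
Variables (F : fieldType) (n : nat) (A : 'I_n -> fdAlgebra F).

Definition dprod_mul (x y : dprod A) : dprod A :=
  [ffun i => amul (x i) (y i)].

Fact dprod_mul_bilinear : bilinear_for *:%R *:%R dprod_mul.
Proof.
split=> z a x y; apply/dprodP => i.
  by rewrite dprodDE dprodZE !ffunE linearPl.
by rewrite dprodDE dprodZE !ffunE linearPr.
Qed.
HB.instance Definition _ := bilinear_isBilinear.Build F
  (dprod A) (dprod A) (dprod A) _ _ dprod_mul dprod_mul_bilinear.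

Definition prodAlgebra : fdAlgebra F := FdAlgebra dprod_mul.

End ProductAlgebra.

(** The tensor product [V_1 ⊗ ... ⊗ V_n] in coordinates: a tensor is the
    family of its coefficients on the products of the chosen bases of the
    [V_i].  The lemmas [pure_multilinear], [tensor_lift_pure] and [tensor_ext]
    are its universal property. *)

Section Tensor.
Variables (F : fieldType) (n : nat) (V : 'I_n -> vectType F).

Definition mindex : finType := {dffun forall i : 'I_n, 'I_(\dim {:V i})}.

Definition tensor : vectType F := {ffun mindex -> F^o}.

Definition pure (x : forall i, V i) : tensor :=
  [ffun k : mindex => \prod_i coord (vbasis {:V i}) (k i) (x i)].

Definition basis_at (k : mindex) (i : 'I_n) : V i := (vbasis {:V i})`_(k i).

Definition multilinear (W : lmodType F) (m : (forall i, V i) -> W) : Prop :=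
  forall (x : forall i, V i) i, linear (fun v : V i => m (dfwith x v)).

Definition tensor_lift (W : lmodType F) (m : (forall i, V i) -> W)
  (t : tensor) : W := \sum_(k : mindex) (t k : F) *: m (basis_at k).

Fact tensor_lift_is_linear (W : lmodType F) (m : (forall i, V i) -> W) :
  linear (tensor_lift m).
Proof.
move=> a s t; rewrite /tensor_lift scaler_sumr -big_split/=.
by apply: eq_bigr => k _; rewrite !ffunE scalerDl scalerA.
Qed.
HB.instance Definition _ (W : lmodType F) (m : (forall i, V i) -> W) :=
  GRing.isLinear.Build F tensor W _ (tensor_lift m)
    (tensor_lift_is_linear m).

Lemma tensor_lift_linear (W : lmodType F) (m m1 m2 : (forall i, V i) -> W)
    a t : (forall x, m x = a *: m1 x + m2 x) ->
  tensor_lift m t = a *: tensor_lift m1 t + tensor_lift m2 t.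
Proof.
move=> mE; rewrite /tensor_lift scaler_sumr -big_split/=.
by apply: eq_bigr => k _; rewrite mE scalerDr !scalerA mulrC.
Qed.

Lemma tensorP (s t : tensor) : (forall k, s k = t k) -> s = t.
Proof. by move=> e; apply/ffunP. Qed.

Lemma tensorDE (s t : tensor) k : (s + t) k = (s k : F) + t k.
Proof. by rewrite ffunE. Qed.

Lemma tensorZE a (t : tensor) k : (a *: t) k = a * (t k : F).
Proof. by rewrite ffunE. Qed.

Lemma pure_multilinear : multilinear pure.
Proof.
move=> x i a u v; apply/tensorP => k.
have pE w : pure (dfwith x w) k = coord (vbasis {:V i}) (k i) w *
    \prod_(j | j != i) coord (vbasis {:V j}) (k j) (x j).
  rewrite ffunE (bigD1 i)//= dfwith_in; congr (_ * _).
  by apply: eq_bigr => j ji; rewrite dfwith_out// eq_sym.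
by rewrite tensorDE tensorZE !pE linearP/= mulrDl -mulrA.
Qed.

Lemma pure_basis_at k l : pure (basis_at k) l = (l == k)%:R.
Proof.
rewrite ffunE; have [->|/eqP lk] := eqVneq l k.
  rewrite big1// => i _; rewrite coord_free ?eqxx//.
  exact: basis_free (vbasisP _).
have [i lki] : exists i, l i != k i.
  by apply/existsP; apply: contra_notT lk => /existsPn e;
     apply/ffunP => i; apply/eqP; have := e i; rewrite negbK.
rewrite (bigD1 i)//= coord_free ?(basis_free (vbasisP _))//.
by rewrite eq_sym (negPf lki) mul0r.
Qed.

Lemma tensor_sum (t : tensor) : t = tensor_lift pure t.
Proof.
apply/tensorP => l; rewrite /tensor_lift sum_ffunE (bigD1 l)//=.
rewrite big1 => [|k kl]; rewrite tensorZE pure_basis_at.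
  by rewrite eqxx mulr1 addr0.
by rewrite eq_sym (negPf kl) mulr0.
Qed.

Lemma multilinear_ext (W : lmodType F) (m m' : (forall i, V i) -> W) :
  multilinear m -> multilinear m' ->
  (forall k, m (basis_at k) = m' (basis_at k)) -> m = m'.
Proof.
move=> mL mL' mm'; apply/funext => x.
suff H j : (j <= n)%N -> forall x : forall i, V i,
    (forall i : 'I_n, (j <= i)%N ->
       exists k : 'I_(\dim {:V i}), x i = (vbasis {:V i})`_k) -> m x = m' x.
  by apply: (H n (leqnn n)) => i; rewrite leqNgt ltn_ord.
elim: j {x} => [_ x xb|j IH jn x xb].
  have [k xk] : exists k : mindex, forall i, x i = basis_at k i.
    have c i : {k : 'I_(\dim {:V i}) | x i = (vbasis {:V i})`_k}.
      exact: (cid (xb i (leq0n i))).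
    exists [ffun i => sval (c i)] => i.
    by rewrite /basis_at ffunE; exact: (svalP (c i)).
  by have -> : x = basis_at k by exact: functional_extensionality_dep.
pose i := Ordinal jn.
have xE : x = dfwith x (x i).
  by apply: functional_extensionality_dep => l; case: dfwithP.
have sumL (m0 : (forall i, V i) -> W) : multilinear m0 -> m0 x =
    \sum_k coord (vbasis {:V i}) k (x i) *:
      m0 (dfwith x ((vbasis {:V i})`_k)).
  move=> m0L; rewrite {1}xE {1}(coord_basis (vbasisP _) (memvf (x i))).
  pose g := GRing.isLinear.Build F (V i) W _ _ (m0L x i).
  pose f : {linear V i -> W} := HB.pack (fun v : V i => m0 (dfwith x v)) g.
  rewrite -[LHS]/(f _) linear_sum; apply: eq_bigr => k _.
  by rewrite linearZ.
rewrite !sumL//; apply: eq_bigr => k _; congr (_ *: _).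
apply: IH => [|l jl]; first exact: ltnW.
case: dfwithP jl => [_|l' il' jl]; first by exists k.
by apply: xb; rewrite ltn_neqAle jl andbT.
Qed.

Lemma multilinear_comp (W : lmodType F) (h : {linear tensor -> W}) :
  multilinear (h \o pure).
Proof.
by move=> x i a u v /=; rewrite pure_multilinear linearP.
Qed.

Lemma tensor_lift_pure (W : lmodType F) (m : (forall i, V i) -> W) x :
  multilinear m -> tensor_lift m (pure x) = m x.
Proof.
move=> mL; suff : tensor_lift m \o pure = m by move=> /(congr1 (@^~ x)).
apply: multilinear_ext => // [|k /=]; first exact: multilinear_comp.
rewrite /tensor_lift (bigD1 k)//= pure_basis_at eqxx scale1r.
by rewrite big1 ?addr0// => l lk; rewrite pure_basis_at (negPf lk) scale0r.
Qed.

Lemma tensor_ext (W : lmodType F) (h h' : {linear tensor -> W}) :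
  (forall x, h (pure x) = h' (pure x)) -> h =1 h'.
Proof.
move=> hh' t; rewrite (tensor_sum t) /tensor_lift !linear_sum.
by apply: eq_bigr => k _; rewrite !linearZ/= hh'.
Qed.

End Tensor.
Arguments tensor_lift {F n V W} m t.

Section TensorMap.
Variables (F : fieldType) (n : nat) (V W : 'I_n -> vectType F).
Variable h : forall i, {linear V i -> W i}.

Definition tensor_map : tensor V -> tensor W :=
  tensor_lift (fun x => pure (fun i => h i (x i))).

HB.instance Definition _ := GRing.Linear.on tensor_map.

Lemma tensor_map_pure x : tensor_map (pure x) = pure (fun i => h i (x i)).
Proof.
apply: (tensor_lift_pure (m := fun x => pure (fun i => h i (x i)))).
move=> {}x i a u v.
have E w : (fun j => h j (dfwith x w j)) = dfwith (fun j => h j (x j)) (h i w).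
  apply: functional_extensionality_dep => j.
  by case: dfwithP => [|l il]; rewrite ?dfwith_in ?dfwith_out.
by rewrite !E linearP; exact: pure_multilinear.
Qed.

End TensorMap.

Section TensorAlgebra.
Variables (F : fieldType) (n : nat) (A : 'I_n -> fdAlgebra F).

(** See [tensor_mul_pure]. *)
Definition tensor_mul (s t : tensor A) : tensor A :=
  tensor_lift (fun x =>
    tensor_lift (fun y => pure (fun i => amul (x i) (y i))) t) s.

Fact tensor_mul_bilinear : bilinear_for *:%R *:%R tensor_mul.
Proof.
split=> [t a s s'|s a t t']; first by rewrite /tensor_mul linearP.
apply: (tensor_lift_linear (W := tensor A)) => x; exact: linearP.
Qed.
HB.instance Definition _ := bilinear_isBilinear.Build F
  (tensor A) (tensor A) (tensor A) _ _ tensor_mul tensor_mul_bilinear.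

Definition tensorAlgebra : fdAlgebra F := FdAlgebra tensor_mul.

Lemma tensor_mul_pure (x y : forall i, A i) :
  tensor_mul (pure x) (pure y) = pure (fun i => amul (x i) (y i)).
Proof.
pose m x y : tensor A := pure (fun i : 'I_n => amul (x i : A i) (y i)).
have mLr z : multilinear (m z).
  move=> w i a u v; rewrite /m.
  have E c : (fun j => amul (z j) (dfwith w c j)) =
      dfwith (fun j => amul (z j) (w j)) (amul (z i) c).
    apply: functional_extensionality_dep => j.
    by case: dfwithP => [|l il]; rewrite ?dfwith_in ?dfwith_out.
  by rewrite !E linearPr; exact: pure_multilinear.
rewrite /tensor_mul (tensor_lift_pure (m := fun x => tensor_lift (m x) _)).
  by rewrite tensor_lift_pure.
move=> w i a u v; rewrite !tensor_lift_pure// /m.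
have E c : (fun j => amul (dfwith w c j) (y j)) =
    dfwith (fun j => amul (w j) (y j)) (amul c (y i)).
  apply: functional_extensionality_dep => j.
  by case: dfwithP => [|l il]; rewrite ?dfwith_in ?dfwith_out.
by rewrite !E linearPl; exact: pure_multilinear.
Qed.

End TensorAlgebra.

(** [comAlgType F] excludes the zero ring, hence this encoding of commutative
    [F]-algebras as ring morphisms out of [F]. *)
Record commAlgebra (F : fieldType) := CommAlgebra {
  calg_ring :> comPzRingType;
  calg_struct : {rmorphism F -> calg_ring} }.

Record calgHom (F : fieldType) (R S : commAlgebra F) := CalgHom {
  calg_hom :> {rmorphism R -> S};
  calg_homE : forall a, calg_hom (calg_struct R a) = calg_struct S a }.

Section CommAlgebraCategory.
Variable F : fieldType.

Definition calg_id (R : commAlgebra F) : calgHom R R :=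
  @CalgHom F R R (idfun : {rmorphism R -> R}) (fun=> erefl).

Fact calg_comp_subproof (R S T : commAlgebra F) (g : calgHom S T)
    (f : calgHom R S) a :
  (g \o f : {rmorphism R -> T}) (calg_struct R a) = calg_struct T a.
Proof. by rewrite /= !calg_homE. Qed.

Definition calg_comp (R S T : commAlgebra F) (g : calgHom S T)
  (f : calgHom R S) : calgHom R T := CalgHom (calg_comp_subproof g f).

End CommAlgebraCategory.

(** Affine group schemes are identified with their functors of points, so that
    their morphisms are the natural transformations. *)
Record groupFunctor (F : fieldType) := GroupFunctor {
  gf_points :> commAlgebra F -> groupType;
  gf_map : forall R S, calgHom R S -> gf_points R -> gf_points S;
  gf_mapM : forall R S (f : calgHom R S) x y,
    gf_map f (x * y)%g = (gf_map f x * gf_map f y)%g;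
  gf_map_id : forall R x, gf_map (calg_id R) x = x;
  gf_map_comp : forall R S T (g : calgHom S T) (f : calgHom R S) x,
    gf_map (calg_comp g f) x = gf_map g (gf_map f x) }.

Record groupFunctorIso (F : fieldType) (G H : groupFunctor F) :=
  GroupFunctorIso {
  gfi_fun :> forall R, G R -> H R;
  gfi_mul : forall R (x y : G R),
    gfi_fun (x * y)%g = (gfi_fun x * gfi_fun y)%g;
  gfi_natural : forall R S (f : calgHom R S) (x : G R),
    gfi_fun (gf_map f x) = gf_map f (gfi_fun x);
  gfi_bij : forall R, bijective (@gfi_fun R) }.

(** [V ⊗ R] is represented by the coordinate vectors over [R] in the chosen
    basis of [V], with [sext_in R v] standing for [v ⊗ 1].  The lemmas
    [sext_lift_in] and [sext_ext] are the universal property. *)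

Definition sext (F : fieldType) (V : vectType F) (R : commAlgebra F)
  : lmodType R := 'rV[R]_(\dim {:V}).

Section ScalarExtension.
Variables (F : fieldType) (V : vectType F) (R : commAlgebra F).
Local Notation b := (vbasis {:V}).

Definition sext_in (v : V) : sext V R := \row_i calg_struct R (coord b i v).

Definition sext_lift (W : lmodType R) (h : V -> W) (x : sext V R) : W :=
  \sum_i x 0 i *: h b`_i.

Lemma sext_inD u v : sext_in (u + v) = sext_in u + sext_in v.
Proof. by apply/rowP => i; rewrite !mxE linearD rmorphD. Qed.

Lemma sext_inZ a v : sext_in (a *: v) = calg_struct R a *: sext_in v.
Proof. by apply/rowP => i; rewrite !mxE linearZ rmorphM. Qed.

Lemma sext_in_basis (i : 'I_(\dim {:V})) : sext_in b`_i = delta_mx 0 i.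
Proof.
apply/rowP => j; rewrite !mxE eqxx/= coord_free ?(basis_free (vbasisP _))//.
by rewrite rmorph_nat eq_sym.
Qed.

Fact sext_lift_is_linear (W : lmodType R) (h : V -> W) : linear (sext_lift h).
Proof.
move=> a x y; rewrite /sext_lift scaler_sumr -big_split/=.
by apply: eq_bigr => i _; rewrite !mxE scalerDl scalerA.
Qed.
HB.instance Definition _ (W : lmodType R) (h : V -> W) :=
  GRing.isLinear.Build R (sext V R) W _ (sext_lift h) (sext_lift_is_linear h).

Lemma sext_lift_linear (W : lmodType R) (h h1 h2 : V -> W) a x :
  (forall v, h v = a *: h1 v + h2 v) ->
  sext_lift h x = a *: sext_lift h1 x + sext_lift h2 x.
Proof.
move=> hE; rewrite /sext_lift scaler_sumr -big_split/=.
by apply: eq_bigr => i _; rewrite hE scalerDr !scalerA mulrC.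
Qed.

Lemma sext_lift_in (W : lmodType R) (h : V -> W) v :
  (forall u w, h (u + w) = h u + h w) ->
  (forall a u, h (a *: u) = calg_struct R a *: h u) ->
  sext_lift h (sext_in v) = h v.
Proof.
move=> hD hZ; have h0 : h 0 = 0 by rewrite -(scale0r 0) hZ rmorph0 scale0r.
rewrite [in RHS](coord_basis (vbasisP _) (memvf v)).
rewrite (big_morph h hD h0); apply: eq_bigr => i _.
by rewrite hZ mxE.
Qed.

Lemma sext_sum (x : sext V R) : x = sext_lift sext_in x.
Proof.
rewrite [LHS]row_sum_delta; apply: eq_bigr => i _.
by rewrite sext_in_basis.
Qed.

Lemma sext_ext (W : lmodType R) (h h' : {linear sext V R -> W}) :
  (forall v, h (sext_in v) = h' (sext_in v)) -> h =1 h'.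
Proof.
move=> hh' x; rewrite (sext_sum x) /sext_lift !linear_sum.
by apply: eq_bigr => i _; rewrite !linearZ/= hh'.
Qed.

End ScalarExtension.
Arguments sext_in {F V} R v.
Arguments sext_lift {F V R W} h x.

Section ScalarExtensionMap.
Variables (F : fieldType) (V W : vectType F) (R : commAlgebra F).
Variable h : {linear V -> W}.

Definition sext_map : sext V R -> sext W R :=
  sext_lift (fun v => sext_in R (h v)).

HB.instance Definition _ := GRing.Linear.on sext_map.

Lemma sext_map_in v : sext_map (sext_in R v) = sext_in R (h v).
Proof.
apply: (sext_lift_in (h := fun v => sext_in R (h v))) => [u w|a u].
  by rewrite linearD sext_inD.
by rewrite linearZ sext_inZ.
Qed.

End ScalarExtensionMap.
Arguments sext_map {F V W} R h x.

Section ScalarExtensionChange.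
Variables (F : fieldType) (V : vectType F) (R S : commAlgebra F).
Variable f : calgHom R S.

Definition sext_change (x : sext V R) : sext V S := map_mx f x.

Lemma sext_change_in v : sext_change (sext_in R v) = sext_in S v.
Proof. by apply/rowP => i; rewrite !mxE calg_homE. Qed.

Lemma sext_changeD x y : sext_change (x + y) = sext_change x + sext_change y.
Proof. by apply/rowP => i; rewrite !mxE rmorphD. Qed.

Lemma sext_changeZ a x : sext_change (a *: x) = f a *: sext_change x.
Proof. by apply/rowP => i; rewrite !mxE rmorphM. Qed.

Lemma sext_change0 : sext_change 0 = 0.
Proof. by apply/rowP => i; rewrite !mxE rmorph0. Qed.

Lemma sext_change_sum (I : finType) (E : I -> sext V R) :
  sext_change (\sum_i E i) = \sum_i sext_change (E i).
Proof. exact: (big_morph _ sext_changeD sext_change0). Qed.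

End ScalarExtensionChange.

Section ScalarExtensionAlgebra.
Variables (F : fieldType) (A : fdAlgebra F) (R : commAlgebra F).
Implicit Types x y : sext A R.

(** The [R]-bilinear product with [(u ⊗ 1) (v ⊗ 1) = uv ⊗ 1]; see
    [sext_mul_in]. *)
Definition sext_mul x y : sext A R :=
  sext_lift (fun u => sext_lift (fun v => sext_in R (amul u v)) y) x.

Lemma sext_mul_linearl y : linear (sext_mul^~ y).
Proof. exact: sext_lift_is_linear. Qed.

Lemma sext_mul_linearr x : linear (sext_mul x).
Proof.
move=> a y y'; apply: sext_lift_linear => u; exact: sext_lift_is_linear.
Qed.

Lemma sext_mul_in u v :
  sext_mul (sext_in R u) (sext_in R v) = sext_in R (amul u v).
Proof.
pose h u v := sext_in R (amul u v : A).
have hr w : sext_lift (h w) (sext_in R v) = h w v.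
  apply: sext_lift_in => [w1 w2|a w1]; rewrite /h.
    by rewrite linearDr sext_inD.
  by rewrite linearZr_LR sext_inZ.
have -> : sext_mul (sext_in R u) (sext_in R v) =
    sext_lift (h^~ v) (sext_in R u).
  by rewrite /sext_mul; apply: eq_bigr => i _; rewrite hr.
apply: sext_lift_in => [w1 w2|a w1]; rewrite /h.
  by rewrite linearDl sext_inD.
by rewrite linearZl_LR sext_inZ.
Qed.

End ScalarExtensionAlgebra.
Arguments sext_mul {F A R} x y.

Record algAut (F : fieldType) (A : fdAlgebra F) (R : commAlgebra F) := AlgAut {
  aut_fun :> sext A R -> sext A R;
  aut_inv : sext A R -> sext A R;
  aut_linear : linear aut_fun;
  aut_mul : forall x y,
    aut_fun (sext_mul x y) = sext_mul (aut_fun x) (aut_fun y);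
  aut_funK : cancel aut_fun aut_inv;
  aut_invK : cancel aut_inv aut_fun }.

Section AutGroup.
Variables (F : fieldType) (A : fdAlgebra F) (R : commAlgebra F).
Local Notation aut := (algAut A R).

Lemma algAutP (f g : aut) : f =1 g -> f = g.
Proof.
case: f g => [f f' fL fM fK f'K] [g g' gL gM gK g'K] /= fg.
have {}fg : f = g by exact/funext.
move: fL fM fK f'K; rewrite {}fg => fL fM fK f'K.
have fg' : f' = g' by apply/funext => x; apply: (can_inj gK); rewrite f'K g'K.
move: fK f'K; rewrite {}fg' => fK f'K.
by congr AlgAut; exact: Prop_irrelevance.
Qed.

HB.instance Definition _ := gen_eqMixin aut.
HB.instance Definition _ := gen_choiceMixin aut.

Definition aut_one : aut.
Proof. by refine (@AlgAut _ A R id id _ _ _ _). Defined.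

Definition aut_comp (f g : aut) : aut.
Proof.
refine (@AlgAut _ A R (f \o g) (aut_inv g \o aut_inv f) _ _ _ _).
- by move=> a x y; rewrite /= !aut_linear.
- by move=> x y; rewrite /= !aut_mul.
- exact: can_comp (@aut_funK _ _ _ f) (@aut_funK _ _ _ g).
- exact: can_comp (@aut_invK _ _ _ g) (@aut_invK _ _ _ f).
Defined.

Definition aut_opp (f : aut) : aut.
Proof.
refine (@AlgAut _ A R (aut_inv f) f _ _ (@aut_invK _ _ _ f) (@aut_funK _ _ _ f)).
- by move=> a x y; apply: (can_inj (@aut_funK _ _ _ f));
    rewrite aut_linear !aut_invK.
- by move=> x y; apply: (can_inj (@aut_funK _ _ _ f));
    rewrite aut_mul !aut_invK.
Defined.

Fact aut_compA : associative aut_comp. Proof. by move=> f g h; exact: algAutP. Qed.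
Fact aut_comp1 : left_id aut_one aut_comp. Proof. by move=> f; exact: algAutP. Qed.
Fact aut_comp1r : right_id aut_one aut_comp.
Proof. by move=> f; exact: algAutP. Qed.
Fact aut_compV : left_inverse aut_one aut_opp aut_comp.
Proof. by move=> f; apply: algAutP => x /=; rewrite aut_funK. Qed.
Fact aut_compVr : right_inverse aut_one aut_opp aut_comp.
Proof. by move=> f; apply: algAutP => x /=; rewrite aut_invK. Qed.
HB.instance Definition _ := isGroup.Build aut
  aut_compA aut_comp1 aut_comp1r aut_compV aut_compVr.

End AutGroup.

Section AutMap.
Variables (F : fieldType) (A : fdAlgebra F).

(** The [S]-linear extension of [f : A ⊗ R -> A ⊗ R] along [R -> S]. *)
Definition base_change (R S : commAlgebra F) (g : calgHom R S)
    (f : sext A R -> sext A R) : sext A S -> sext A S :=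
  sext_lift (fun v => sext_change g (f (sext_in R v))).

Section BaseChange.
Variables (R S : commAlgebra F) (g : calgHom R S).

Lemma base_changeE f x : linear f ->
  base_change g f (sext_change g x) = sext_change g (f x).
Proof.
move=> fL; pose f' : {linear sext A R -> sext A R} :=
  HB.pack f (GRing.isLinear.Build R (sext A R) (sext A R) _ f fL).
rewrite [in RHS](sext_sum x) -[f _]/(f' _) /sext_lift linear_sum.
rewrite sext_change_sum; apply: eq_bigr => i _.
by rewrite linearZ sext_changeZ mxE.
Qed.

Lemma sext_change_mul (x y : sext A R) :
  sext_change g (sext_mul x y) = sext_mul (sext_change g x) (sext_change g y).
Proof.
rewrite /sext_mul /sext_lift sext_change_sum; apply: eq_bigr => i _.
rewrite sext_changeZ sext_change_sum !mxE; congr (_ *: _).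
by apply: eq_bigr => j _; rewrite sext_changeZ sext_change_in mxE.
Qed.

Lemma sext_change_ext (W : lmodType S) (h h' : sext A S -> W) :
  linear h -> linear h' ->
  (forall x, h (sext_change g x) = h' (sext_change g x)) -> h =1 h'.
Proof.
move=> hL h'L hh'.
pose k : {linear sext A S -> W} :=
  HB.pack h (GRing.isLinear.Build S (sext A S) W _ h hL).
pose k' : {linear sext A S -> W} :=
  HB.pack h' (GRing.isLinear.Build S (sext A S) W _ h' h'L).
apply: (sext_ext (h := k) (h' := k')) => v.
by rewrite -(sext_change_in g); exact: hh'.
Qed.

Lemma base_change_linear f : linear (base_change g f).
Proof. exact: sext_lift_is_linear. Qed.

Lemma base_changeK f f' : linear f -> linear f' -> cancel f f' ->
  cancel (base_change g f) (base_change g f').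
Proof.
move=> fL f'L fK x.
apply: (sext_change_ext (h := base_change g f' \o base_change g f) (h' := id)).
- by move=> a u v; rewrite /= !base_change_linear.
- by [].
- by move=> y; rewrite /= !base_changeE// fK.
Qed.

Lemma base_changeM f : linear f ->
  (forall x y, f (sext_mul x y) = sext_mul (f x) (f y)) ->
  forall x y, base_change g f (sext_mul x y) =
    sext_mul (base_change g f x) (base_change g f y).
Proof.
move=> fL fM x y.
apply: (sext_change_ext (h := fun x => base_change g f (sext_mul x y))
  (h' := fun x => sext_mul (base_change g f x) (base_change g f y))).
- by move=> a u v; rewrite sext_mul_linearl base_change_linear.
- by move=> a u v; rewrite base_change_linear sext_mul_linearl.
move=> {}x; apply: (sext_change_ext
  (h := fun y => base_change g f (sext_mul (sext_change g x) y))
  (h' := fun y => sext_mul (base_change g f (sext_change g x))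
                           (base_change g f y))).
- by move=> a u v; rewrite sext_mul_linearr base_change_linear.
- by move=> a u v; rewrite base_change_linear sext_mul_linearr.
by move=> {}y; rewrite -sext_change_mul !base_changeE// fM sext_change_mul.
Qed.

Definition aut_map (f : algAut A R) : algAut A S :=
  AlgAut (base_change_linear f) (base_changeM (aut_linear f) (aut_mul f))
    (base_changeK (aut_linear f) (aut_linear (f^-1)%g) (@aut_funK _ _ _ f))
    (base_changeK (aut_linear (f^-1)%g) (aut_linear f) (@aut_invK _ _ _ f)).

End BaseChange.

Lemma aut_map_change R S (g : calgHom R S) (f : algAut A R) x :
  aut_map g f (sext_change g x) = sext_change g (f x).
Proof. exact: base_changeE (aut_linear f). Qed.

Fact aut_mapM R S (g : calgHom R S) (f f' : algAut A R) :
  aut_map g (f * f')%g = (aut_map g f * aut_map g f')%g.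
Proof.
apply: algAutP; apply: (sext_change_ext (g := g)).
- exact: aut_linear.
- exact: aut_linear.
by move=> x; rewrite aut_map_change /= !base_changeE//; exact: aut_linear.
Qed.

Fact aut_map_id R (f : algAut A R) : aut_map (calg_id R) f = f.
Proof.
have idE (x : sext A R) : sext_change (calg_id R) x = x.
  by apply/rowP => i; rewrite mxE.
by apply: algAutP => x; rewrite -{1}[x]idE aut_map_change idE.
Qed.

Fact aut_map_comp R S T (g : calgHom S T) (h : calgHom R S)
  (f : algAut A R) : aut_map (calg_comp g h) f = aut_map g (aut_map h f).
Proof.
have compE (x : sext A R) :
    sext_change (calg_comp g h) x = sext_change g (sext_change h x).
  by apply/rowP => i; rewrite !mxE.
apply: algAutP; apply: (sext_change_ext (g := calg_comp g h)).
- exact: aut_linear.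
- exact: aut_linear.
by move=> x; rewrite aut_map_change !compE !aut_map_change.
Qed.

Definition AutScheme : groupFunctor F :=
  @GroupFunctor F (fun R => algAut A R : groupType) aut_map
    aut_mapM aut_map_id aut_map_comp.

Definition AutInvol (sigma : {linear A -> A}) (R : commAlgebra F) :
    set (AutScheme R) :=
  [set f : algAut A R |
    forall x, f (sext_map R sigma x) = sext_map R sigma (f x)].

End AutMap.
Arguments AutScheme {F} A.
Arguments AutInvol {F A} sigma R _.

(** [h] identifies the algebra [B] with the subspace [S] of [A] endowed with
    the commutator product. *)
Record identifies (F : fieldType) (B A : fdAlgebra F) (h : {linear B -> A})
  (S : set A) : Prop := Identifies {
  identifies_inj : injective h;
  identifies_range : range h = S;
  identifies_mul : forall x y, h (amul x y) = acomm (h x) (h y) }.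

(** Under the identification of [B] with a subspace of [A] by [h], the
    automorphism [f'] of [B ⊗ R] is the restriction of [f]. *)
Definition restricts_to (F : fieldType) (B A : fdAlgebra F)
  (h : {linear B -> A}) (R : commAlgebra F) (f : algAut A R)
  (f' : algAut B R) : Prop :=
  forall x, f (sext_map R h x) = sext_map R h (f' x).

Section CayleyFamily.
Variables (F : fieldType) (n : nat) (C : 'I_n -> cayleyAlgebra F).

Definition cayleyTensor : fdAlgebra F := tensorAlgebra C.
Definition cayleyProd : fdAlgebra F := prodAlgebra C.
Definition cayleySkewProd : fdAlgebra F :=
  prodAlgebra (fun i => skewAlgebra (C i)).

Definition tensor_conj : {linear cayleyTensor -> cayleyTensor} :=
  tensor_map (fun i => @hconj F (C i) : {linear C i -> C i}).

(** [1 ⊗ ... ⊗ x ⊗ ... ⊗ 1], with [x] in position [i]. *)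
Definition tensor_at (i : 'I_n) (x : C i) : cayleyTensor :=
  pure (dfwith (fun j => hone (C j)) x).

(** The embedding of the product of the [C_0^i] onto [N'_alt]. *)
Definition skew_tensor (x : cayleySkewProd) : cayleyTensor :=
  \sum_i tensor_at (vsval ((x : dprod _) i)).

Fact skew_tensor_is_linear : linear skew_tensor.
Proof.
move=> a x y; rewrite /skew_tensor scaler_sumr -big_split/=.
apply: eq_bigr => i _; rewrite dprodDE dprodZE linearP.
exact: pure_multilinear.
Qed.
HB.instance Definition _ := GRing.isLinear.Build F
  cayleySkewProd cayleyTensor _ skew_tensor skew_tensor_is_linear.

Definition skew_incl (x : cayleySkewProd) : cayleyProd :=
  [ffun i => vsval ((x : dprod _) i)] : dprod C.

Fact skew_incl_is_linear : linear skew_incl.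
Proof.
move=> a x y; apply/dprodP => i.
rewrite [RHS](dprodDE (V := C)) (dprodZE (V := C)) !ffunE.
exact: linearP.
Qed.
HB.instance Definition _ := GRing.isLinear.Build F
  cayleySkewProd cayleyProd _ skew_incl skew_incl_is_linear.

End CayleyFamily.

(* Main.v *)
(** Let [L] be the product of the [C_0^i] over [R], let [f] be an automorphism
    of [L] with inverse [g], let [f_ij : C_0^j -> C_0^i] be the blocks of [f]
    and, for a fixed [i], let [M_j] be the image of [f_ij].  The [M_j] commute
    with each other and are perfect, so that they are orthogonal since the polar
    form is associative for the commutator.  The identity
      [[[x,y],z] + [[x,z],y] = -4 n(y,z) x + 2 n(x,y) z + 2 n(x,z) y]
    then gives [n(M_j, M_j) M_k = 0] for [j <> k].  Hence, if [n(u,v) = 1], the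
    scalars [e_ij = n(f_ij g_ji u, v)] are orthogonal idempotents which sum to 1
    over [j]; those of [g] form the transposed matrix, so that they also sum to
    1 over [i].  This extends [f] to the product of the [C^j] by
    [1_j |-> sum_i e_ij 1_i], and then to their tensor product by
    [z_1 ⊗ ... ⊗ z_n |-> (f z)_1 ⊗ ... ⊗ (f z)_n], which is multilinear because
    after multiplication by [e_ij] only the [i]-th factor depends on [z_j].

    Conversely, automorphisms over [R] preserve [N_alt], which is cut out by
    linear equations over [F].  For [i <> j] the tensor
    [(a, u_i, v_i w_j) - (u_i, v_i w_j, a)] is obtained from [a] by applying
    [(-, u, v)] in position [i] and [[-, w]] in position [j]; the nucleus and the
    commutative centre of a Cayley algebra are [F 1], so that the elements of
    [N_alt] have no component which is skew in two positions. *)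

From HB Require Import structures.
Require Import Defs.
From mathcomp Require Import all_boot all_algebra sesquilinear ring.
From mathcomp Require Import boolp classical_sets.

Set Implicit Arguments.
Unset Strict Implicit.
Unset Printing Implicit Defensive.

Import GRing.Theory.

Local Open Scope ring_scope.
Local Open Scope classical_set_scope.

(** * Cayley algebras *)

(** Over a field, an automorphism of the product of the [C_0^i] permutes the factors. Over [R],
    which may have idempotents, such a permutation exists only locally on the spectrum; the matrix
    [e_ij] describes it without localizing. The two restriction maps are shown to be bijective for
    each [R] separately: injective because the skew elements and the unit generate, surjective by
    explicit extension. For the extension to be multiplicative, the commutator must determine the
    product. For skew [x], [y] one has [xy = [x,y]/2 - n(x,y)/2], so the blocks must also respect
    the norm, up to [e_ij]. They do, since the double commutator identity expresses the norm through
    brackets. Facts about Cayley algebras are proved over [F] and recast as identities between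
    linear maps, which pass to [R] because they can be tested on the vectors [v ⊗ 1]. Compatibility
    with the involution comes for free: the extension commutes with it by construction, and by
    injectivity every automorphism is the extension of its restriction. *)

Lemma two_neq0 (F : fieldType) : 2%N \notin [pchar F] -> (2 : F) != 0.
Proof. by rewrite inE. Qed.

Section Hurwitz.
Variables (F : fieldType) (C : cayleyAlgebra F).
Hypothesis charF : 2%N \notin [pchar F].
Implicit Types x y z u v : C.

Let n2 : (2 : F) != 0 := two_neq0 charF.

Local Notation p := (polar (hnorm C)).
Local Notation nm := (hnorm C).
Local Notation "x ⋅ y" := (amul (x : C) (y : C)) (at level 40, left associativity).
Local Notation e := (hone C).

Lemma polarZl a x y : p (a *: x) y = a * p x y.
Proof.
have [_ qL] := hnorm_quad C; have := qL y a x 0.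
have p0 : p 0 y = 0 by rewrite -(subrr y) polarDl polarNl subrr.
by rewrite p0 !addr0.
Qed.
Lemma polarDr x y z : p x (y + z) = p x y + p x z.
Proof. by rewrite !(polarC x) polarDl. Qed.
Lemma polarNr x y : p x (- y) = - p x y.
Proof. by rewrite !(polarC x) polarNl. Qed.
Lemma polarZr a x y : p x (a *: y) = a * p x y.
Proof. by rewrite !(polarC x) polarZl. Qed.

Definition polarE := (polarDl, polarDr, polarNl, polarNr, polarZl, polarZr).

Lemma amulNl x y : (- x) ⋅ y = - (x ⋅ y). Proof. exact: linearNl. Qed.
Lemma amulNr x y : x ⋅ (- y) = - (x ⋅ y). Proof. exact: linearNr. Qed.
Lemma amulZl a x y : (a *: x) ⋅ y = a *: (x ⋅ y). Proof. exact: linearZl_LR. Qed.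
Lemma amulZr a x y : x ⋅ (a *: y) = a *: (x ⋅ y). Proof. exact: linearZr_LR. Qed.
Definition amulE := (amulDl, amulDr, amulNl, amulNr, amulZl, amulZr).

Lemma hnormZ a x : nm (a *: x) = a ^+ 2 * nm x.
Proof. by have [-> _] := hnorm_quad C. Qed.
Lemma hnormD x y : nm (x + y) = nm x + nm y + p x y.
Proof. by rewrite /polar; ring. Qed.
Lemma polarxx x : p x x = 2 * nm x.
Proof. by rewrite /polar -mulr2n -scaler_nat hnormZ; ring. Qed.

Lemma polar_inj x y : (forall z, p x z = p y z) -> x = y.
Proof.
move=> h; apply/eqP; rewrite -subr_eq0; apply/eqP/hnorm_nondeg => z.
by rewrite !polarE h subrr.
Qed.

Lemma hone_neq0 : e != 0.
Proof.
apply/negP => /eqP e0.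
have : (\dim {: C} <= \dim (0%VS : {vspace C}))%N.
  apply: dimvS; apply/subvP => x _.
  by rewrite -(hmul1l x) e0 linear0l mem0v.
by rewrite cayley_dim dimv0.
Qed.

Lemma hnorm1 : nm e = 1.
Proof.
have : nm e != 0.
  apply: contraNneq hone_neq0 => n0; apply/eqP/polar_inj => z.
  have nz x : nm x = 0 by rewrite -(hmul1l x) hnormM n0 mul0r.
  by rewrite /polar !nz.
by move=> /mulfI; apply; rewrite -hnormM hmul1l mulr1.
Qed.

Lemma polarMr x y z : p (x ⋅ z) (y ⋅ z) = p x y * nm z.
Proof. by rewrite /polar -amulDl !hnormM; ring. Qed.
Lemma polarMl x y z : p (z ⋅ x) (z ⋅ y) = nm z * p x y.
Proof. by rewrite /polar -amulDr !hnormM; ring. Qed.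

(** Polarization of [polarMr] in its last variable. With one argument equal to 1 it yields the
    adjoints of the multiplications, from which the alternative laws follow. *)
Lemma polarM4 x y z u :
  p (x ⋅ z) (y ⋅ u) + p (x ⋅ u) (y ⋅ z) = p x y * p z u.
Proof.
have := polarMr x y (z + u); rewrite hnormD !amulE !polarE !polarMr => E.
transitivity (p x y * (nm z + nm u + p z u) - p x y * nm z - p x y * nm u).
  by rewrite -E; ring.
by ring.
Qed.

Lemma polarMV x y z : p (x ⋅ y) z = p x (z ⋅ hconj y).
Proof.
rewrite /hconj !(amulE, polarE) hmul1r.
have := polarM4 x z y e; rewrite !hmul1r => E.
by rewrite (mulrC (p y e)) -E addrK.
Qed.

Lemma polarVM x y z : p (x ⋅ y) z = p y (hconj x ⋅ z).
Proof.
rewrite /hconj !(amulE, polarE) hmul1l.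
have := polarM4 x e y z; rewrite !hmul1l => E.
by rewrite -E (polarC y) addrK.
Qed.

Lemma polar11 : p e e = 2. Proof. by rewrite polarxx hnorm1 mulr1. Qed.

Lemma polar_hconj1 x : p (hconj x) e = p x e.
Proof. by rewrite /hconj !polarE polar11; ring. Qed.

Lemma hconjK x : hconj (hconj x) = x.
Proof. by rewrite {1}/hconj polar_hconj1 /hconj opprB addrC subrK. Qed.

Lemma hconj_mull x y : hconj x ⋅ (x ⋅ y) = nm x *: y.
Proof.
apply: polar_inj => z.
by rewrite polarVM hconjK polarMl polarE.
Qed.

Lemma hconj_mulr x y : (y ⋅ x) ⋅ hconj x = nm x *: y.
Proof.
by apply: polar_inj => z; rewrite polarMV hconjK polarMr polarE mulrC.
Qed.

Lemma mul_hconj x : x ⋅ hconj x = nm x *: e.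
Proof. by rewrite -{1}(hmul1l x) hconj_mulr. Qed.

Lemma amul_xx x : x ⋅ x = p x e *: x - nm x *: e.
Proof. by rewrite -mul_hconj /hconj !amulE hmul1r opprB addrC subrK. Qed.

(** Substituting [hconj x = n(x,1) 1 - x] in [hconj_mull] turns it into the left alternative law. *)
Lemma assocxx x y : associator x x y = 0.
Proof.
apply/eqP; rewrite /associator subr_eq0 amul_xx !amulE hmul1l; apply/eqP.
by rewrite -hconj_mull /hconj !amulE hmul1l opprB addrC subrK.
Qed.

Lemma assoc_xx x y : associator y x x = 0.
Proof.
apply/eqP; rewrite /associator subr_eq0 amul_xx !amulE hmul1r; apply/eqP.
by rewrite -hconj_mulr /hconj !amulE hmul1r opprB addrC subrK.
Qed.

Lemma assocDl x y z u : associator (x + y) z u = associator x z u + associator y z u.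
Proof. by rewrite /associator !amulE opprD addrACA. Qed.
Lemma assocDm x y z u : associator z (x + y) u = associator z x u + associator z y u.
Proof. by rewrite /associator !amulE opprD addrACA. Qed.
Lemma assocDr x y z u : associator z u (x + y) = associator z u x + associator z u y.
Proof. by rewrite /associator !amulE opprD addrACA. Qed.

Lemma assocC12 x y z : associator x y z = - associator y x z.
Proof.
apply/eqP; rewrite -addr_eq0; have := assocxx (x + y) z.
by rewrite assocDl !assocDm !assocxx add0r addr0 => ->.
Qed.

Lemma assocC23 x y z : associator x y z = - associator x z y.
Proof.
apply/eqP; rewrite -addr_eq0; have := assoc_xx (y + z) x.
by rewrite assocDm !assocDr !assoc_xx add0r addr0 => ->.
Qed.

Lemma skewE x : (x \in skew_space C) = (p x e == 0).
Proof.
rewrite mem_skew_space /hconj -subr_eq0 opprK subrK scaler_eq0.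
by rewrite (negPf hone_neq0) orbF.
Qed.

Lemma skewP x : reflect (p x e = 0) (x \in skew_space C).
Proof. by rewrite skewE; exact: eqP. Qed.

Lemma skew_anti x y : x \in skew_space C -> y \in skew_space C ->
  x ⋅ y + y ⋅ x = - p x y *: e.
Proof.
move=> /skewP xS /skewP yS.
have sq z : p z e = 0 -> z ⋅ z = - nm z *: e.
  by move=> z0; rewrite amul_xx z0 scale0r sub0r scaleNr.
have := sq (x + y); rewrite !(polarE, amulE) xS yS addr0 => /(_ erefl).
move=> E.
have -> : - p x y *: e = (- nm (x + y) *: e) - (- nm x *: e) - (- nm y *: e).
  by rewrite -!scalerBl; congr (_ *: _); rewrite /polar; ring.
by rewrite -E; apply: polar_inj => z; rewrite -!sq// !polarE; ring.
Qed.

(** Both multiplications by a skew element are skew-adjoint for the polar form. *)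
Lemma polar_skewM x y z : x \in skew_space C -> y \in skew_space C ->
  p (acomm x y) z = p x (acomm y z).
Proof.
rewrite !mem_skew_space => /eqP xS /eqP yS.
rewrite /acomm !polarE [p (y ⋅ x) z]polarVM polarMV yS !amulE !polarE; ring.
Qed.

Lemma acomm_skewE x y : x \in skew_space C -> y \in skew_space C ->
  acomm x y = 2 *: (x ⋅ y) + p x y *: e.
Proof.
move=> xS yS; apply: polar_inj => z.
have := congr1 (p^~ z) (skew_anti xS yS); rewrite /acomm !polarE => E.
have -> : p (y ⋅ x) z = - p x y * p e z - p (x ⋅ y) z by rewrite -E; ring.
by ring.
Qed.

Lemma mul_skewE x y : x \in skew_space C -> y \in skew_space C ->
  x ⋅ y = 2^-1 *: acomm x y - (2^-1 * p x y) *: e.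
Proof.
move=> xS yS; rewrite acomm_skewE// scalerDr !scalerA mulVf// scale1r.
by rewrite addrK.
Qed.

(** By [acomm_skewE] it all reduces to [(xy)z + (xz)y], which the alternative law equates with
    [x(yz + zy) = - n(y,z) x]. *)
Lemma acomm_acomm x y z : x \in skew_space C -> y \in skew_space C ->
    z \in skew_space C ->
  acomm (acomm x y) z + acomm (acomm x z) y =
  - (4 * p y z) *: x + (2 * p x y) *: z + (2 * p x z) *: y.
Proof.
move=> xS yS zS.
rewrite (acomm_skewE (acomm_skew x y) zS) (acomm_skewE (acomm_skew x z) yS).
rewrite (acomm_skewE xS yS) (acomm_skewE xS zS) !amulE !hmul1l.
have E : (x ⋅ y) ⋅ z + (x ⋅ z) ⋅ y = - p y z *: x.
  have := assocC23 x y z; rewrite /associator => A.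
  have -> : - p y z *: x = x ⋅ (y ⋅ z) + x ⋅ (z ⋅ y).
    by rewrite -amulDr skew_anti// !amulE hmul1r.
  apply: polar_inj => w; have := congr1 (p^~ w) A; rewrite !polarE => {}A.
  have -> : p ((x ⋅ y) ⋅ z) w =
    - (p ((x ⋅ z) ⋅ y) w - p (x ⋅ (z ⋅ y)) w) + p (x ⋅ (y ⋅ z)) w.
    by rewrite -A; ring.
  by ring.
(* The form [n(xy, z)] is alternating in [y] and [z], so the components of the two double
   commutators along the unit cancel. *)
have E2 : p (x ⋅ z) y = - p (x ⋅ y) z.
  move: xS; rewrite mem_skew_space => /eqP xS.
  by rewrite [p (x ⋅ y) z]polarVM xS !amulE polarNr opprK polarC.
apply: polar_inj => w; have := congr1 (p^~ w) E; rewrite !polarE E2.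
move=> {}E; rewrite [p (_ ⋅ _ ⋅ y) w](_ : _ = - p y z * p x w - p (x ⋅ y ⋅ z) w).
  have {zS}/skewP := zS; have {yS}/skewP := yS.
  by rewrite !(polarC _ e) => -> ->; ring.
by rewrite -E; ring.
Qed.

Lemma acommDr x y z : acomm z (x + y) = acomm z x + acomm z y.
Proof. by rewrite /acomm !amulE opprD addrACA. Qed.
Lemma acommZr a x y : acomm x (a *: y) = a *: acomm x y.
Proof. by rewrite /acomm !amulE scalerBr. Qed.
Lemma acommC x y : acomm x y = - acomm y x.
Proof. by rewrite /acomm opprB. Qed.
Lemma acomme x : acomm x e = 0.
Proof. by rewrite /acomm hmul1l hmul1r subrr. Qed.

Lemma acomm_sqr x y : x \in skew_space C -> y \in skew_space C ->
  acomm (acomm x y) y = - (4 * nm y) *: x + (2 * p x y) *: y.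
Proof.
move=> xS yS; have := acomm_acomm xS yS yS; rewrite polarxx => E.
apply: (scalerI n2); rewrite scaler_nat mulr2n E.
by apply: polar_inj => w; rewrite !polarE; ring.
Qed.

(** Half of the usual trace, so that [htr x *: e] is the scalar component of [x]. *)
Definition htr x : F := 2^-1 * p x e.

Lemma htr_is_linear : linear (htr : C -> F^o).
Proof. by move=> a x y; rewrite /htr !polarE mulrDr mulrCA. Qed.

Lemma htrP a x y : htr (a *: x + y) = a * htr x + htr y.
Proof. exact: htr_is_linear. Qed.

Lemma htr1 : htr e = 1. Proof. by rewrite /htr polar11 mulVf. Qed.

Lemma htr_skew x : x \in skew_space C -> htr x = 0.
Proof. by rewrite /htr => /skewP ->; rewrite mulr0. Qed.

Lemma sub_htr_skew x : x - htr x *: e \in skew_space C.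
Proof.
by apply/skewP; rewrite /htr !polarE polar11 mulrAC mulVf// mul1r subrr.
Qed.

Lemma hconj_htr x : hconj x = htr x *: e - (x - htr x *: e).
Proof.
apply: polar_inj => w; rewrite /hconj !polarE /htr.
by rewrite [in LHS](_ : p x e = 2 * (2^-1 * p x e)); [ring|rewrite mulrA mulfV// mul1r].
Qed.

(** The orthogonal projection [pr] onto the span of [s] exists because [p x x = 2 n(x)] is
    invertible for [x] in [s]. If the orthogonal complement were totally isotropic, polarization and
    nondegeneracy would make it zero, and fewer than 8 vectors would span. *)
Lemma exists_anisotropic (s : seq C) : (size s < 8)%N ->
    (forall x, x \in s -> nm x != 0) ->
    (forall x y, x \in s -> y \in s -> x != y -> p x y = 0) -> uniq s ->
  exists2 v, nm v != 0 & forall x, x \in s -> p x v = 0.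
Proof.
move=> sz s_an s_orth us; apply: contrapT => /forall2NP noV.
have iso v : (forall x, x \in s -> p x v = 0) -> nm v = 0.
  by move=> vs; have [/negP/negPn/eqP|] := noV v.
pose pr w := \sum_(x <- s) (p x w / (2 * nm x)) *: x.
have p0 u : p u 0 = 0 by rewrite -(subrr u) polarDr polarNr subrr.
have psum z w : p z (pr w) = \sum_(x <- s) (p x w / (2 * nm x)) * p z x.
  by rewrite (big_morph _ (polarDr z) (p0 z)); apply: eq_bigr => x _; rewrite polarZr.
have pr_perp w x : x \in s -> p x (w - pr w) = 0.
  move=> xs; rewrite polarDr polarNr psum (bigD1_seq x)//= big_seq_cond big1 => [|y].
    by rewrite addr0 polarxx mulfVK ?subrr// mulf_neq0// s_an.
  by case/andP=> ys yx; rewrite (s_orth x y)// ?mulr0// eq_sym.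
have perp0 v : (forall x, x \in s -> p x v = 0) -> v = 0.
  move=> vs; apply: polar_inj => w; rewrite [RHS]polarC p0.
  have -> : w = (w - pr w) + pr w by rewrite subrK.
  rewrite polarDr psum [X in _ + X]big_seq big1 => [|x xs].
    rewrite addr0 /polar !iso ?subrr// => x xs; first exact: pr_perp.
    by rewrite polarDr vs// pr_perp// addr0.
  by rewrite (polarC v) vs// mulr0.
have : (\dim {: C} <= \dim <<s>>%VS)%N.
  apply: dimvS; apply/subvP => w _.
  have -> : w = pr w by apply/eqP; rewrite -subr_eq0; apply/eqP/perp0/pr_perp.
  by rewrite /pr big_seq; apply: rpred_sum => x xs; rewrite memvZ// memv_span.
by rewrite cayley_dim leqNgt (leq_ltn_trans (dim_span s)).
Qed.

Lemma polar_orth_neq x y : nm x != 0 -> p x y = 0 -> x != y.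
Proof.
move=> nx; apply: contra_eqN => /eqP <-.
by rewrite polarxx mulf_neq0.
Qed.

(** The start of a Cayley-Dickson process: [1, c, u, cu] span a quaternion subalgebra and [v] is
    orthogonal to it. Orthogonality of [v] to [cu] is what prevents [c, u, v] from associating. *)
Lemma cayley_basic_triple : exists c u v, [/\ [/\ c \in skew_space C,
  u \in skew_space C & v \in skew_space C], [/\ nm c != 0, nm u != 0 & nm v != 0],
  [/\ p c u = 0, p c v = 0 & p u v = 0] & p (c ⋅ u) v = 0].
Proof.
have ne : nm e != 0 by rewrite hnorm1 oner_neq0.
have skew x : p e x = 0 -> x \in skew_space C by rewrite polarC => /skewP.
have [|||//|c nc /(_ e) /[!inE] /(_ (eqxx _)) ec] := @exists_anisotropic [:: e].
- by [].
- by move=> x /[!inE] /eqP->.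
- by move=> x y /[!inE] /eqP-> /eqP->; rewrite eqxx.
have [|||//|u nu us] := @exists_anisotropic [:: e; c].
- by [].
- by move=> x /[!inE] /orP[]/eqP->.
- by move=> x y /[!inE] /orP[]/eqP-> /orP[]/eqP->; rewrite ?eqxx// polarC.
- by rewrite /= inE polar_orth_neq.
have eu : p e u = 0 by apply: us; rewrite inE eqxx.
have cu : p c u = 0 by apply: us; rewrite !inE eqxx orbT.
have ncu : nm (c ⋅ u) != 0 by rewrite hnormM mulf_neq0.
have ccu : p c (c ⋅ u) = 0 by rewrite -{1}(hmul1r c) polarMl eu mulr0.
have ucu : p u (c ⋅ u) = 0 by rewrite -{1}(hmul1l u) polarMr ec mul0r.
have ecu : p e (c ⋅ u) = 0.
  move: (skew _ ec); rewrite mem_skew_space => /eqP cS.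
  by rewrite polarC polarVM cS hmul1r polarNr polarC cu oppr0.
have [|||//|v nv vs] := @exists_anisotropic [:: e; c; u; c ⋅ u].
- by [].
- by move=> x /[!inE] /or4P[]/eqP->.
- by move=> x y /[!inE] /or4P[]/eqP-> /or4P[]/eqP->; rewrite ?eqxx// polarC.
- by rewrite /= !inE !negb_or !polar_orth_neq.
exists c, u, v; split=> //.
- by split; apply: skew => //; apply: vs; rewrite !inE eqxx.
- by split=> //; apply: vs; rewrite !inE eqxx ?orbT.
- by apply: vs; rewrite !inE eqxx ?orbT.
Qed.

(* Applying [ad_y^2 + 4 n(y)], then [ad_z^2 + 4 n(z)], kills [x]. *)
Lemma acomm_resolve x y z : x \in skew_space C -> y \in skew_space C ->
    z \in skew_space C -> p y z = 0 ->
  (16 * nm y * nm z) *: x =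
  - acomm (acomm (acomm (acomm x y) y) z) z - (4 * nm z) *: acomm (acomm x y) y
  - (4 * nm y) *: acomm (acomm x z) z.
Proof.
move=> xS yS zS yz.
rewrite (acomm_sqr (acomm_skew _ y) zS) !acomm_sqr// polarDl !polarZl yz.
by apply: polar_inj => w; rewrite !polarE; ring.
Qed.

(* The skew elements of the nucleus form a space stable under all [ad_y]; by
   [acomm_sqr] it is 0 or everything, and the triple of [cayley_basic_triple]
   does not associate. *)
Lemma nucleus_scalar c : (forall u v, associator c u v = 0) -> c - htr c *: e = 0.
Proof.
pose N x := forall u v, associator x u v = 0.
have ND x y : N x -> N y -> N (x + y).
  by move=> xN yN u v; rewrite assocDl xN yN addr0.
have assocZl a x u v : associator (a *: x) u v = a *: associator x u v.
  by rewrite /associator !amulE scalerBr.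
have NZ a x : N x -> N (a *: x).
  by move=> xN u v; rewrite assocZl xN scaler0.
have Ne : N e by move=> u v; rewrite /associator !hmul1l subrr.
(* For nuclear [x], [(xa,u,v) = x(a,u,v)], while [(ax,u,v) = (a,xu,v) = -(xu,a,v) = -x(u,a,v) =
   x(a,u,v)]. *)
have Nacomm x a : N x -> N (acomm x a).
  move=> xN u v.
  have xN2 y z : associator y x z = 0 by rewrite assocC12 xN oppr0.
  have E1 b w d : associator (x ⋅ b) w d = x ⋅ associator b w d.
    have := xN (b ⋅ w) d; have := xN b (w ⋅ d); have := xN b w.
    rewrite /associator !amulE => /subr0_eq E /subr0_eq <- /subr0_eq <-.
    by rewrite E.
  have E2 b d : associator (b ⋅ x) u d = associator b (x ⋅ u) d.
    rewrite /associator.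
    have := xN2 b u; have := xN2 b (u ⋅ d); have := xN u d; rewrite /associator.
    by move=> /subr0_eq <- /subr0_eq -> /subr0_eq ->.
  rewrite /acomm assocDl -(scaleN1r (a ⋅ x)) assocZl E1 E2.
  rewrite (assocC12 a (x ⋅ u)) E1 (assocC12 u a) linearNr opprK.
  by rewrite scaleN1r subrr.
move=> cN; apply: contrapT => /eqP c0.
pose d := c - htr c *: e.
have dS : d \in skew_space C by exact: sub_htr_skew.
have dN : N d by apply: ND => //; rewrite -scaleNr; exact: NZ.
(* Since [N] contains [x] and is stable under [ad_y], solving [acomm_sqr] for its last term shows
   that [N] contains [y]. *)
have np1 x y : x \in skew_space C -> y \in skew_space C -> N x -> p x y != 0 -> N y.
  move=> xS yS xN xy.
  have -> : y = (2 * p x y)^-1 *: (acomm (acomm x y) y + (4 * nm y) *: x).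
    rewrite acomm_sqr// addrAC -scalerDl addNr scale0r add0r scalerA.
    by rewrite mulVf ?scale1r// mulf_neq0.
  by apply: (NZ); apply: ND; [apply: (Nacomm); apply: (Nacomm)|apply: (NZ)].
have [y yS dy] : exists2 y, y \in skew_space C & p d y != 0.
  apply: contrapT => /forall2NP noy; apply/negP: c0; rewrite negbK; apply/eqP.
  rewrite -/d; apply: polar_inj => w; rewrite -[w](subrK (htr w *: e)) (polarDr d) (polarDr
    0) !polarZr.
  have [/(_ (sub_htr_skew w))//|/negP/negPn/eqP->] := noy (w - htr w *: e).
  have /skewP -> := dS; rewrite !mulr0.
  have p0 u : p 0 u = 0 by rewrite -(subrr w) polarDl polarNl subrr.
  by rewrite !p0 mulr0.
have Nall x : x \in skew_space C -> N x.
  move=> xS; have [dx|dx] := eqVneq (p d x) 0; last exact: (np1 d).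
  have -> : x = (x + y) - y by rewrite addrK.
  apply: ND; last by rewrite -scaleN1r; apply: NZ; apply: (np1 d).
  by apply: (np1 d) => //; rewrite ?rpredD// polarDr dx add0r.
have [b [u [v [[bS uS vS] [nb nu nv] [bu bv uv] buv]]]] := cayley_basic_triple.
have anti x z : x \in skew_space C -> z \in skew_space C -> p x z = 0 ->
    x ⋅ z = - (z ⋅ x).
  by move=> xS zS xz; apply/eqP; rewrite -addr_eq0 skew_anti// xz oppr0 scale0r.
have buS : b ⋅ u \in skew_space C.
  move: (bS); rewrite mem_skew_space => /eqP b'.
  by apply/skewP; rewrite polarVM b' hmul1r polarNr polarC bu oppr0.
(* Orthogonal skew elements anticommute. The right-hand side has nonzero norm because the norm is
   multiplicative. *)
have A : associator b u v = 2 *: (b ⋅ u ⋅ v).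
  have E : b ⋅ (v ⋅ u) = - (v ⋅ (b ⋅ u)).
    have := assocC12 b v u; rewrite /associator => A; apply/eqP.
    rewrite -addr_eq0; have := skew_anti bS vS; rewrite bv oppr0 scale0r => B.
    have := congr1 (amul^~ u) B; rewrite linear0l amulDl => <-.
    apply/eqP/polar_inj => w; have := congr1 (p^~ w) A; rewrite !polarE => {}A.
    have -> : p (b ⋅ v ⋅ u) w = p (b ⋅ (v ⋅ u)) w -(p (v ⋅ b ⋅ u) w - p (v ⋅ (b ⋅ u)) w).
      by rewrite -A; ring.
    by ring.
  rewrite /associator (anti u v)// amulNr E opprK (anti v)//; last by rewrite polarC.
  by rewrite opprK scaler_nat.
have : nm (associator b u v) = 0.
  by rewrite (Nall b bS) -(scale0r b) hnormZ expr0n mul0r.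
by rewrite A hnormZ !hnormM => /eqP; rewrite !mulf_eq0 (negPf n2) (negPf nb) (negPf nu)
  (negPf nv).
Qed.
End Hurwitz.

(** * Homomorphisms between products of vector-product algebras *)

(* [C_0 ⊗ R] with the commutator and the polar form of the norm.  The last
   property replaces the comparison of coefficients in a basis. *)
Record crossProduct (R : comPzRingType) (L : lmodType R)
    (br : L -> L -> L) (be : L -> L -> R) : Prop := CrossProduct {
  cp_linear : forall y, linear (br^~ y);
  cp_anti : forall x y, br x y = - br y x;
  cp_scalar : forall y, scalar (be^~ y);
  cp_sym : forall x y, be x y = be y x;
  cp_assoc : forall x y z, be (br x y) z = be x (br y z);
  cp_double : forall x y z, br (br x y) z + br (br x z) y =
    - (4 * be y z) *: x + (2 * be x y) *: z + (2 * be x z) *: y;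
  cp_perfect : forall x, exists a b c d, x = br a b + br c d;
  cp_unimodular : exists x y, be x y = 1;
  cp_rigid : forall mu : L -> L -> R, (forall y, scalar (mu^~ y)) ->
    (forall x y, mu x y = mu y x) ->
    (forall x y, mu y y *: x = mu x y *: y) -> forall x y, mu x y = 0 }.

Section CrossProduct.
Variables (R : comPzRingType) (L : lmodType R).
Variables (br : L -> L -> L) (be : L -> L -> R).
Hypothesis cp : crossProduct br be.

Lemma cp_brDl x y z : br (x + y) z = br x z + br y z.
Proof. by have := cp_linear cp z 1 x y; rewrite !scale1r. Qed.
Lemma cp_br0l z : br 0 z = 0.
Proof. by apply: (addrI (br 0 z)); rewrite -cp_brDl !addr0. Qed.

Lemma cp_beDl x y z : be (x + y) z = be x z + be y z.
Proof. by have := cp_scalar cp z 1 x y; rewrite scale1r mul1r. Qed.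
Lemma cp_be0l z : be 0 z = 0.
Proof. by apply: (addrI (be 0 z)); rewrite -cp_beDl !addr0. Qed.
Lemma cp_beZl a x z : be (a *: x) z = a * be x z.
Proof. by have := cp_scalar cp z a x 0; rewrite !addr0 cp_be0l addr0. Qed.
Lemma cp_beDr x y z : be z (x + y) = be z x + be z y.
Proof. by rewrite !(cp_sym cp z) cp_beDl. Qed.
Lemma cp_be0r z : be z 0 = 0.
Proof. by rewrite (cp_sym cp) cp_be0l. Qed.
Lemma cp_be_suml I (r : seq I) (E : I -> L) z :
  be (\sum_(i <- r) E i) z = \sum_(i <- r) be (E i) z.
Proof. exact: (big_morph (be^~ z) (fun x y => cp_beDl x y z) (cp_be0l z)). Qed.
Lemma cp_be_sumr I (r : seq I) (E : I -> L) z :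
  be z (\sum_(i <- r) E i) = \sum_(i <- r) be z (E i).
Proof. exact: (big_morph (be z) (fun x y => cp_beDr x y z) (cp_be0r z)). Qed.

(** Unimodularity of the form makes [L] a faithful module, so scalars can be compared through their
    action. *)
Lemma cp_scalar_inj (a b : R) : (forall x : L, a *: x = b *: x) -> a = b.
Proof.
have [x [y xy]] := cp_unimodular cp.
by move=> /(_ x) /(congr1 (be^~ y)); rewrite !cp_beZl xy !mulr1.
Qed.

End CrossProduct.

(** * Blocks of an automorphism of a product and their matrix of idempotents *)

Section Blocks.
Variables (R : comPzRingType) (n : nat) (L : 'I_n -> lmodType R).
Variables (br : forall i, L i -> L i -> L i) (be : forall i, L i -> L i -> R).
Hypothesis cp : forall i, crossProduct (@br i) (@be i).
Variable half : R.
Hypothesis half2 : half * 2 = 1.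

Definition blocks := forall i j, L j -> L i.

Section OneSided.
Variables f g : blocks.
Arguments f : clear implicits.
Arguments g : clear implicits.
Hypothesis f_linear : forall i j, linear (f i j).
Hypothesis fM : forall i j x y, f i j (br x y) = br (f i j x) (f i j y).
Hypothesis f_orth : forall i j k x y, j != k -> br (f i j x) (f i k y) = 0.
Hypothesis fgK : forall i (x : L i), \sum_j f i j (g j i x) = x.
Hypothesis fg0 : forall i k (x : L k), i != k -> \sum_j f i j (g j k x) = 0.

Let f_add i j x y : f i j (x + y) = f i j x + f i j y.
Proof. by have := @f_linear i j 1 x y; rewrite !scale1r. Qed.

Lemma block_be_orth i j k x y : j != k -> be (f i j x) (f i k y) = 0.
Proof.
move=> jk; have [a [b [c [d ->]]]] := cp_perfect (cp j) x.
rewrite f_add !fM (cp_beDl (cp i)) !(cp_assoc (cp i)) !f_orth//.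
by rewrite !(cp_be0r (cp i)) addr0.
Qed.

Lemma block_be_ann i j k x y z : j != k ->
  be (f i j x) (f i j y) *: f i k z = 0.
Proof.
move=> jk; have := cp_double (cp i) (f i j x) (f i j y) (f i k z).
rewrite !(@block_be_orth _ _ _ _ _ jk) -fM !(@f_orth _ _ _ _ _ jk) (cp_br0l (cp i)) !addr0.
rewrite !mulr0 oppr0 !scale0r add0r addr0 => /esym/(congr1 (fun w => half *: w)).
by rewrite scalerA mulrA half2 mul1r scaler0.
Qed.

Lemma block_idempotents : exists e : 'I_n -> 'I_n -> R,
  [/\ forall i j k, j != k -> e i j * e i k = 0,
      forall i, \sum_j e i j = 1,
      forall i j x, e i j *: f i j x = f i j x,
      forall i j x, f i j (g j i x) = e i j *: x
    & forall i j k x, i != k -> f i j (g j k x) = 0].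
Proof.
have w i : {w : L i * L i | be w.1 w.2 = 1}.
  by apply: cid; have [x [y xy]] := cp_unimodular (cp i); exists (x, y).
pose uv i := sval (w i); have uv1 i : be (uv i).1 (uv i).2 = 1 := svalP (w i).
pose e i j := be (f i j (g j i (uv i).1)) (uv i).2.
(* Writing the second vector as the sum of its images under [f i k (g k i _)], orthogonality leaves
   only [k = j]. This puts [e i j] among the values of the form on the image of [f i j], where
   [block_be_ann] applies. *)
have eE i j : e i j = be (f i j (g j i (uv i).1)) (f i j (g j i (uv i).2)).
  rewrite /e -{1}(fgK (uv i).2) (cp_be_sumr (cp i)) (bigD1 j)//= big1 ?addr0// => k kj.
  by rewrite block_be_orth// eq_sym.
have e_ann i j k x : j != k -> e i j *: f i k x = 0.
  by move=> jk; rewrite eE block_be_ann.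
have e1 i : \sum_j e i j = 1 by rewrite /e -(cp_be_suml (cp i)) fgK.
have ef i j x : e i j *: f i j x = f i j x.
  rewrite -[RHS]scale1r -(e1 i) scaler_suml (bigD1 j)//= big1 ?addr0// => k kj.
  exact: e_ann.
have ee i j k : j != k -> e i j * e i k = 0.
  by move=> jk; rewrite {2}/e -(cp_beZl (cp i)) e_ann// (cp_be0l (cp i)).
exists e; split=> // [i j x|i j k x ik].
  (* Multiplying a sum over all blocks by [e i j] isolates its [j]-th term; the same device gives
     the vanishing of each term of [fg0] below. *)
  rewrite -{2}(fgK x) scaler_sumr (bigD1 j)//= big1 ?addr0 ?ef// => k kj.
  by rewrite e_ann// eq_sym.
rewrite -ef -[RHS](scaler0 (L i) (e i j)) -(fg0 x ik) scaler_sumr (bigD1 j)//= big1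
  ?addr0// => l lj.
by rewrite e_ann// eq_sym.
Qed.

End OneSided.

Variables f g : blocks.
Arguments f : clear implicits.
Arguments g : clear implicits.
Hypothesis f_linear : forall i j, linear (f i j).
Hypothesis fM : forall i j x y, f i j (br x y) = br (f i j x) (f i j y).
Hypothesis f_orth : forall i j k x y, j != k -> br (f i j x) (f i k y) = 0.
Hypothesis fgK : forall i (x : L i), \sum_j f i j (g j i x) = x.
Hypothesis fg0 : forall i k (x : L k), i != k -> \sum_j f i j (g j k x) = 0.
Hypothesis g_linear : forall i j, linear (g i j).
Hypothesis gM : forall i j x y, g i j (br x y) = br (g i j x) (g i j y).
Hypothesis g_orth : forall i j k x y, j != k -> br (g i j x) (g i k y) = 0.
Hypothesis gfK : forall i (x : L i), \sum_j g i j (f j i x) = x.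
Hypothesis gf0 : forall i k (x : L k), i != k -> \sum_j g i j (f j k x) = 0.

Let linZ i j (h : L j -> L i) a x : linear h -> h (a *: x) = a *: h x.
Proof.
move=> hL; have h0 : h 0 = 0.
  by apply: (addrI (h 0)); have := hL 1 0 0; rewrite !scale1r addr0 => <-; rewrite addr0.
by have := hL a x 0; rewrite !addr0 h0 addr0.
Qed.

Let linD i j (h : L j -> L i) x y : linear h -> h (x + y) = h x + h y.
Proof. by move=> hL; have := hL 1 x y; rewrite !scale1r. Qed.

Lemma block_matrix : exists e : 'I_n -> 'I_n -> R,
  [/\ (forall i j k, j != k -> e i j * e i k = 0) /\
      (forall i j k, i != k -> e i j * e k j = 0),
      (forall i, \sum_j e i j = 1) /\ (forall j, \sum_i e i j = 1),
      (forall i j x, e i j *: f i j x = f i j x) /\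
      (forall i j x, e i j *: g j i x = g j i x),
      (forall i j k x, i != k -> f i j (g j k x) = 0) /\
      (forall i j k x, i != k -> g i j (f j k x) = 0)
    & (forall i j x y, be (f i j x) (f i j y) = e i j * be x y) /\
      (forall i j x y, be (g j i x) (g j i y) = e i j * be x y)].
Proof.
have [e [ee e1 ef efg fg0']] := block_idempotents f_linear fM f_orth fgK fg0.
have [d [dd d1 dg dgf gf0']] := block_idempotents g_linear gM g_orth gfK gf0.
(* [e i j] acts as [f i j] after [g j i], and [d j i] fixes the image of [g j i], hence [e = d e];
   symmetrically [d = e d]. *)
have de i j : d j i = e i j.
  have h1 : e i j = d j i * e i j.
    apply: (cp_scalar_inj (cp i)) => x.
    by rewrite -scalerA -!efg -{1}dg linZ.
  have h2 : d j i = e i j * d j i.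
    apply: (cp_scalar_inj (cp j)) => x.
    by rewrite -scalerA -!dgf -{1}ef linZ.
  by rewrite h1 mulrC -h2.
(* Let [mu(x,y) = e n(x,y) - n(f x, f y)]. Taking the double commutator of [x, y, y] before or after
   applying [f], and pulling both results back by [g], gives [mu(y,y) x = mu(x,y) y] once 4 is
   inverted; [cp_rigid] then forces [mu = 0]. *)
have form (f' g' : blocks) (e' : 'I_n -> 'I_n -> R) :
    (forall i j, linear (f' i j)) -> (forall i j, linear (g' i j)) ->
    (forall i j x y, f' i j (br x y) = br (f' i j x) (f' i j y)) ->
    (forall i j x, e' i j *: f' i j x = f' i j x) ->
    (forall i j x, g' j i (f' i j x) = e' i j *: x) ->
  forall i j x y, be (f' i j x) (f' i j y) = e' i j * be x y.
  move=> f'L g'L f'M e'f' g'f' i j x y; apply/esym/subr0_eq; move: x y.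
  apply: (cp_rigid (cp j)) => [y a x x'|x y|x y].
  - by rewrite f'L !(cp_beDl (cp _)) !(cp_beZl (cp _)); ring.
  - by rewrite (cp_sym (cp j)) (cp_sym (cp i)).
  have ebe a b : be (f' i j a) (f' i j b) * e' i j = be (f' i j a) (f' i j b).
    by rewrite mulrC -(cp_beZl (cp i)) e'f'.
  have := congr1 (g' j i) (cp_double (cp i) (f' i j x) (f' i j y) (f' i j y)).
  rewrite -!f'M -(linD _ _ (f'L i j)) (cp_double (cp j)).
  rewrite !(linD _ _ (f'L i j)) !(linD _ _ (g'L j i)) !(linZ _ _ (f'L i j)) !(linZ _ _ (g'L
    j i)) !g'f' !scalerA => E.
  have q4 : half * half * 4 = 1.
    by rewrite (_ : 4 = 2 * 2); [rewrite mulrA -(mulrA half) half2 mulr1 half2|ring].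
  have swap (a s b t : L j) : a + s = b + t -> b - a = s - t.
    move=> h; have -> : b = a + s - t by rewrite h addrK.
    by rewrite -(addrA a) [LHS]addrC addKr.
  move: E; rewrite -!addrA -!scalerDl => /swap; rewrite -!scalerBl.
  move=> /(congr1 (fun w => (half * half) *: w)); rewrite !scalerA => E.
  transitivity ((half * half * 4) *: ((e' i j * be y y - be (f' i j y) (f' i j y)) *: x)).
    by rewrite q4 scale1r.
  transitivity ((half * half * 4) *: ((e' i j * be x y - be (f' i j x) (f' i j y)) *: y)).
    rewrite -(ebe y y) -(ebe x y) !scalerA; move: E; congr (_ *: _ = _ *: _); ring.
  by rewrite q4 scale1r.
exists e; split; split=> //.
- by move=> i j k ik; rewrite -!de dd.
- by move=> j; rewrite -(d1 j); apply: eq_bigr => i _; rewrite de.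
- by move=> i j x; rewrite -de.
- by apply: (form _ _ _ f_linear g_linear fM ef) => i j x; rewrite dgf de.
- move=> i j x y; rewrite -de.
  by apply: (form _ _ _ g_linear f_linear gM dg) => k l z; rewrite efg de.
Qed.

End Blocks.

(** * Scalar extension and restriction of automorphisms *)

Definition mklin (R : pzRingType) (U V : lmodType R) (f : U -> V)
  (fL : linear f) : {linear U -> V} :=
  HB.pack f (GRing.isLinear.Build R U V *:%R f fL).

Section LinearClosure.
Variables (R : comPzRingType) (U V W : lmodType R).

Lemma lin_id : linear (fun x : U => x). Proof. by []. Qed.
Lemma lin_0 : linear (fun x : U => (0 : V)).
Proof. by move=> a x y; rewrite scaler0 addr0. Qed.
Lemma lin_comp (h : {linear V -> W}) (f : U -> V) :
  linear f -> linear (fun x => h (f x)).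
Proof. by move=> fL a x y; rewrite fL linearP. Qed.
Lemma lin_comp' (h : V -> W) (f : U -> V) :
  linear h -> linear f -> linear (fun x => h (f x)).
Proof. by move=> hL fL a x y; rewrite fL hL. Qed.
Lemma lin_add (f g : U -> V) : linear f -> linear g -> linear (fun x => f x + g x).
Proof. by move=> fL gL a x y; rewrite fL gL scalerDr addrACA. Qed.
Lemma lin_opp (f : U -> V) : linear f -> linear (fun x => - f x).
Proof. by move=> fL a x y; rewrite fL opprD scalerN. Qed.
Lemma lin_scale c (f : U -> V) : linear f -> linear (fun x => c *: f x).
Proof. by move=> fL a x y; rewrite fL scalerDr !scalerA mulrC. Qed.
Lemma lin_form (b : U -> R) (v : V) : scalar b -> linear (fun x => b x *: v).
Proof. by move=> bL a x y; rewrite bL scalerDl scalerA. Qed.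
Lemma lin_sum (I : finType) (E : I -> U -> V) :
  (forall i, linear (E i)) -> linear (fun x => \sum_i E i x).
Proof.
move=> EL a x y; rewrite scaler_sumr -big_split; apply: eq_bigr => i _; exact: EL.
Qed.

Lemma linearD_of (f : U -> V) x y : linear f -> f (x + y) = f x + f y.
Proof. by move=> fL; exact: (linearD (mklin fL)). Qed.
Lemma linearZ_of (f : U -> V) a x : linear f -> f (a *: x) = a *: f x.
Proof. by move=> fL; exact: (linearZZ (mklin fL)). Qed.
Lemma linear0_of (f : U -> V) : linear f -> f 0 = 0.
Proof. by move=> fL; exact: (linear0 (mklin fL)). Qed.
Lemma linear_sum_of (f : U -> V) I (r : seq I) (E : I -> U) : linear f ->
  f (\sum_(i <- r) E i) = \sum_(i <- r) f (E i).
Proof. by move=> fL; exact: (linear_sum (mklin fL)). Qed.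
End LinearClosure.

Section Factor.
Variables (F : fieldType) (V W W' : vectType F) (K : finType).

(* Turns an inclusion of kernels into an identity between linear maps, which
   survives extension of scalars. *)
Lemma linear_factor (h : K -> {linear V -> W}) (q : {linear V -> W'}) :
    (forall x, (forall k, h k x = 0) -> q x = 0) ->
  exists phi : K -> {linear W -> W'}, forall x, q x = \sum_k phi k (h k x).
Proof.
move=> hq.
have HL : linear (fun x => [ffun k => h k x] : {ffun K -> W}).
  by move=> a x y; apply/ffunP => k; rewrite !ffunE linearP.
pose H := linfun (mklin HL).
have HE x : H x = [ffun k => h k x] by rewrite lfunE.
pose d k w : {ffun K -> W} := [ffun l => if l == k then w else 0].
(* [H] collects all the [h k] and [H^-1] is a generalized inverse: [x - H^-1 (H x)] lies in every
   kernel, so [q x] can be read off [H x], one coordinate [d k] at a time. *)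
have phiL k : linear (fun w => q ((H^-1)%VF (d k w))).
  have dL : linear (d k).
    move=> a x y; apply/ffunP => l; rewrite !ffunE; case: ifP => // _.
    by rewrite scaler0 addr0.
  by move=> a x y; rewrite dL !linearP.
exists (fun k => mklin (phiL k)) => x /=.
have -> : \sum_k q ((H^-1)%VF (d k (h k x))) = q ((H^-1)%VF (H x)).
  rewrite HE -!linear_sum; congr (q (_ _)); apply/ffunP => l.
  rewrite sum_ffunE (bigD1 l)//= !ffunE eqxx big1 ?addr0// => k kl.
  by rewrite ffunE eq_sym (negPf kl).
apply/eqP; rewrite -subr_eq0 -linearB; apply/eqP/hq => k.
have : H (x - (H^-1)%VF (H x)) = 0.
  by rewrite linearB /= limg_lfunVK ?subrr// memv_img// memvf.
by rewrite HE => /ffunP /(_ k); rewrite !ffunE.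
Qed.

End Factor.

Section Sext.
Variables (F : fieldType) (R : commAlgebra F).
Implicit Types (U V W : vectType F).

Lemma sext_lin_ext V (M : lmodType R) (h h' : sext V R -> M) :
  linear h -> linear h' -> (forall v, h (sext_in R v) = h' (sext_in R v)) ->
  forall x, h x = h' x.
Proof. by move=> hL h'L; exact: (@sext_ext _ _ _ _ (mklin hL) (mklin h'L)). Qed.

Lemma sext_map_sumcomp U V W (K : finType) (g : {linear U -> W})
    (phi : K -> {linear V -> W}) (h : K -> {linear U -> V}) :
  (forall u, g u = \sum_k phi k (h k u)) ->
  forall x, sext_map R g x = \sum_k sext_map R (phi k) (sext_map R (h k) x).
Proof.
move=> gE; apply: sext_lin_ext => [||u]; first exact: lin_comp.
  by apply: lin_sum => k; do 2!apply: lin_comp.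
rewrite /= sext_map_in gE; under eq_bigr do rewrite !sext_map_in.
apply: (big_morph (@sext_in F W R) (@sext_inD _ _ _)).
by rewrite -[0 in LHS](scale0r (0 : W)) sext_inZ rmorph0 scale0r.
Qed.

Lemma sext_map_comp U V W (g : {linear U -> W}) (a : {linear V -> W})
    (b : {linear U -> V}) : (forall u, g u = a (b u)) ->
  forall x, sext_map R g x = sext_map R a (sext_map R b x).
Proof.
move=> gE; apply: sext_lin_ext => [||u]; do ?[exact: lin_comp|apply: lin_comp].
by rewrite !sext_map_in gE.
Qed.

Lemma sext_map_id V (g : {linear V -> V}) : (forall v, g v = v) ->
  forall x, sext_map R g x = x.
Proof.
move=> gE; apply: sext_lin_ext => [||u]; do ?[exact: lin_comp|apply: lin_comp].
  exact: lin_id.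
by rewrite !sext_map_in gE.
Qed.

Lemma sext_in0 V : sext_in R (0 : V) = 0.
Proof. by rewrite -[0 in LHS](scale0r (0 : V)) sext_inZ rmorph0 scale0r. Qed.

Lemma sext_map0 V W (g : {linear V -> W}) : (forall v, g v = 0) ->
  forall x, sext_map R g x = 0.
Proof.
move=> gE; apply: sext_lin_ext => [||u]; do ?[exact: lin_comp|apply: lin_comp].
  exact: lin_0.
by rewrite !sext_map_in gE sext_in0.
Qed.

Variable A : fdAlgebra F.
Implicit Types x y z : sext A R.

Lemma sext_mulDl x y z : sext_mul (x + y) z = sext_mul x z + sext_mul y z.
Proof. exact: (linearD_of _ _ (sext_mul_linearl z)). Qed.
Lemma sext_mulDr x y z : sext_mul z (x + y) = sext_mul z x + sext_mul z y.
Proof. exact: (linearD_of _ _ (sext_mul_linearr z)). Qed.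
Lemma sext_mulZl a x z : sext_mul (a *: x) z = a *: sext_mul x z.
Proof. exact: (linearZ_of _ _ (sext_mul_linearl z)). Qed.
Lemma sext_mulZr a x z : sext_mul z (a *: x) = a *: sext_mul z x.
Proof. exact: (linearZ_of _ _ (sext_mul_linearr z)). Qed.
Lemma sext_mul0l z : sext_mul 0 z = 0.
Proof. exact: (linear0_of (sext_mul_linearl z)). Qed.
Lemma sext_mul0r z : sext_mul z 0 = 0.
Proof. exact: (linear0_of (sext_mul_linearr z)). Qed.

Lemma lin_mull (M : lmodType R) (f : M -> sext A R) z :
  linear f -> linear (fun w : M => sext_mul (f w) z).
Proof. by move=> fL; exact: lin_comp' (sext_mul_linearl z) fL. Qed.
Lemma lin_mulr (M : lmodType R) (f : M -> sext A R) z :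
  linear f -> linear (fun w : M => sext_mul z (f w)).
Proof. by move=> fL; exact: lin_comp' (sext_mul_linearr z) fL. Qed.

Definition sext_comm x y := sext_mul x y - sext_mul y x.

Lemma sext_comm_in u v :
  sext_comm (sext_in R u) (sext_in R v) = sext_in R (acomm u v).
Proof.
rewrite /sext_comm !sext_mul_in /acomm sext_inD; congr (_ + _).
by rewrite -!scaleN1r sext_inZ rmorphN1.
Qed.

End Sext.

Ltac lin :=
  repeat first [ apply: lin_add | apply: lin_opp | apply: lin_mull | apply: lin_mulr
    | apply: lin_scale | apply: lin_id | apply: lin_0
    | match goal with |- context [sext_map] => apply: lin_comp end ].

Section Restriction.
Variables (F : fieldType) (A B : fdAlgebra F) (h : {linear B -> A}).
Hypothesis h_inj : injective h.
Hypothesis hM : forall x y, h (amul x y) = acomm (h x) (h y).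

Lemma sext_map_comm R (x y : sext B R) :
  sext_map R h (sext_mul x y) = sext_comm (sext_map R h x) (sext_map R h y).
Proof.
move: x; apply: sext_lin_ext => [||u]; rewrite /sext_comm; [by lin|by lin|].
move: y; apply: sext_lin_ext => [||v]; [by lin|by lin|].
by rewrite -/(sext_comm _ _) !sext_map_in sext_comm_in sext_mul_in sext_map_in hM.
Qed.

Let hV : {linear A -> B} := ((linfun h)^-1)%VF.

(** Over the field [F] the injection [h] has a linear retraction, and an identity between linear
    maps extends to [R]. *)
Lemma sext_mapK R : cancel (sext_map R h) (sext_map R hV).
Proof.
have hK v : hV (h v) = v.
  have hk0 : lker (linfun h) == 0%VS by apply/lker0P => a b; rewrite !lfunE; exact: h_inj.
  by have := lker0_lfunK hk0 v; rewrite lfunE.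
move=> x; rewrite -(@sext_map_comp _ _ _ _ _ (mklin (@lin_id _ _))) ?sext_map_id//.
Qed.

Hypothesis h_stable : forall R (f : algAut A R) x,
  exists y, f (sext_map R h x) = sext_map R h y.
Hypothesis h_faithful : forall R (f : algAut A R),
  (forall x, f (sext_map R h x) = sext_map R h x) -> forall x, f x = x.
Hypothesis h_lift : forall R (f' : algAut B R), exists f : algAut A R,
  restricts_to h f f'.

Section Restr.
Variables (R : commAlgebra F) (f : algAut A R).

Definition restr_fun (f : algAut A R) x := sext_map R hV (f (sext_map R h x)).

Lemma restr_funE (g : algAut A R) x :
  sext_map R h (restr_fun g x) = g (sext_map R h x).
Proof.
by rewrite /restr_fun; have [y ->] := h_stable g x; rewrite sext_mapK.
Qed.

Fact restr_linear : linear (restr_fun f).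
Proof. by move=> a x y; rewrite /restr_fun linearP aut_linear linearP. Qed.

Fact restr_mul x y :
  restr_fun f (sext_mul x y) = sext_mul (restr_fun f x) (restr_fun f y).
Proof.
apply: (can_inj (@sext_mapK R)); rewrite restr_funE !sext_map_comm !restr_funE.
by rewrite /sext_comm -!aut_mul -scaleN1r addrC aut_linear scaleN1r addrC.
Qed.

Fact restrK : cancel (restr_fun f) (restr_fun (aut_opp f)).
Proof.
by move=> x; apply: (can_inj (@sext_mapK R)); rewrite !restr_funE /= aut_funK.
Qed.
Fact restrVK : cancel (restr_fun (aut_opp f)) (restr_fun f).
Proof.
by move=> x; apply: (can_inj (@sext_mapK R)); rewrite !restr_funE /= aut_invK.
Qed.

Definition restr : algAut B R := AlgAut restr_linear restr_mul restrK restrVK.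

End Restr.

(** Stability makes the restriction map well defined. Its inverse is chosen pointwise from [h_lift],
    since naturality is required of the restriction only; it is a left inverse because two
    automorphisms with the same restriction differ by one that [h_faithful] makes trivial. *)
Lemma restriction_iso : exists Phi : groupFunctorIso (AutScheme A) (AutScheme B),
  forall (R : commAlgebra F) (f : AutScheme A R), restricts_to h f (Phi R f).
Proof.
have rE R (f : algAut A R) : restricts_to h f (restr f).
  by move=> x; rewrite /= restr_funE.
have runi R (f : algAut A R) (f' : algAut B R) : restricts_to h f f' -> restr f = f'.
  move=> ff'; apply: algAutP => x; apply: (can_inj (@sext_mapK R)).
  by rewrite -ff' -rE.
pose Phi R : AutScheme A R -> AutScheme B R := @restr R.
have PhiM R (f g : AutScheme A R) : Phi R (f * g)%g = (Phi R f * Phi R g)%g.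
  by apply: runi => x /=; rewrite !restr_funE.
have PhiN R S (c : calgHom R S) (f : AutScheme A R) :
    Phi S (gf_map c f) = gf_map c (Phi R f).
  have change x : sext_map S h (sext_change c x) = sext_change c (sext_map R h x).
    rewrite /sext_map /sext_lift sext_change_sum; apply: eq_bigr => i _.
    by rewrite sext_changeZ sext_change_in mxE.
  (* Linear maps on the extension to [S] are determined by the vectors coming from [R]. *)
  apply: runi; apply: (sext_change_ext (g := c)) => [||x].
  - by move=> a x y; rewrite linearP aut_linear.
  - by move=> a x y; rewrite aut_linear linearP.
  by rewrite /= change !base_changeE ?change ?rE//; (exact: aut_linear || exact: restr_linear).
have Phi_bij R : bijective (Phi R).
  pose Psi (f' : AutScheme B R) : AutScheme A R := sval (cid (h_lift f')).
  have PsiE f' : restricts_to h (Psi f') f' := svalP (cid (h_lift f')).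
  exists Psi => [f|f']; last exact: runi.
  apply: (mulgI (f^-1)%g); rewrite mulVg; apply: algAutP.
  apply: h_faithful => x /=.
  by rewrite PsiE -(rE R f) aut_funK.
by exists (GroupFunctorIso PhiM PhiN Phi_bij) => R f; exact: rE.
Qed.

End Restriction.

(** * Operators on a tensor product *)

Section TensorOps.
Variables (F : fieldType) (n : nat) (V : 'I_n -> vectType F).
Implicit Types (x : forall i, V i) (t : tensor V).

Lemma tensor_lin_ext (W : lmodType F) (h h' : tensor V -> W) :
  linear h -> linear h' -> (forall x, h (pure x) = h' (pure x)) ->
  forall t, h t = h' t.
Proof. by move=> hL h'L; exact: (@tensor_ext _ _ _ _ (mklin hL) (mklin h'L)). Qed.

Lemma dfwith_id (T : 'I_n -> Type) (x : forall i, T i) i : dfwith x (x i) = x.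
Proof. by apply: functional_extensionality_dep => j; case: dfwithP. Qed.

Lemma dfwith2 (T : 'I_n -> Type) (x : forall i, T i) i (v w : T i) :
  dfwith (dfwith x v) w = dfwith x w.
Proof.
by apply: functional_extensionality_dep => j; case: dfwithP => [|k ik];
  rewrite ?dfwith_in// !dfwith_out.
Qed.

Lemma dfwithC (T : 'I_n -> Type) (x : forall i, T i) i j (v : T i) (w : T j) :
  i != j -> dfwith (dfwith x v) w = dfwith (dfwith x w) v.
Proof.
move=> ij; apply: functional_extensionality_dep => k.
case: dfwithP => [|l jl]; first by rewrite dfwith_out// dfwith_in.
by case: dfwithP jl => [_|m im jm]; rewrite ?dfwith_in// !dfwith_out.
Qed.

Lemma dfwith_map (T T' : 'I_n -> Type) (h : forall i, T i -> T' i)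
    (x : forall i, T i) i (v : T i) :
  (fun j => h j (dfwith x v j)) = dfwith (fun j => h j (x j)) (h i v).
Proof.
by apply: functional_extensionality_dep => j; case: dfwithP => [|k ik];
  rewrite ?dfwith_in ?dfwith_out.
Qed.

Lemma pure_scale (c : 'I_n -> F) x :
  pure (fun i => c i *: x i) = (\prod_i c i) *: pure x.
Proof.
apply: tensorP => k; rewrite tensorZE !ffunE -big_split; apply: eq_bigr => i _.
by rewrite linearZ.
Qed.

(** The operator [1 ⊗ ... ⊗ phi ⊗ ... ⊗ 1]. *)
Definition op_at i (phi : {linear V i -> V i}) : {linear tensor V -> tensor V} :=
  tensor_map (dfwith (T := fun j => {linear V j -> V j}) (fun j => idfun) phi).

Lemma op_at_pure i (phi : {linear V i -> V i}) x :
  op_at phi (pure x) = pure (dfwith x (phi (x i))).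
Proof.
rewrite /op_at /= tensor_map_pure; congr pure.
apply: functional_extensionality_dep => j.
by case: (dfwithP (T := V)) => [|k ik]; rewrite ?dfwith_in ?dfwith_out.
Qed.

(** Carries a factorization obtained in a single factor by [linear_factor] over to the tensor
    product. *)
Lemma op_at_sumcomp i (K : finType) (g : {linear V i -> V i})
    (a b : K -> {linear V i -> V i}) t : (forall v, g v = \sum_k a k (b k v)) ->
  op_at g t = \sum_k op_at (a k) (op_at (b k) t).
Proof.
move=> gE; move: t; apply: tensor_lin_ext => [||x].
- exact: linearP.
- by apply: lin_sum => k; do 2!apply: lin_comp.
rewrite op_at_pure gE (linear_sum_of _ _ (@pure_multilinear F n V x i)).
by apply: eq_bigr => k _; rewrite !op_at_pure dfwith_in dfwith2.
Qed.

Lemma op_at_comp i (g a b : {linear V i -> V i}) t : (forall v, g v = a (b v)) ->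
  op_at g t = op_at a (op_at b t).
Proof.
move=> gE; rewrite (@op_at_sumcomp _ 'I_1 g (fun=> a) (fun=> b)) ?big_ord1// => v.
by rewrite big_ord1.
Qed.

Lemma op_atD i (g a b : {linear V i -> V i}) t : (forall v, g v = a v + b v) ->
  op_at g t = op_at a t + op_at b t.
Proof.
move=> gE; move: t; apply: tensor_lin_ext => [||x].
- exact: linearP.
- by apply: lin_add; exact: linearP.
by rewrite !op_at_pure gE (linearD_of _ _ (@pure_multilinear F n V x i)).
Qed.

Lemma op_atB i (g a b : {linear V i -> V i}) t : (forall v, g v = a v - b v) ->
  op_at g t = op_at a t - op_at b t.
Proof.
move=> gE; apply/eqP; rewrite -subr_eq opprK; apply/eqP/esym.
by apply: op_atD => v; rewrite gE subrK.
Qed.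

Lemma op_at_id i (g : {linear V i -> V i}) t : (forall v, g v = v) -> op_at g t = t.
Proof.
move=> gE; move: t; apply: tensor_lin_ext => [||x]; first exact: linearP.
  exact: lin_id.
by rewrite op_at_pure gE dfwith_id.
Qed.

Lemma op_atC i j (a : {linear V i -> V i}) (b : {linear V j -> V j}) t :
  i != j -> op_at a (op_at b t) = op_at b (op_at a t).
Proof.
move=> ij; move: t; apply: tensor_lin_ext => [||x].
- by do 2!apply: lin_comp.
- by do 2!apply: lin_comp.
by rewrite !op_at_pure !dfwith_out// 1?eq_sym// dfwithC// eq_sym.
Qed.

(** The tensor product of the [h i] is the composite of the commuting [op_at (h i)]; [hs s] applies
    only those with index in [s]. *)
Lemma tensor_map_fixed (h : forall i, {linear V i -> V i}) t :
  (forall i, op_at (h i) t = t) -> tensor_map h t = t.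
Proof.
move=> ht.
pose hs (s : seq 'I_n) i : {linear V i -> V i} := if i \in s then h i else idfun.
have hsE s : tensor_map (hs s) t = t.
  elim: s => [|i s IH].
    move: t {ht}; apply: tensor_lin_ext => [||x]; first exact: linearP.
      exact: lin_id.
    by rewrite tensor_map_pure.
  have [is_|nis] := boolP (i \in s).
    rewrite -[RHS]IH; congr (tensor_map _ _).
    by apply: functional_extensionality_dep => j; rewrite /hs inE; case: eqP => // ->;
      rewrite is_.
  rewrite -[RHS](ht i) -[in RHS]IH; move: t {ht IH}.
  apply: tensor_lin_ext => [||x]; first exact: linearP.
    by do 2!apply: lin_comp.
  rewrite !tensor_map_pure op_at_pure; congr pure.
  apply: functional_extensionality_dep => j; case: (dfwithP (T := V)) => [|k ik].
    by rewrite /hs inE eqxx (negPf nis).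
  by rewrite /hs inE eq_sym (negPf ik).
rewrite -[RHS](hsE (enum 'I_n)); congr (tensor_map _ _).
by apply: functional_extensionality_dep => i; rewrite /hs mem_enum.
Qed.

Lemma tensor_map_op (h : forall i, {linear V i -> V i}) i (g : {linear V i -> V i}) t :
  (forall v, h i (g v) = h i v) -> tensor_map h (op_at g t) = tensor_map h t.
Proof.
move=> hg; move: t; apply: tensor_lin_ext => [||x]; first by do 2!apply: lin_comp.
  exact: linearP.
by rewrite op_at_pure !tensor_map_pure (dfwith_map (fun j => h j : V j -> V j)) hg dfwith_id.
Qed.

Lemma tensor_map_op0 (h : forall i, {linear V i -> V i}) i (g : {linear V i -> V i}) t :
  (forall v, h i (g v) = 0) -> tensor_map h (op_at g t) = 0.
Proof.
move=> hg; move: t; apply: tensor_lin_ext => [||x]; first by do 2!apply: lin_comp.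
  exact: lin_0.
by rewrite op_at_pure !tensor_map_pure (dfwith_map (fun j => h j : V j -> V j)) hg
  (linear0_of (@pure_multilinear F n V _ i)).
Qed.

End TensorOps.

(** * The generalized alternative nucleus *)

Section FdAlgebra.
Variables (F : fieldType) (A : fdAlgebra F).
Implicit Types x y z : A.

Lemma amul_linearl y : linear (fun x : A => amul x y).
Proof. by move=> a u v; rewrite linearPl. Qed.
Lemma amul_linearr x : linear (fun y : A => amul x y).
Proof. by move=> a u v; rewrite linearPr. Qed.
Definition rmul y : {linear A -> A} := mklin (@amul_linearl y).
Definition lmul x : {linear A -> A} := mklin (@amul_linearr x).

Lemma lin_amull (M : lmodType F) (f : M -> A) z :
  linear f -> linear (fun w : M => amul (f w) z).
Proof. by move=> fL; exact: lin_comp' (@amul_linearl z) fL. Qed.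
Lemma lin_amulr (M : lmodType F) (f : M -> A) z :
  linear f -> linear (fun w : M => amul z (f w)).
Proof. by move=> fL; exact: lin_comp' (@amul_linearr z) fL. Qed.

Lemma assoc_linear1 y z : linear (fun x => associator x y z).
Proof.
rewrite /associator; apply: lin_add; [do 2!apply: lin_amull; exact: lin_id|].
by apply/lin_opp/lin_amull/lin_id.
Qed.
Lemma assoc_linear2 y z : linear (fun x => associator y x z).
Proof.
rewrite /associator; apply: lin_add; [by apply/lin_amull/lin_amulr/lin_id|].
by apply/lin_opp/lin_amulr/lin_amull/lin_id.
Qed.
Lemma assoc_linear3 y z : linear (fun x => associator y z x).
Proof.
rewrite /associator; apply: lin_add; [by apply/lin_amulr/lin_id|].
by apply/lin_opp/lin_amulr/lin_amulr/lin_id.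
Qed.
Lemma acomm_linearl y : linear (fun x => acomm x y).
Proof.
rewrite /acomm; apply: lin_add; [by apply/lin_amull/lin_id|].
by apply/lin_opp/lin_amulr/lin_id.
Qed.
Lemma acomm_linearr y : linear (fun x => acomm y x).
Proof.
rewrite /acomm; apply: lin_add; [by apply/lin_amulr/lin_id|].
by apply/lin_opp/lin_amull/lin_id.
Qed.

Lemma basis_ext (W : lmodType F) (h h' : A -> W) : linear h -> linear h' ->
  (forall k : 'I_(\dim {: A}), h (vbasis {: A})`_k = h' (vbasis {: A})`_k) ->
  forall x, h x = h' x.
Proof.
move=> hL h'L hh' x; rewrite (coord_basis (vbasisP _) (memvf x)).
rewrite (linear_sum_of _ _ hL) (linear_sum_of _ _ h'L); apply: eq_bigr => k _.
by rewrite (linearZ_of _ _ hL) (linearZ_of _ _ h'L) hh'.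
Qed.

Definition assoc_op u v : {linear A -> A} := mklin (@assoc_linear1 u v).
Definition ad_op u : {linear A -> A} := mklin (@acomm_linearl u).

End FdAlgebra.

(** * Scalar and skew projections of a Cayley algebra *)

Section CayleyOps.
Variables (F : fieldType) (C : cayleyAlgebra F).
Hypothesis charF : 2%N \notin [pchar F].

Definition scal_op : {linear C -> C} :=
  mklin (lin_form (hone C) (@htr_is_linear F C)).

Fact skew_op_linear : linear (fun x => x - htr x *: hone C).
Proof. by apply: lin_add; [exact: lin_id|apply: lin_opp; exact: (linearP scal_op)]. Qed.
Definition skew_op : {linear C -> C} := mklin skew_op_linear.

Lemma scal_skew_op v : v = scal_op v + skew_op v. Proof. by rewrite /= addrC subrK. Qed.

Lemma htr_skew_op x : htr (skew_op x) = 0.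
Proof. by rewrite htr_skew// sub_htr_skew. Qed.

Lemma scal_op_skew_op v : scal_op (skew_op v) = 0.
Proof. by rewrite /= htr_skew_op scale0r. Qed.

Lemma skew_opK v : skew_op (skew_op v) = skew_op v.
Proof. by rewrite {1}/skew_op/= htr_skew_op scale0r subr0. Qed.

(** An element killed by all [(-,u,v)] is nuclear, hence scalar, so the skew part factors through
    these operators; basis vectors [u, v] suffice and keep the family finite. *)
Lemma skew_op_assoc : exists phi :
    'I_(\dim {: C}) * 'I_(\dim {: C}) -> {linear C -> C},
  forall x, skew_op x =
    \sum_k phi k (assoc_op (vbasis {: C})`_k.1 (vbasis {: C})`_k.2 x).
Proof.
apply: (linear_factor (V := C) (W := C) (W' := C)) => x x0.
apply: (nucleus_scalar charF) => u v; move: u.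
apply: basis_ext => [||k]; [exact: assoc_linear2|exact: lin_0|].
move: v; apply: basis_ext => [||l]; [exact: assoc_linear3|exact: lin_0|].
exact: (x0 (k, l)).
Qed.

Lemma skew_op_ad : exists phi : 'I_(\dim {: C}) -> {linear C -> C},
  forall x, skew_op x = \sum_k phi k (ad_op (vbasis {: C})`_k x).
Proof.
apply: (linear_factor (V := C) (W := C) (W' := C)) => x x0.
have {}x0 u : acomm x u = 0.
  move: u; apply: basis_ext => [||k]; [exact: acomm_linearr|exact: lin_0|].
  exact: (x0 k).
have [c [u [v [[cS uS _] [nc nu _] [cu _ _] _]]]] := cayley_basic_triple C charF.
have s0 w : acomm (skew_op x) w = 0.
  rewrite acommC acommDr [acomm w x]acommC x0 oppr0 add0r.
  by rewrite -scaleNr acommZr acomme scaler0 oppr0.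
(* This expresses [16 n(c) n(u)] times the skew part of [x] by commutators, all of which vanish. *)
have := acomm_resolve charF (sub_htr_skew charF x) cS uS cu.
rewrite -[x - _]/(skew_op x) !s0 !(linear0_of (@acomm_linearl _ _ _)).
rewrite !oppr0 !scaler0 !subr0 => /eqP; rewrite scaler_eq0 !mulf_eq0 (negPf nc) (negPf nu)
  !orbF.
have -> : (16 : F) = 2 * 2 * 2 * 2 by ring.
by rewrite !mulf_eq0 (negPf (two_neq0 charF)) /= => /eqP.
Qed.

End CayleyOps.

(** * The generalized alternative nucleus of a tensor product of Cayley algebras *)

Section CayleyTensor.
Variables (F : fieldType) (n : nat) (C : 'I_n -> cayleyAlgebra F).
Hypothesis charF : 2%N \notin [pchar F].
Local Notation T := (cayleyTensor C).
Implicit Types (s t : T).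

Definition tensor_one : T := pure (fun i => hone (C i)).

Lemma tensor_mulE (x y : forall i, C i) :
  amul (pure x : T) (pure y : T) = pure (fun i => amul (x i) (y i)).
Proof. exact: (tensor_mul_pure (A := C)). Qed.

Lemma tensor_mul1 t : amul tensor_one t = t.
Proof.
move: t; apply: tensor_lin_ext => [||x]; first exact: (@amul_linearr F T).
  exact: lin_id.
by rewrite tensor_mulE; congr pure; apply: functional_extensionality_dep => i; exact: hmul1l.
Qed.
Lemma tensor_1mul t : amul t tensor_one = t.
Proof.
move: t; apply: tensor_lin_ext => [||x]; first exact: (@amul_linearl F T).
  exact: lin_id.
by rewrite tensor_mulE; congr pure; apply: functional_extensionality_dep => i; exact: hmul1r.
Qed.

Lemma mul_tensor_at i (u : C i) t : amul t (tensor_at u) = op_at (rmul u) t.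
Proof.
move: t; apply: tensor_lin_ext => [||x]; first exact: (@amul_linearl F T).
  exact: linearP.
rewrite /tensor_at tensor_mulE op_at_pure; congr pure.
apply: functional_extensionality_dep => j.
by case: (dfwithP (T := C)) => [|k ik]; rewrite ?dfwith_in ?dfwith_out// hmul1r.
Qed.

Lemma tensor_at_mul i (u : C i) t : amul (tensor_at u) t = op_at (lmul u) t.
Proof.
move: t; apply: tensor_lin_ext => [||x]; first exact: (@amul_linearr F T).
  exact: linearP.
rewrite /tensor_at tensor_mulE op_at_pure; congr pure.
apply: functional_extensionality_dep => j.
by case: (dfwithP (T := C)) => [|k ik]; rewrite ?dfwith_in ?dfwith_out// hmul1l.
Qed.

Lemma tensor_at_pair i j (u : C i) (v : C j) : i != j ->
  amul (tensor_at u) (tensor_at v) = pure (dfwith (dfwith (fun k => hone (C k)) u) v).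
Proof.
move=> ij; rewrite mul_tensor_at /tensor_at op_at_pure; congr (pure (dfwith _ _)).
by rewrite dfwith_out//= hmul1l.
Qed.

Lemma mul_tensor_at2 i j (u : C i) (v : C j) t : i != j ->
  amul t (amul (tensor_at u) (tensor_at v)) = op_at (rmul u) (op_at (rmul v) t).
Proof.
move=> ij; rewrite tensor_at_pair//; move: t.
apply: tensor_lin_ext => [||x]; first exact: (@amul_linearl F T).
  by do 2!apply: lin_comp.
rewrite tensor_mulE op_at_pure op_at_pure (dfwith_out (T := C)) 1?eq_sym//.
congr pure; apply: functional_extensionality_dep => k.
case: (dfwithP (T := C)) => [|l jl]; first by rewrite dfwith_out// dfwith_in.
by case: (dfwithP (T := C)) jl => [|m im jm]; rewrite ?dfwith_in ?dfwith_out// hmul1r.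
Qed.

Lemma tensor_at2_mul i j (u : C i) (v : C j) t : i != j ->
  amul (amul (tensor_at u) (tensor_at v)) t = op_at (lmul u) (op_at (lmul v) t).
Proof.
move=> ij; rewrite tensor_at_pair//; move: t.
apply: tensor_lin_ext => [||x]; first exact: (@amul_linearr F T).
  by do 2!apply: lin_comp.
rewrite tensor_mulE op_at_pure op_at_pure (dfwith_out (T := C)) 1?eq_sym//.
congr pure; apply: functional_extensionality_dep => k.
case: (dfwithP (T := C)) => [|l jl]; first by rewrite dfwith_out// dfwith_in.
by case: (dfwithP (T := C)) jl => [|m im jm]; rewrite ?dfwith_in ?dfwith_out// hmul1l.
Qed.

Lemma tensor_at_mulA i j (u v : C i) (w : C j) : i != j ->
  amul (tensor_at u) (amul (tensor_at v) (tensor_at w)) =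
  amul (tensor_at (amul u v)) (tensor_at w).
Proof.
move=> ij; rewrite !tensor_at_pair// tensor_at_mul op_at_pure.
rewrite (dfwith_out (T := C)) 1?eq_sym// dfwith_in /= dfwithC 1?eq_sym//.
by rewrite dfwith2.
Qed.

Lemma assoc_op_rmul (D : cayleyAlgebra F) (u v x : D) :
  assoc_op u v x = mklin (lin_comp (rmul v) (linearP (rmul u))) x - rmul (amul u v) x.
Proof. by []. Qed.

(** The associator is alternating, so [(x,u,v) = (u,v,x)]; the same operator is thus written with
    left multiplications instead of right ones. *)
Lemma assoc_op_lmul (D : cayleyAlgebra F) (u v x : D) :
  assoc_op u v x = lmul (amul u v) x - mklin (lin_comp (lmul u) (linearP (lmul v))) x.
Proof. by rewrite /= assocC12 assocC23 opprK. Qed.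

(** Let [D = (-,u,v)] act in position [i]. Expanding, [(a, u, vw)] is [D] followed by right
    multiplication by [w] in position [j], and [(u, vw, a)] is [D] with left multiplication by [w].
    On [Nalt] the two agree, and their difference is [D] composed with [ad_op w]. *)
Lemma assoc_ad_Nalt a i j (u v : C i) (w : C j) : i != j -> Nalt T a ->
  op_at (assoc_op u v) (op_at (ad_op w) a) = 0.
Proof.
move=> ij /(_ (tensor_at u) (amul (tensor_at v) (tensor_at w))) [A B].
have {A B} := etrans A B.
rewrite /associator (tensor_at_mulA u v w ij) (mul_tensor_at2 v w _ ij).
rewrite (mul_tensor_at2 (amul u v) w a ij) (tensor_at2_mul (amul u v) w a ij).
rewrite (tensor_at2_mul v w a ij) (mul_tensor_at u a) (tensor_at_mul u) => A.
rewrite (@op_atB _ _ _ _ (ad_op w) (rmul w) (lmul w))// linearB.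
rewrite (op_atB _ (assoc_op_rmul u v)) (op_atB (op_at (lmul w) a) (assoc_op_lmul u v)).
rewrite (@op_at_comp _ _ _ _ (mklin (lin_comp (rmul v) (linearP (rmul u)))) (rmul v) (rmul
  u))//.
rewrite (@op_at_comp _ _ _ _ (mklin (lin_comp (lmul u) (linearP (lmul v)))) (lmul u) (lmul
  v))//.
by rewrite -A (op_atC (rmul u))// subrr.
Qed.

Lemma skew_skew_Nalt a i j : i != j -> Nalt T a ->
  op_at (skew_op (C i)) (op_at (skew_op (C j)) a) = 0.
Proof.
move=> ij aN; have [phi phiE] := skew_op_assoc (C i) charF.
have [psi psiE] := skew_op_ad (C j) charF.
rewrite (op_at_sumcomp _ psiE) linear_sum big1// => l _.
rewrite (op_at_sumcomp _ phiE) big1// => k _.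
by rewrite (op_atC (assoc_op _ _))// assoc_ad_Nalt// !linear0.
Qed.

Lemma prod_dfwith (P : pred 'I_n) (g : forall j, C j -> F) (x : forall j, C j) l (w : C l) :
  \prod_(j | P j) g j (dfwith x w j) =
  (if P l then g l w else 1) * \prod_(j | P j && (j != l)) g j (x j).
Proof.
case: ifPn => Pl.
  rewrite (bigD1 l)//= dfwith_in; congr (_ * _).
  by apply: eq_bigr => j /andP[_ jl]; rewrite dfwith_out// eq_sym.
rewrite mul1r; apply: eq_big => j.
  by have [->|_] := eqVneq j l; rewrite ?(negPf Pl)// andbT.
by move=> Pj; rewrite dfwith_out//; apply: contraNneq Pl => ->.
Qed.

Lemma prod_htr_multilinear :
  multilinear (V := C) (W := F^o) (fun x => \prod_j htr (x j)).
Proof.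
move=> x l a u v; rewrite !(prod_dfwith xpredT (fun j => @htr F (C j))).
by rewrite htrP mulrDl -mulrA.
Qed.

Definition tensor_htr : {linear T -> F^o} :=
  tensor_lift (V := C) (W := F^o) (fun x => \prod_j htr (x j)).

Lemma tensor_htr_pure x : tensor_htr (pure x) = \prod_j htr (x j).
Proof. exact: tensor_lift_pure prod_htr_multilinear. Qed.

Definition skew_part i (x : C i) : skewAlgebra (C i) := Subvs (sub_htr_skew charF x).

Lemma skew_part_linear i : linear (@skew_part i).
Proof. by move=> a x y; apply/val_inj; rewrite [RHS]linearP /= (skew_op_linear a x y). Qed.

Lemma skew_part_vsval i (x : skewAlgebra (C i)) : skew_part (vsval x) = x.
Proof.
by apply/val_inj; rewrite /= htr_skew ?scale0r ?subr0//; exact: (valP x).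
Qed.

(** The coordinates of the projection onto the sum of the [C_0^i]: skew part in position [i], scalar
    parts in all the others. *)
Definition skew_coord (x : forall i, C i) : cayleySkewProd C :=
  [ffun i => (\prod_(j | j != i) htr (x j)) *: skew_part (x i)]
    : dprod (fun i => skewAlgebra (C i)).

Lemma skew_coord_multilinear : multilinear (V := C) skew_coord.
Proof.
move=> x l a u v; apply/dprodP => i.
rewrite [RHS](dprodDE (V := fun i => skewAlgebra (C i))) (dprodZE (V := fun i =>
  skewAlgebra (C i))) !ffunE.
rewrite !(prod_dfwith _ (fun j => @htr F (C j))).
have [li|li] := eqVneq l i; last first.
  by rewrite !(dfwith_out (T := C))// htrP mulrDl scalerDl -mulrA scalerA.
subst i; rewrite !dfwith_in skew_part_linear scalerDr !mul1r !scalerA.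
by rewrite mulrC.
Qed.

Definition tensor_skew : {linear T -> cayleySkewProd C} :=
  tensor_lift (V := C) skew_coord.

Lemma tensor_skew_pure x : tensor_skew (pure x) = skew_coord x.
Proof. exact: tensor_lift_pure skew_coord_multilinear. Qed.

Lemma tensor_skew_at i (y : skewAlgebra (C i)) :
  (tensor_skew (tensor_at (vsval y)) : dprod (fun i => skewAlgebra (C i))) i = y.
Proof.
rewrite /tensor_at tensor_skew_pure ffunE.
rewrite (prod_dfwith _ (fun j => @htr F (C j))) eqxx dfwith_in skew_part_vsval.
by rewrite mul1r big1 ?scale1r// => j _; rewrite htr1.
Qed.

Lemma tensor_skew_at0 i k (y : skewAlgebra (C i)) : k != i ->
  (tensor_skew (tensor_at (vsval y)) : dprod (fun i => skewAlgebra (C i))) k = 0.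
Proof.
move=> ki; rewrite /tensor_at tensor_skew_pure ffunE.
rewrite (prod_dfwith _ (fun j => @htr F (C j))) eq_sym ki htr_skew ?mul0r ?scale0r//.
exact: (valP y).
Qed.

Lemma dprod_sumE (W : 'I_n -> vectType F) (I : finType) (E : I -> dprod W) k :
  (\sum_i E i) k = \sum_i E i k.
Proof.
apply: (big_morph (fun x : dprod W => x k)) => [x y|]; first exact: dprodDE.
by rewrite -[0 in LHS](scale0r (0 : dprod W)) dprodZE scale0r.
Qed.

Lemma tensor_skewK (x : cayleySkewProd C) : tensor_skew (skew_tensor x) = x.
Proof.
rewrite /skew_tensor linear_sum; apply/dprodP => k.
rewrite dprod_sumE (bigD1 k)//= tensor_skew_at big1 ?addr0// => i ik.
by rewrite tensor_skew_at0// eq_sym.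
Qed.

Lemma tensor_map_scal t :
  tensor_map (fun i => scal_op (C i)) t = (tensor_htr t : F) *: tensor_one.
Proof.
move: t; apply: tensor_lin_ext => [||x]; first exact: linearP.
  exact: (lin_form tensor_one (linearP tensor_htr)).
by rewrite tensor_map_pure pure_scale tensor_htr_pure.
Qed.

Definition one_skew i j : {linear C j -> C j} :=
  dfwith (T := fun j => {linear C j -> C j}) (fun j => scal_op (C j)) (skew_op (C i)) j.

Lemma tensor_map_one_skew i t : tensor_map (one_skew i) t =
  tensor_at (vsval ((tensor_skew t : dprod (fun i => skewAlgebra (C i))) i)).
Proof.
have atL : linear (fun y : C i => tensor_at y : T).
  exact: (@pure_multilinear F n C _ i).
move: t; apply: tensor_lin_ext => [||x]; first exact: linearP.
  by move=> a s t; rewrite linearP dprodDE dprodZE linearP atL.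
rewrite tensor_map_pure tensor_skew_pure ffunE linearZ /= (linearZ_of _ _ atL).
rewrite /tensor_at.
have -> : (fun j => one_skew i j (x j)) =
   (fun j => (if j != i then htr (x j) else 1) *:
      dfwith (fun j => hone (C j)) (skew_op (C i) (x i)) j).
  apply: functional_extensionality_dep => j; rewrite /one_skew.
  have [ji|ji] := eqVneq j i; first by subst j; rewrite !dfwith_in scale1r.
  by rewrite !dfwith_out// eq_sym.
by rewrite pure_scale -big_mkcond.
Qed.

Lemma pure_sub_at i (X Y m : forall j, C j) :
  (forall j, i != j -> X j = m j /\ Y j = m j) ->
  pure X - pure Y = pure (dfwith m (X i - Y i)) :> T.
Proof.
move=> XY; rewrite (linearD_of _ _ (@pure_multilinear F n C m i)).
rewrite -[in X in _ = _ + X]scaleN1r (linearZ_of _ _ (@pure_multilinear F n C m i)) scaleN1r.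
congr (pure _ - pure _); apply: functional_extensionality_dep => j.
  by case: (dfwithP (T := C)) => // k /XY[].
by case: (dfwithP (T := C)) => // k /XY[].
Qed.

(** Outside position [i] one of the three factors is 1, so both bracketings agree there; in position
    [i] the associator of [C i] remains, and it is alternating. *)
Lemma skew_at_Nalt i (x : C i) : Nalt T (tensor_at x).
Proof.
have A1 y z : associator (tensor_at x) (pure y : T) (pure z : T) =
    pure (dfwith (fun j => amul (y j) (z j)) (associator x (y i) (z i))).
  rewrite /associator /tensor_at !tensor_mulE (@pure_sub_at i _ _ (fun j => amul (y j) (z j))).
    by rewrite !dfwith_in.
  by move=> j ij; rewrite !dfwith_out// !hmul1l.
have A2 y z : associator (pure y : T) (tensor_at x) (pure z : T) =
    pure (dfwith (fun j => amul (y j) (z j)) (associator (y i) x (z i))).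
  rewrite /associator /tensor_at !tensor_mulE (@pure_sub_at i _ _ (fun j => amul (y j) (z j))).
    by rewrite !dfwith_in.
  by move=> j ij; rewrite !dfwith_out// hmul1l hmul1r.
have A3 y z : associator (pure y : T) (pure z : T) (tensor_at x) =
    pure (dfwith (fun j => amul (y j) (z j)) (associator (y i) (z i) x)).
  rewrite /associator /tensor_at !tensor_mulE (@pure_sub_at i _ _ (fun j => amul (y j) (z j))).
    by rewrite !dfwith_in.
  by move=> j ij; rewrite !dfwith_out// !hmul1r.
have pN (y : forall j, C j) (v : C i) : pure (dfwith y (- v)) = - pure (dfwith y v) :> T.
  by rewrite -scaleN1r (linearZ_of _ _ (@pure_multilinear F n C y i)) scaleN1r.
move=> s t; split.
  move: s; apply: tensor_lin_ext => [||y].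
  - exact: (@assoc_linear2 F T).
  - exact/lin_opp/(@assoc_linear1 F T).
  move: t; apply: tensor_lin_ext => [||z].
  - exact: (@assoc_linear3 F T).
  - exact/lin_opp/(@assoc_linear3 F T).
  by rewrite A1 A2 assocC12 pN.
move: s; apply: tensor_lin_ext => [||y].
- exact/lin_opp/(@assoc_linear1 F T).
- exact: (@assoc_linear1 F T).
move: t; apply: tensor_lin_ext => [||z].
- exact/lin_opp/(@assoc_linear3 F T).
- exact: (@assoc_linear2 F T).
by rewrite A2 A3 -pN assocC23 opprK.
Qed.

Lemma Nalt_linear a s t : Nalt T s -> Nalt T t -> Nalt T (a *: s + t).
Proof.
move=> sN tN u v; have [s1 s2] := sN u v; have [t1 t2] := tN u v.
rewrite (@assoc_linear1 F T) (@assoc_linear2 F T) (@assoc_linear3 F T).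
rewrite s1 t1 -s2 -t2; move: (associator u s v) (associator u t v) => X Y.
by rewrite opprD scalerN.
Qed.

Lemma Nalt0 : Nalt T 0.
Proof.
move=> s t; rewrite (linear0_of (@assoc_linear1 F T s t)).
rewrite (linear0_of (@assoc_linear2 F T s t)) (linear0_of (@assoc_linear3 F T s t)).
by rewrite oppr0.
Qed.

Lemma skew_tensor_Nalt x : Nalt T (skew_tensor (C := C) x).
Proof.
rewrite /skew_tensor; apply: (big_ind (Nalt T)) => [|s t sN tN|i _]; first exact: Nalt0.
  by rewrite -[s]scale1r; exact: Nalt_linear.
exact: skew_at_Nalt.
Qed.

(** Let [Q i] be the skew projection in position [i]. As [Q i (Q j a) = 0] for distinct [i, j], the
    remainder [b] of [a] after subtracting all [Q i a] is killed by every [Q i], hence a multiple of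
    the unit, and each [Q i a] is scalar outside position [i]. *)
Lemma Nalt_decomp a : Nalt T a ->
  a = (tensor_htr a : F) *: tensor_one + skew_tensor (tensor_skew a).
Proof.
move=> aN; pose Q i := op_at (V := C) (i := i) (skew_op (C i)).
pose P i := op_at (V := C) (i := i) (scal_op (C i)).
have PQ i t : t = P i t + Q i t.
  by rewrite /P /Q -(op_atD (g := idfun)) ?op_at_id// => v; exact: scal_skew_op.
have QQ i j : i != j -> Q i (Q j a) = 0 by move=> ij; exact: skew_skew_Nalt.
have QK i t : Q i (Q i t) = Q i t.
  by rewrite /Q -(op_at_comp (g := skew_op (C i)))// => v; rewrite skew_opK.
have Pfix i t : Q i t = 0 -> P i t = t by move=> Qt; rewrite [RHS](PQ i) Qt addr0.
have E1 i : tensor_map (one_skew i) a = Q i a.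
  rewrite -(@tensor_map_op _ _ _ (one_skew i) i (skew_op (C i))) => [|v].
    apply: tensor_map_fixed => j; rewrite /one_skew.
    case: (dfwithP (T := fun j => {linear C j -> C j})) => [|k ik]; first exact: QK.
    by apply: Pfix; apply: QQ; rewrite eq_sym.
  by rewrite /one_skew dfwith_in skew_opK.
rewrite -tensor_map_scal.
have -> : skew_tensor (tensor_skew a) = \sum_i Q i a.
  by rewrite /skew_tensor; apply: eq_bigr => i _; rewrite -E1 tensor_map_one_skew.
pose b := a - \sum_i Q i a.
have Eb : tensor_map (fun i => scal_op (C i)) b = b.
  apply: tensor_map_fixed => i; apply: Pfix.
  rewrite /b (linearB (Q i)) (linear_sum (Q i)) (bigD1 i)//= QK big1 ?addr0 ?subrr// => j ji.
  by rewrite QQ// eq_sym.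
rewrite -{1}(subrK (\sum_i Q i a) a) -/b -{1}Eb; congr (_ + _).
rewrite (linearB (tensor_map (fun i => scal_op (C i)))) (linear_sum (tensor_map (fun i =>
  scal_op (C i)))) big1 ?subr0// => i _.
by apply: tensor_map_op0 => v; exact: scal_op_skew_op.
Qed.

End CayleyTensor.

(** * Perfectness and the identifications *)

(* The decomposition is required to be linear in [x] so that it survives
   extension of scalars. *)
Definition explicit_perfect (F : fieldType) (A : fdAlgebra F) :=
  exists (y z : A) (a b : {linear A -> A}),
    forall x, x = amul (a x) y + amul (b x) z.

Section SextComm.
Variables (F : fieldType) (A : fdAlgebra F) (R : commAlgebra F).
Implicit Types x y z : sext A R.

Lemma sext_comm_linearl y : linear (fun x => sext_comm x y).
Proof. by rewrite /sext_comm; lin. Qed.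
Lemma sext_comm_linearr y : linear (fun x => sext_comm y x).
Proof. by rewrite /sext_comm; lin. Qed.

Definition sext_assoc x y z := sext_mul (sext_mul x y) z - sext_mul x (sext_mul y z).

Lemma sext_assoc_linear1 y z : linear (fun x => sext_assoc x y z).
Proof. by rewrite /sext_assoc; lin. Qed.
Lemma sext_assoc_linear2 y z : linear (fun x => sext_assoc y x z).
Proof. by rewrite /sext_assoc; lin. Qed.
Lemma sext_assoc_linear3 y z : linear (fun x => sext_assoc y z x).
Proof. by rewrite /sext_assoc; lin. Qed.

Lemma sext_assoc_in u v w :
  sext_assoc (sext_in R u) (sext_in R v) (sext_in R w) = sext_in R (associator (u : A) v w).
Proof.
rewrite /sext_assoc !sext_mul_in /associator sext_inD; congr (_ + _).
by rewrite -!scaleN1r sext_inZ rmorphN1.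
Qed.

Lemma sext_perfect x : explicit_perfect A ->
  exists p q r s, x = sext_mul p q + sext_mul r s.
Proof.
move=> [y [z [a [b ab]]]]; exists (sext_map R a x), (sext_in R y), (sext_map R b x),
  (sext_in R z).
move: x; apply: sext_lin_ext => [||u]; [by lin|by lin|].
by rewrite !sext_map_in !sext_mul_in -sext_inD -ab.
Qed.

Lemma aut_comm (f : algAut A R) x y : f (sext_comm x y) = sext_comm (f x) (f y).
Proof.
by rewrite /sext_comm (linearD_of _ _ (aut_linear f)) -scaleN1r (linearZ_of _ _ (aut_linear
  f)) scaleN1r !aut_mul.
Qed.

Lemma aut_assoc (f : algAut A R) x y z :
  f (sext_assoc x y z) = sext_assoc (f x) (f y) (f z).
Proof.
by rewrite /sext_assoc (linearD_of _ _ (aut_linear f)) -scaleN1r (linearZ_of _ _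
  (aut_linear f)) scaleN1r !aut_mul.
Qed.

Lemma comm_linspan_sub (B : fdAlgebra F) (h : {linear B -> A}) (S : set A) :
  (forall u v : A, S u -> S v -> exists w, acomm u v = h w) ->
  comm_span S `<=` range h.
Proof.
move=> Sh v [s [sS vs]].
have : (<<s>> <= limg (linfun h))%VS.
  apply/span_subvP => w /sS [x [y [Sx Sy ->]]].
  by have [z ->] := Sh _ _ Sx Sy; rewrite -(lfunE h); apply: memv_img; exact: memvf.
by move=> /subvP /(_ _ vs) /memv_imgP [u _ ->]; exists u; rewrite // lfunE.
Qed.

End SextComm.

Section Perfect.
Variables (F : fieldType).
Hypothesis charF : 2%N \notin [pchar F].

(** [acomm_resolve] divided by [16 n(y) n(z)], the terms being grouped by their last commutator,
    with [y] or with [z]. *)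
Lemma skew_perfect (C : cayleyAlgebra F) : explicit_perfect (skewAlgebra C).
Proof.
have [y [z [_ [[yS zS _] [ny nz _] [yz _ _] _]]]] := cayley_basic_triple C charF.
pose y' : skewAlgebra C := Subvs yS; pose z' : skewAlgebra C := Subvs zS.
pose c := 16 * hnorm C y * hnorm C z.
have c0 : c != 0.
  have -> : c = 2 * 2 * 2 * 2 * hnorm C y * hnorm C z by rewrite /c; ring.
  by rewrite !mulf_neq0// two_neq0.
pose a x : skewAlgebra C := (- (c^-1 * (4 * hnorm C z))) *: amul x y'.
pose b x : skewAlgebra C :=
  (- c^-1) *: (amul (amul (amul x y') y') z' + (4 * hnorm C y) *: amul x z').
have aL : linear a by apply: lin_scale; exact: (@amul_linearl F (skewAlgebra C)).
have bL : linear b.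
  apply: lin_scale; apply: lin_add; first by do 3!apply: lin_amull; exact: lin_id.
  by apply: lin_scale; apply: lin_amull; exact: lin_id.
exists y', z', (mklin aL), (mklin bL) => x; apply/val_inj.
have := acomm_resolve charF (valP x) yS zS yz; rewrite -/c => /(congr1 (fun w => c^-1 *: w)).
rewrite scalerA mulVf// scale1r => E.
rewrite [LHS]E [RHS]linearD /= /a /b.
rewrite !(linearZ_of _ _ (@acomm_linearl F C _)) (linearD_of (acomm (acomm (acomm (vsval x)
  y) y) z) _ (@acomm_linearl F C _)).
rewrite (linearZ_of _ _ (@acomm_linearl F C _)).
by apply: polar_inj => w; rewrite !polarE; ring.
Qed.

Lemma prod_perfect n (A : 'I_n -> fdAlgebra F) :
  (forall i, explicit_perfect (A i)) -> explicit_perfect (prodAlgebra A).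
Proof.
move=> AP.
have P i : {d : A i * A i * {linear A i -> A i} * {linear A i -> A i} |
   forall x, x = amul (d.1.2 x) d.1.1.1 + amul (d.2 x) d.1.1.2}.
  by apply: cid; have [y [z [a [b ab]]]] := AP i; exists (y, z, a, b).
pose d i := sval (P i).
have PE i (x : A i) : x = amul ((d i).1.2 x) (d i).1.1.1 + amul ((d i).2 x) (d i).1.1.2.
  exact: (svalP (P i)).
pose a (x : prodAlgebra A) : prodAlgebra A := [ffun i => (d i).1.2 ((x : dprod A) i)] :
  dprod A.
pose b (x : prodAlgebra A) : prodAlgebra A := [ffun i => (d i).2 ((x : dprod A) i)] : dprod A.
have aL : linear a.
  move=> c x y; apply/dprodP => i.
  by rewrite [RHS](dprodDE (V := A)) (dprodZE (V := A)) !ffunE linearP.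
have bL : linear b.
  move=> c x y; apply/dprodP => i.
  by rewrite [RHS](dprodDE (V := A)) (dprodZE (V := A)) !ffunE linearP.
exists ([ffun i => (d i).1.1.1] : dprod A), ([ffun i => (d i).1.1.2] : dprod A).
exists (mklin aL), (mklin bL) => x; apply/dprodP => i.
by rewrite [RHS](dprodDE (V := A)) !ffunE -PE.
Qed.

End Perfect.

Section Main.
Variables (F : fieldType) (n : nat) (C : 'I_n -> cayleyAlgebra F).
Hypothesis charF : 2%N \notin [pchar F].
Local Notation T := (cayleyTensor C).
Local Notation A := (cayleyProd C).
Local Notation L := (cayleySkewProd C).

Lemma skewProd_perfect : explicit_perfect L.
Proof. by apply: prod_perfect => i; exact: skew_perfect. Qed.

Lemma skew_incl_inj : injective (skew_incl (C := C)).
Proof.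
move=> x y xy; apply/dprodP => i; apply/val_inj.
by move/ffunP/(_ i): xy; rewrite !ffunE.
Qed.

Lemma skew_inclM (x y : L) : skew_incl (amul x y) = acomm (skew_incl x) (skew_incl y).
Proof.
apply/dprodP => i.
have -> : acomm (skew_incl x) (skew_incl y) = amul (skew_incl x) (skew_incl y) + (-1) *:
  amul (skew_incl y) (skew_incl x).
  by rewrite scaleN1r.
by rewrite [RHS](dprodDE (V := C)) (dprodZE (V := C)) !ffunE scaleN1r.
Qed.

Definition prod_skew (x : A) : L :=
  [ffun i => skew_part charF ((x : dprod C) i)] : dprod (fun i => skewAlgebra (C i)).

Lemma prod_skew_linear : linear prod_skew.
Proof.
move=> a x y; apply/dprodP => i.
rewrite [RHS](dprodDE (V := fun i => skewAlgebra (C i))) (dprodZE (V := fun i =>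
  skewAlgebra (C i))).
by rewrite !ffunE (skew_part_linear charF).
Qed.

(** The preimage of a commutator is given by a linear map, which lets the statement pass to [R]. *)
Lemma acomm_prod_skew (x y : A) : acomm x y = skew_incl (mklin prod_skew_linear (acomm x y)).
Proof.
apply/dprodP => i.
transitivity (vsval (skew_part charF ((acomm x y : dprod C) i)));
  last by rewrite /skew_incl !ffunE.
have -> : (acomm x y : dprod C) i = acomm ((x : dprod C) i) ((y : dprod C) i).
  have -> : acomm x y = amul x y + (-1) *: amul y x by rewrite scaleN1r.
  by rewrite (dprodDE (V := C)) (dprodZE (V := C)) !ffunE scaleN1r.
by rewrite /= htr_skew ?scale0r ?subr0//; exact: acomm_skew.
Qed.

Lemma comm_span_image (B A' : fdAlgebra F) (h : {linear B -> A'}) (S : set A') :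
    explicit_perfect B -> (forall x y, h (amul x y) = acomm (h x) (h y)) ->
    (forall x, S (h x)) -> (forall u v, S u -> S v -> exists w, acomm u v = h w) ->
  range h = comm_span S.
Proof.
move=> [y [z [a [b ab]]]] hM hS Sh; apply/seteqP; split; last exact: comm_linspan_sub.
move=> _ [x _ <-].
exists [:: acomm (h (a x)) (h y); acomm (h (b x)) (h z)]; split=> [u|].
  rewrite !inE => /orP[]/eqP->; first by exists (h (a x)), (h y).
  by exists (h (b x)), (h z).
rewrite {1}(ab x) linearD !hM; apply: rpredD; apply: memv_span; rewrite !inE eqxx ?orbT//.
Qed.

Lemma skew_incl_identifies : identifies (skew_incl (C := C)) (comm_span [set: A]).
Proof.
split; [exact: skew_incl_inj| |exact: skew_inclM].
apply: comm_span_image => //; first exact: skewProd_perfect.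
  exact: skew_inclM.
by move=> u v _ _; exists (mklin prod_skew_linear (acomm u v)); exact: acomm_prod_skew.
Qed.

Lemma acomm_tensor_at i j (u : C i) (v : C j) : i != j ->
  acomm (tensor_at u) (tensor_at v) = 0 :> T.
Proof.
move=> ij; rewrite /acomm !tensor_at_pair// 1?eq_sym// dfwithC ?subrr//.
Qed.

Lemma acomm_tensor_at_same i (u v : C i) :
  acomm (tensor_at u) (tensor_at v) = tensor_at (acomm u v) :> T.
Proof.
have E a b : amul (tensor_at a) (tensor_at b) = tensor_at (amul (a : C i) b) :> T.
  by rewrite tensor_at_mul /tensor_at op_at_pure dfwith_in dfwith2.
rewrite /acomm !E /tensor_at (linearD_of _ _ (@pure_multilinear F n C _ i)).
by rewrite -!scaleN1r (linearZ_of _ _ (@pure_multilinear F n C _ i)).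
Qed.

Lemma skew_tensorM (x y : L) : skew_tensor (amul x y) = acomm (skew_tensor x) (skew_tensor y).
Proof.
rewrite /skew_tensor (linear_sum_of _ _ (@acomm_linearl F T _)); apply: eq_bigr => i _.
rewrite (linear_sum_of _ _ (@acomm_linearr F T _)) (bigD1 i)//= big1 => [|j ji].
  by rewrite addr0 acomm_tensor_at_same ffunE.
by rewrite acomm_tensor_at// eq_sym.
Qed.

Lemma skew_tensor_inj : injective (skew_tensor (C := C)).
Proof. exact: can_inj (tensor_skewK charF). Qed.

Lemma acomm_tensor_one r (t : T) : acomm (r *: tensor_one C) t = 0.
Proof.
rewrite (linearZ_of _ _ (@acomm_linearl F T _)) /acomm tensor_mul1 tensor_1mul.
by rewrite subrr scaler0.
Qed.

(** By [Nalt_decomp], elements of [Nalt] differ from skew ones by multiples of the central unit,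
    which commutators do not see. *)
Lemma skew_tensor_identifies : identifies (skew_tensor (C := C)) (Nalt' T).
Proof.
split; [exact: skew_tensor_inj| |exact: skew_tensorM].
apply: comm_span_image; [exact: skewProd_perfect|exact: skew_tensorM|exact: skew_tensor_Nalt|].
move=> u v uN vN; exists (amul (tensor_skew C charF u) (tensor_skew C charF v) : L).
apply: etrans (esym (skew_tensorM _ _)).
rewrite {1}(Nalt_decomp charF uN) {1}(Nalt_decomp charF vN).
rewrite (linearD_of _ _ (@acomm_linearl F T _)) acomm_tensor_one add0r.
rewrite (linearD_of _ _ (@acomm_linearr F T _)) -[X in X + _]opprK.
by rewrite [in X in X + _]/acomm opprB -/(acomm _ _) acomm_tensor_one oppr0 add0r.
Qed.

End Main.

(** * Stability under automorphisms *)

Section SextSum.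
Variables (F : fieldType) (R : commAlgebra F).

Lemma sext_in_sum (V : vectType F) (I : finType) (v : I -> V) :
  sext_in R (\sum_i v i) = \sum_i sext_in R (v i).
Proof. exact: (big_morph _ (@sext_inD _ _ _) (@sext_in0 _ _ _)). Qed.

Lemma sext_tensor_ext n (V : 'I_n -> vectType F) (M : lmodType R)
    (h h' : sext (tensor V) R -> M) : linear h -> linear h' ->
    (forall x, h (sext_in R (pure x)) = h' (sext_in R (pure x))) ->
  forall t, h t = h' t.
Proof.
move=> hL h'L hh'; apply: sext_lin_ext => // v.
rewrite (tensor_sum v) /tensor_lift sext_in_sum (linear_sum_of _ _ hL) (linear_sum_of _ _ h'L).
by apply: eq_bigr => k _; rewrite sext_inZ (linearZ_of _ _ hL) (linearZ_of _ _ h'L) hh'.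
Qed.

End SextSum.

Section Dinj.
Variables (F : fieldType) (n : nat) (V : 'I_n -> vectType F).

Definition dinj_fun i (x : V i) : dprod V := [ffun j => dfwith (fun j => 0 : V j) x j].
Definition dproj_fun i (x : dprod V) : V i := x i.

Fact dinj_linear i : linear (@dinj_fun i).
Proof.
move=> a x y; apply/dprodP => j; rewrite [RHS]dprodDE dprodZE !ffunE.
case: (dfwithP (T := V)) => [|k ik]; rewrite ?dfwith_in ?dfwith_out//.
by rewrite scaler0 addr0.
Qed.
Fact dproj_linear i : linear (@dproj_fun i).
Proof. by move=> a x y; rewrite /dproj_fun dprodDE dprodZE. Qed.

Definition dinj i : {linear V i -> dprod V} := mklin (@dinj_linear i).
Definition dproj i : {linear dprod V -> V i} := mklin (@dproj_linear i).

Lemma dproj_inj i (x : V i) : dproj i (dinj i x) = x.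
Proof. by rewrite /= /dproj_fun ffunE dfwith_in. Qed.
Lemma dproj_inj0 i j (x : V j) : i != j -> dproj i (dinj j x) = 0.
Proof. by move=> ij; rewrite /= /dproj_fun ffunE dfwith_out// eq_sym. Qed.
Lemma dinj_sum (x : dprod V) : x = \sum_i dinj i (dproj i x).
Proof.
apply/dprodP => k; rewrite dprod_sumE (bigD1 k)//= big1 => [|i ik].
  by rewrite addr0 ffunE dfwith_in.
by rewrite ffunE dfwith_out.
Qed.

End Dinj.

Section Stable.
Variables (F : fieldType) (n : nat) (C : 'I_n -> cayleyAlgebra F).
Hypothesis charF : 2%N \notin [pchar F].
Variable R : commAlgebra F.
Local Notation T := (cayleyTensor C).
Local Notation A := (cayleyProd C).
Local Notation L := (cayleySkewProd C).
Local Notation skewT := (sext_map R (skew_tensor (C := C))).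
Local Notation skewA := (sext_map R (skew_incl (C := C))).

(** By perfectness every element of the subalgebra is a sum of two commutators. Automorphisms
    preserve commutators, and all commutators of the product are skew. *)
Lemma cayleyProd_stable (g : algAut A R) x : exists y, g (skewA x) = skewA y.
Proof.
have [a [b [c [d ->]]]] := sext_perfect x (skewProd_perfect C charF).
have cA u v : exists w, sext_comm u v = skewA w.
  exists (sext_map R (mklin (prod_skew_linear charF)) (sext_comm (u : sext A R) v)).
  move: u; apply: sext_lin_ext => [||u].
  - exact: sext_comm_linearl.
  - by do 2!apply: lin_comp; exact: sext_comm_linearl.
  move: v; apply: sext_lin_ext => [||v].
  - exact: sext_comm_linearr.
  - by do 2!apply: lin_comp; exact: sext_comm_linearr.
  by rewrite sext_comm_in !sext_map_in; congr sext_in; exact: acomm_prod_skew.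
rewrite linearD /= !(sext_map_comm (@skew_inclM _ _ C)) (linearD_of _ _ (aut_linear g))
  !aut_comm.
have [u ->] := cA (g (skewA a)) (g (skewA b)).
have [v ->] := cA (g (skewA c)) (g (skewA d)).
by exists (u + v); rewrite linearD.
Qed.

(** The equations of [Nalt] over [R], written as vanishing sums so that each is linear in [a]. *)
Definition NaltR (a : sext T R) := forall s t,
  sext_assoc a s t + sext_assoc s a t = 0 /\ sext_assoc s a t + sext_assoc s t a = 0.

Lemma NaltR_skew x : NaltR (skewT x).
Proof.
move=> s t; split.
  move: x; apply: sext_lin_ext => [||x].
  - by apply: lin_add; [apply: (lin_comp' (sext_assoc_linear1 _ _))|
      apply: (lin_comp' (sext_assoc_linear2 _ _))]; exact: linearP.
  - exact: lin_0.
  move: s; apply: sext_lin_ext => [||s].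
  - by apply: lin_add; [exact: sext_assoc_linear2|exact: sext_assoc_linear1].
  - exact: lin_0.
  move: t; apply: sext_lin_ext => [||t].
  - by apply: lin_add; exact: sext_assoc_linear3.
  - exact: lin_0.
  have [E _] := @skew_tensor_Nalt F n C x s t.
  by rewrite sext_map_in !sext_assoc_in -sext_inD E addNr sext_in0.
move: x; apply: sext_lin_ext => [||x].
- by apply: lin_add; [apply: (lin_comp' (sext_assoc_linear2 _ _))|
    apply: (lin_comp' (sext_assoc_linear3 _ _))]; exact: linearP.
- exact: lin_0.
move: s; apply: sext_lin_ext => [||s].
- by apply: lin_add; [exact: sext_assoc_linear1|exact: sext_assoc_linear1].
- exact: lin_0.
move: t; apply: sext_lin_ext => [||t].
- by apply: lin_add; [exact: sext_assoc_linear3|exact: sext_assoc_linear2].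
- exact: lin_0.
have [_ E] := @skew_tensor_Nalt F n C x s t.
by rewrite sext_map_in !sext_assoc_in -sext_inD -E addrN sext_in0.
Qed.

Definition scal_tensor : {linear F^o -> T} :=
  mklin (@lin_form F F^o T idfun (tensor_one C) (fun a x y => erefl)).

(** By [Nalt_decomp] over [F], the map sending [a] to the error of its decomposition vanishes
    wherever the equations of [Nalt] hold. By [linear_factor] it is a combination of these
    equations, and this combination persists over [R]. *)
Lemma NaltR_decomp a : NaltR a -> exists r x, a = sext_map R scal_tensor r + skewT x.
Proof.
move=> aN; exists (sext_map R (tensor_htr C) a), (sext_map R (tensor_skew C charF) a).
pose N := \dim {: T}; pose b (k : 'I_N) : T := (vbasis {: T})`_k.
have qL : linear (fun a : T => a - scal_tensor (tensor_htr C a) -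
    skew_tensor (tensor_skew C charF a)).
  apply: lin_add; last by apply: lin_opp; do 2!apply: lin_comp; exact: lin_id.
  by apply: lin_add; [exact: lin_id|apply: lin_opp; do 2!apply: lin_comp; exact: lin_id].
pose h1 s t (a : T) := associator a s t + associator s a t.
pose h2 s t (a : T) := associator s a t + associator s t a.
have h1L s t : linear (h1 s t).
  by apply: lin_add; [exact: (@assoc_linear1 F T)|exact: (@assoc_linear2 F T)].
have h2L s t : linear (h2 s t).
  by apply: lin_add; [exact: (@assoc_linear2 F T)|exact: (@assoc_linear3 F T)].
(* The indices give the two test vectors and the Boolean chooses between the two equations of
   [NaltR]. *)
pose h (k : 'I_N * 'I_N * bool) : {linear T -> T} :=
  if k.2 then mklin (h1L (b k.1.1) (b k.1.2)) else mklin (h2L (b k.1.1) (b k.1.2)).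
have [phi phiE] : exists phi : 'I_N * 'I_N * bool -> {linear T -> T},
    forall a, mklin qL a = \sum_k phi k (h k a).
  apply: (linear_factor (V := T) (W := T) (W' := T)) => c hc.
  have cN : Nalt T c.
    move=> s t; split; apply/eqP.
      rewrite -addr_eq0; apply/eqP; move: s; apply: (@basis_ext F T) => [||k].
      - by apply: lin_add; [exact: (@assoc_linear2 F T)|exact: (@assoc_linear1 F T)].
      - exact: lin_0.
      move: t; apply: (@basis_ext F T) => [||l].
      - by apply: lin_add; exact: (@assoc_linear3 F T).
      - exact: lin_0.
      exact: (hc (k, l, true)).
    rewrite eq_sym -addr_eq0 addrC; apply/eqP; move: s; apply: (@basis_ext F T) => [||k].
    - by apply: lin_add; exact: (@assoc_linear1 F T).
    - exact: lin_0.
    move: t; apply: (@basis_ext F T) => [||l].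
    - by apply: lin_add; [exact: (@assoc_linear3 F T)|exact: (@assoc_linear2 F T)].
    - exact: lin_0.
    exact: (hc (k, l, false)).
  by rewrite /= {1}(Nalt_decomp charF cN) addrAC addrK subrr.
have q0 : sext_map R (mklin qL) a = 0.
  rewrite (sext_map_sumcomp phiE) big1// => -[[k l] c] _.
  suff -> : sext_map R (h (k, l, c)) a = 0 by rewrite linear0.
  case: c; rewrite /h /=.
    have [<- _] := aN (sext_in R (b k)) (sext_in R (b l)).
    move: {aN} a; apply: sext_lin_ext => [||a]; first exact: linearP.
      by apply: lin_add; [exact: sext_assoc_linear1|exact: sext_assoc_linear2].
    by rewrite sext_map_in !sext_assoc_in -sext_inD.
  have [_ <-] := aN (sext_in R (b k)) (sext_in R (b l)).
  move: {aN} a; apply: sext_lin_ext => [||a]; first exact: linearP.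
    by apply: lin_add; [exact: sext_assoc_linear2|exact: sext_assoc_linear3].
  by rewrite sext_map_in !sext_assoc_in -sext_inD.
apply/eqP; rewrite -subr_eq0 opprD addrA; apply/eqP; rewrite -[RHS]q0.
move: {aN q0} a; apply: sext_lin_ext => [||a].
- apply: lin_add; last by apply: lin_opp; apply: lin_comp; exact: linearP.
  by apply: lin_add; [exact: lin_id|apply: lin_opp; apply: lin_comp; exact: linearP].
- exact: linearP.
by rewrite !sext_map_in /= !sext_inD -![sext_in R (- _)]/(sext_in R (- _)) -!scaleN1r
  !sext_inZ rmorphN1.
Qed.

Lemma cayleyTensor_stable (f : algAut T R) x : exists y, f (skewT x) = skewT y.
Proof.
have fN a : NaltR a -> NaltR (f a).
  move=> aN s t; rewrite -[s](aut_invK f) -[t](aut_invK f) -!aut_assoc.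
  have [E1 E2] := aN (aut_inv f s) (aut_inv f t).
  rewrite -!(linearD_of _ _ (aut_linear f)) E1 E2.
  by rewrite (linear0_of (aut_linear f)).
have central r t : sext_comm (sext_map R scal_tensor r) t = 0.
  move: r; apply: sext_lin_ext => [||r].
  - by apply: (lin_comp' (sext_comm_linearl _)); exact: linearP.
  - exact: lin_0.
  move: t; apply: sext_lin_ext => [||t].
  - exact: sext_comm_linearr.
  - exact: lin_0.
  by rewrite sext_map_in sext_comm_in /= acomm_tensor_one sext_in0.
have commN u v : NaltR u -> NaltR v -> exists w, sext_comm u v = skewT w.
  move=> /NaltR_decomp[r [u' ->]] /NaltR_decomp[s [v' ->]].
  exists (sext_mul u' v'); rewrite (sext_map_comm (@skew_tensorM _ _ C)).
  rewrite (linearD_of _ _ (sext_comm_linearl _)) central add0r.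
  rewrite (linearD_of _ _ (sext_comm_linearr _)).
  by rewrite [X in X + _](_ : _ = 0) ?add0r// -[LHS]opprK opprB -/(sext_comm _ _) central
    oppr0.
have [a [b [c [d ->]]]] := sext_perfect x (skewProd_perfect C charF).
rewrite linearD /= !(sext_map_comm (@skew_tensorM _ _ C)) (linearD_of _ _ (aut_linear f))
  !aut_comm.
have [u ->] := commN _ _ (fN _ (NaltR_skew a)) (fN _ (NaltR_skew b)).
have [v ->] := commN _ _ (fN _ (NaltR_skew c)) (fN _ (NaltR_skew d)).
by exists (u + v); rewrite linearD.
Qed.

End Stable.

(** * Faithfulness *)

Section AutUnit.
Variables (F : fieldType) (A : fdAlgebra F) (R : commAlgebra F).

Lemma aut_unit (u : A) (f : algAut A R) : (forall x, amul u x = x) ->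
  (forall x, amul x u = x) -> f (sext_in R u) = sext_in R u.
Proof.
move=> ul ur.
have m1 t : sext_mul (sext_in R u) t = t.
  move: t; apply: sext_lin_ext => [||t]; [exact: sext_mul_linearr|exact: lin_id|].
  by rewrite sext_mul_in ul.
have m2 t : sext_mul t (sext_in R u) = t.
  move: t; apply: sext_lin_ext => [||t]; [exact: sext_mul_linearl|exact: lin_id|].
  by rewrite sext_mul_in ur.
by rewrite -[LHS]m2 -{2}[sext_in R _](aut_invK f) -aut_mul m1 aut_invK.
Qed.

End AutUnit.

Section Faithful.
Variables (F : fieldType) (n : nat) (C : 'I_n -> cayleyAlgebra F).
Hypothesis charF : 2%N \notin [pchar F].
Variable R : commAlgebra F.
Local Notation T := (cayleyTensor C).
Local Notation A := (cayleyProd C).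
Local Notation L := (cayleySkewProd C).
Local Notation skewT := (sext_map R (skew_tensor (C := C))).
Local Notation skewA := (sext_map R (skew_incl (C := C))).

Section Fixed.
Variables (B : fdAlgebra F) (f : algAut B R).
Definition fixed (v : B) := f (sext_in R v) = sext_in R v.

Lemma fixedM u v : fixed u -> fixed v -> fixed (amul u v).
Proof. by rewrite /fixed -sext_mul_in aut_mul => -> ->. Qed.
Lemma fixedD u v : fixed u -> fixed v -> fixed (u + v).
Proof. by rewrite /fixed sext_inD (linearD_of _ _ (aut_linear f)) => -> ->. Qed.
Lemma fixedZ a v : fixed v -> fixed (a *: v).
Proof. by rewrite /fixed sext_inZ (linearZ_of _ _ (aut_linear f)) => ->. Qed.
Lemma fixed0 : fixed 0.
Proof. by rewrite -(scale0r (0 : B)) /fixed sext_inZ rmorph0 scale0r (linear0_of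
  (aut_linear f)). Qed.
End Fixed.

(** Fixed vectors form a subalgebra containing the unit and the skew elements, hence [Nalt]; every
    pure tensor is a product of elements [tensor_at (x i)], which lie in [Nalt]. *)
Lemma cayleyTensor_faithful (f : algAut T R) :
  (forall x, f (skewT x) = skewT x) -> forall t, f t = t.
Proof.
move=> fS.
have f1 : fixed f (tensor_one C).
  by apply: aut_unit; [exact: tensor_mul1|exact: tensor_1mul].
have fNalt a : Nalt T a -> fixed f a.
  move=> /(Nalt_decomp charF) ->; apply: fixedD; first exact: fixedZ.
  by rewrite /fixed -sext_map_in fS.
have fpure x : fixed f (pure x).
  pose xs (s : seq 'I_n) i : C i := if i \in s then x i else hone (C i).
  have -> : x = xs (enum 'I_n).
    by apply: functional_extensionality_dep => i; rewrite /xs mem_enum.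
  elim: (enum 'I_n) (enum_uniq 'I_n) => [_|i s IH /= /andP[nis us]]; first exact: f1.
  have -> : pure (xs (i :: s)) = amul (pure (xs s) : T) (tensor_at (x i)).
    rewrite mul_tensor_at op_at_pure; congr pure.
    apply: functional_extensionality_dep => j; case: (dfwithP (T := C)) => [|k ik].
      by rewrite /xs inE eqxx (negPf nis) /= hmul1l.
    by rewrite /xs inE eq_sym (negPf ik).
  by apply: fixedM; [exact: IH|apply: fNalt; exact: skew_at_Nalt].
by apply: (sext_tensor_ext (h := f) (h' := fun t => t)) => [||x];
  [exact: (aut_linear f)|exact: lin_id|exact: fpure].
Qed.

Lemma cayleyProd_faithful (g : algAut A R) :
  (forall x, g (skewA x) = skewA x) -> forall t, g t = t.
Proof.
move=> gS.
have gskew i (x : C i) : x \in skew_space (C i) -> fixed g (dinj C i x : A).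
  move=> xS; have := gS (sext_in R (dinj (fun i => skewAlgebra (C i)) i (Subvs xS) : L)).
  rewrite sext_map_in [X in sext_in R X](_ : _ = dinj C i x)//.
  apply/dprodP => j; rewrite !ffunE.
  by case: (dfwithP (T := C)) => [|k ik]; rewrite ?dfwith_in ?dfwith_out//= linear0.
have gat i (x : C i) : fixed g (dinj C i x : A).
  have dM (u v : C i) : amul (dinj C i u : A) (dinj C i v) = dinj C i (amul u v).
    apply/dprodP => j; rewrite !ffunE.
    by case: (dfwithP (T := C)) => [|k ik]; rewrite ?dfwith_in ?dfwith_out// linear0l.
  rewrite (scal_skew_op x) linearD; apply: fixedD; last by apply: gskew; exact: sub_htr_skew.
  rewrite [scal_op _ _]/= linearZ; apply: fixedZ.
  have [c [_ [_ [[cS _ _] [nc _ _] _ _]]]] := cayley_basic_triple (C i) charF.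
  (* The unit of a single factor is recovered from skew elements: an anisotropic skew [c] satisfies
     [c^2 = - n(c) 1]. *)
  have -> : hone (C i) = (- (hnorm (C i) c)^-1) *: amul c c.
    rewrite amul_xx// (elimT (skewP c) cS) scale0r sub0r scalerN scalerA mulNr mulVf//.
    by rewrite scaleN1r opprK.
  by rewrite linearZ -dM; apply/fixedZ/fixedM; exact: gskew.
apply: sext_lin_ext => [||v]; [exact: aut_linear|exact: lin_id|].
rewrite -/(fixed g v) (dinj_sum v).
by apply: (big_ind (fixed g)) => [|u w|i _]; [exact: fixed0|exact: fixedD|exact: gat].
Qed.

End Faithful.

(** * The algebra of skew elements over a commutative ring *)

Section SextForm.
Variables (F : fieldType) (V : vectType F) (R : commAlgebra F).
Variable b : V -> V -> F.
Hypothesis b_scalarl : forall y, scalar (b^~ y).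
Hypothesis b_sym : forall x y, b x y = b y x.

Definition sext_form (x y : sext V R) : R :=
  sext_lift (W := R^o) (fun u => sext_lift (W := R^o)
    (fun v => calg_struct R (b u v)) y) x.

Lemma sext_form_scalarl y : scalar (sext_form^~ y).
Proof. by move=> a x x'; exact: (sext_lift_is_linear (W := R^o)). Qed.

Lemma sext_form_scalarr x : scalar (sext_form x).
Proof.
by move=> a y y'; apply: (sext_lift_linear (W := R^o)) => u; exact: sext_lift_is_linear.
Qed.

Lemma sext_form_in u v : sext_form (sext_in R u) (sext_in R v) = calg_struct R (b u v).
Proof.
have bDl w w' z : b (w + w') z = b w z + b w' z.
  by have := b_scalarl z 1 w w'; rewrite scale1r mul1r.
have b0l z : b 0 z = 0 by apply: (addrI (b 0 z)); rewrite -bDl !addr0.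
have bZl a w z : b (a *: w) z = a * b w z.
  by have := b_scalarl z a w 0; rewrite !addr0 b0l addr0.
rewrite /sext_form.
have E w : sext_lift (W := R^o) (fun v => calg_struct R (b w v)) (sext_in R v) =
    calg_struct R (b w v).
  apply: sext_lift_in => [z z'|a z].
    by rewrite b_sym bDl rmorphD !(b_sym w).
  by rewrite b_sym bZl rmorphM (b_sym w).
under [LHS]eq_bigr do rewrite E.
by apply: (sext_lift_in (W := R^o) (h := fun w => calg_struct R (b w v))) => [z z'|a z];
  rewrite ?bDl ?bZl ?rmorphD ?rmorphM.
Qed.

End SextForm.

Section SkewCrossProduct.
Variables (F : fieldType) (C : cayleyAlgebra F) (R : commAlgebra F).
Hypothesis charF : 2%N \notin [pchar F].
Local Notation L := (skewAlgebra C).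

Definition skew_polar (x y : L) : F := polar (hnorm C) (vsval x) (vsval y).

Lemma skew_polar_scalar y : scalar (skew_polar^~ y).
Proof. by move=> a u v; rewrite /skew_polar linearP polarDl polarZl. Qed.
Lemma skew_polar_sym x y : skew_polar x y = skew_polar y x.
Proof. exact: polarC. Qed.

Definition skew_form : sext L R -> sext L R -> R := sext_form skew_polar.

Lemma skew_form_in u v : skew_form (sext_in R u) (sext_in R v) = calg_struct R (skew_polar
  u v).
Proof. exact: (sext_form_in _ skew_polar_scalar skew_polar_sym). Qed.

Lemma lin_forml (M N : lmodType R) (f : M -> sext L R) z (v : N) :
  linear f -> linear (fun w : M => skew_form (f w) z *: v).
Proof.
by move=> fL; apply: lin_form => a x y; rewrite fL; exact: sext_form_scalarl.
Qed.
Lemma lin_formr (M N : lmodType R) (f : M -> sext L R) z (v : N) :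
  linear f -> linear (fun w : M => skew_form z (f w) *: v).
Proof.
by move=> fL; apply: lin_form => a x y; rewrite fL; exact: sext_form_scalarr.
Qed.

(** The vector [w = n(y,u) c - n(y,c) u] is orthogonal to [y]; if both coefficients vanish, [c]
    itself is. The case [y = 0] gives unimodularity, the general one serves for [cp_rigid]. *)
Lemma skew_unimodular (y : L) : exists x w, skew_polar x w = 1 /\ skew_polar y w = 0.
Proof.
have [c [u [_ [[cS uS _] [nc nu _] [cu _ _] _]]]] := cayley_basic_triple C charF.
pose c' : L := Subvs cS; pose u' : L := Subvs uS.
have n2 := two_neq0 charF.
have unit (x w : L) : skew_polar x w != 0 -> exists x', skew_polar x' w = 1.
  move=> xw; exists ((skew_polar x w)^-1 *: x).
  by rewrite /skew_polar linearZ polarZl mulVf.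
have cc : skew_polar c' c' != 0 by rewrite /skew_polar polarxx mulf_neq0.
have uu : skew_polar u' u' != 0 by rewrite /skew_polar polarxx mulf_neq0.
pose be := skew_polar y u'; pose al := skew_polar y c'; pose w := be *: c' - al *: u'.
have wE x : skew_polar x w = be * skew_polar x c' - al * skew_polar x u'.
  rewrite /skew_polar (_ : vsval w = be *: vsval c' - al *: vsval u').
    by rewrite polarDr polarNr !polarZr.
  by rewrite /w linearB !linearZ.
have yw : skew_polar y w = 0 by rewrite wE mulrC subrr.
have cu0 : skew_polar c' u' = 0 by [].
have cw : skew_polar c' w = be * skew_polar c' c' by rewrite wE cu0 mulr0 subr0.
have uw : skew_polar u' w = - (al * skew_polar u' u').
  by rewrite wE (skew_polar_sym u') cu0 mulr0 sub0r.
have [b0|b0] := eqVneq be 0.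
  have [a0|a0] := eqVneq al 0.
    by have [x xw] := unit c' c' cc; exists x, c'.
  have [|x xw] := unit u' w; first by rewrite uw oppr_eq0 mulf_neq0.
  by exists x, w.
have [|x xw] := unit c' w; first by rewrite cw mulf_neq0.
by exists x, w.
Qed.

Lemma scalar_ext (h h' : sext L R -> R) : scalar h -> scalar h' ->
  (forall v, h (sext_in R v) = h' (sext_in R v)) -> forall x, h x = h' x.
Proof. exact: (@sext_lin_ext _ _ _ R^o). Qed.

Lemma skew_crossProduct : crossProduct (@sext_mul F L R) skew_form.
Proof.
have sym x y : skew_form x y = skew_form y x.
  move: x; apply: scalar_ext => [||x]; [exact: sext_form_scalarl|exact: sext_form_scalarr|].
  move: y; apply: scalar_ext => [||y]; [exact: sext_form_scalarr|exact: sext_form_scalarl|].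
  by rewrite !skew_form_in skew_polar_sym.
split.
- exact: sext_mul_linearl.
- move=> x y; move: x; apply: sext_lin_ext => [||x];
  [exact: sext_mul_linearl|by apply: lin_opp; exact: sext_mul_linearr|].
  move: y; apply: sext_lin_ext => [||y]; [exact: sext_mul_linearr|by apply: lin_opp;
    exact: sext_mul_linearl|].
  rewrite !sext_mul_in -scaleN1r -(rmorphN1 (calg_struct R)) -sext_inZ scaleN1r.
  by congr sext_in; apply/val_inj; rewrite [RHS]linearN /= acommC.
- exact: sext_form_scalarl.
- exact: sym.
- move=> x y z; move: x; apply: scalar_ext => [||x].
  + by move=> a u v; rewrite sext_mul_linearl; exact: sext_form_scalarl.
  + exact: sext_form_scalarl.
  move: y; apply: scalar_ext => [||y].
  + by move=> a u v; rewrite sext_mul_linearr; exact: sext_form_scalarl.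
  + by move=> a u v; rewrite sext_mul_linearl; exact: sext_form_scalarr.
  move: z; apply: scalar_ext => [||z].
  + exact: sext_form_scalarr.
  + by move=> a u v; rewrite sext_mul_linearr; exact: sext_form_scalarr.
  rewrite !sext_mul_in !skew_form_in; congr (calg_struct R _).
  by rewrite /skew_polar /= polar_skewM//; exact: valP.
- move=> x y z.
  have scM (a b : R) (v : sext L R) : (a * b) *: v = a *: (b *: v) by rewrite scalerA.
  rewrite -mulNr !scM; move: x; apply: sext_lin_ext => [||x].
  + by apply: lin_add; do 2!apply: lin_mull; exact: lin_id.
  + apply: lin_add; [apply: lin_add|]; apply: lin_scale.
    * by apply: lin_scale; exact: lin_id.
    * by apply: lin_forml; exact: lin_id.
    * by apply: lin_forml; exact: lin_id.
  move: y; apply: sext_lin_ext => [||y].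
  + apply: lin_add; first by apply: lin_mull; apply: lin_mulr; exact: lin_id.
    by apply: lin_mulr; exact: lin_id.
  + apply: lin_add; [apply: lin_add|]; apply: lin_scale.
    * by apply: lin_forml; exact: lin_id.
    * by apply: lin_formr; exact: lin_id.
    * by apply: lin_scale; exact: lin_id.
  move: z; apply: sext_lin_ext => [||z].
  + apply: lin_add; first by apply: lin_mulr; exact: lin_id.
    by apply: lin_mull; apply: lin_mulr; exact: lin_id.
  + apply: lin_add; [apply: lin_add|]; apply: lin_scale.
    * by apply: lin_formr; exact: lin_id.
    * by apply: lin_scale; exact: lin_id.
    * by apply: lin_formr; exact: lin_id.
  rewrite !sext_mul_in !skew_form_in.
  rewrite -[4]/(4%:R) -[2]/(2%:R) -!(rmorph_nat (calg_struct R)) -rmorphN !scalerA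
    -!rmorphM -!sext_inZ -!sext_inD.
  congr sext_in; apply/val_inj; rewrite /=.
  by rewrite acomm_acomm// ?mulNr//; exact: valP.
- by move=> x; exact: (sext_perfect x (skew_perfect charF C)).
- have [x [w [xw _]]] := skew_unimodular 0.
  by exists (sext_in R x), (sext_in R w); rewrite skew_form_in xw rmorph1.
- move=> mu mu_lin mu_sym mu_rel.
  (* Pairing [mu_rel] with [w] orthogonal to [y] removes its right-hand side, and [n(x,w) = 1]
     leaves [mu(y,y)]. Mixed values then follow by polarization. *)
  have mu_in y : mu (sext_in R y) (sext_in R y) = 0.
    have [x [w [xw yw]]] := skew_unimodular y.
    have := congr1 (skew_form^~ (sext_in R w)) (mu_rel (sext_in R x) (sext_in R y)).
    have Z a (u v : sext L R) : skew_form (a *: u) v = a * skew_form u v.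
      exact: (linearZ_of (V := R^o) _ _ (@sext_form_scalarl _ _ R skew_polar v)).
    by rewrite !Z !skew_form_in xw yw rmorph1 rmorph0 mulr1 mulr0.
  have muD x x' y : mu (x + x') y = mu x y + mu x' y.
    exact: (linearD_of (V := R^o) _ _ (mu_lin y)).
  move=> x y; move: x; apply: scalar_ext => [||x]; [exact: mu_lin|by move=> a u v;
    rewrite mulr0 addr0|].
  rewrite mu_sym; move: y; apply: scalar_ext => [||y]; [exact: mu_lin|by move=> a u v;
    rewrite mulr0 addr0|].
  have := mu_in (x + y); rewrite sext_inD muD !(mu_sym _ (_ + _)) !muD !mu_in add0r addr0.
  rewrite (mu_sym (sext_in R x)) => E.
  have h : calg_struct R 2^-1 * 2 = 1.
    by rewrite -(rmorph_nat (calg_struct R)) -rmorphM mulVf ?rmorph1// two_neq0.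
  by rewrite -[LHS]mul1r -h -mulrA mulr_natl (mulr2n (mu _ _)) E mulr0.
Qed.

End SkewCrossProduct.

(** * Cayley algebras over a commutative ring *)

Section SextMul.
Variables (F : fieldType) (R : commAlgebra F) (A B : fdAlgebra F) (h : {linear A -> B}).

Lemma sext_map_mul : (forall x y, h (amul x y) = amul (h x) (h y)) ->
  forall x y : sext A R,
    sext_map R h (sext_mul x y) = sext_mul (sext_map R h x) (sext_map R h y).
Proof.
move=> hM x y; move: x; apply: sext_lin_ext => [||x].
- by apply: lin_comp; exact: sext_mul_linearl.
- by apply: lin_mull; exact: linearP.
move: y; apply: sext_lin_ext => [||y].
- by apply: lin_comp; exact: sext_mul_linearr.
- by apply: lin_mulr; exact: linearP.
by rewrite sext_mul_in !sext_map_in sext_mul_in hM.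
Qed.

End SextMul.

Section SextProd.
Variables (F : fieldType) (R : commAlgebra F) (n : nat) (A : 'I_n -> fdAlgebra F).

Definition sproj i : {linear sext (prodAlgebra A) R -> sext (A i) R} :=
  sext_map R (dproj A i).
Definition sinj i : {linear sext (A i) R -> sext (prodAlgebra A) R} :=
  sext_map R (dinj A i).

Lemma sproj_inj i x : sproj i (sinj i x) = x.
Proof. by rewrite /sproj /sinj /= -(sext_map_comp (g := idfun)) ?sext_map_id// => v;
  rewrite dproj_inj. Qed.
Lemma sproj_inj0 i j x : i != j -> sproj i (sinj j x) = 0.
Proof.
move=> ij; rewrite /sproj /sinj /= -(sext_map_comp (g := mklin (@lin_0 F (A j) (A i))))
  ?sext_map0// => v.
by rewrite dproj_inj0.
Qed.
Lemma sinj_sum x : \sum_i sinj i (sproj i x) = x.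
Proof.
move: x; apply: sext_lin_ext => [||v].
- by apply: lin_sum => i; do 2!apply: lin_comp; exact: lin_id.
- exact: lin_id.
under eq_bigr do rewrite /sproj /sinj /= !sext_map_in.
by rewrite -sext_in_sum -dinj_sum.
Qed.

Lemma sprodP x y : (forall i, sproj i x = sproj i y) -> x = y.
Proof.
by move=> xy; rewrite -[x]sinj_sum -[y]sinj_sum; apply: eq_bigr => i _; rewrite xy.
Qed.

Lemma sproj_sum (w : forall i, sext (A i) R) k : sproj k (\sum_i sinj i (w i)) = w k.
Proof.
rewrite linear_sum (bigD1 k)//= [X in X + _]sproj_inj big1 ?addr0// => i ik.
by rewrite sproj_inj0// eq_sym.
Qed.

Lemma sproj_mul i x y : sproj i (sext_mul x y) = sext_mul (sproj i x) (sproj i y).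
Proof. by apply: sext_map_mul => u v; rewrite /= /dproj_fun ffunE. Qed.
Lemma sinj_mul i x y : sinj i (sext_mul x y) = sext_mul (sinj i x) (sinj i y).
Proof.
apply: sext_map_mul => u v; apply/dprodP => j; rewrite !ffunE.
by case: (dfwithP (T := A)) => [|k ik]; rewrite ?dfwith_in ?dfwith_out// linear0l.
Qed.
Lemma sinj_mul0 i j x y : i != j -> sext_mul (sinj i x) (sinj j y) = 0.
Proof.
move=> ij; apply: sprodP => k; rewrite sproj_mul linear0.
have [<-|ik] := eqVneq i k; first by rewrite (sproj_inj0 _ ij) sext_mul0r.
by rewrite (@sproj_inj0 k i) ?sext_mul0l// eq_sym.
Qed.

End SextProd.
Arguments sproj {F R n A} i.
Arguments sinj {F R n A} i.

Section CayleySext.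
Variables (F : fieldType) (R : commAlgebra F) (C : cayleyAlgebra F).
Hypothesis charF : 2%N \notin [pchar F].

Definition shalf : R := calg_struct R 2^-1.
Lemma shalf2 : shalf * 2 = 1.
Proof.
by rewrite /shalf -(rmorph_nat (calg_struct R)) -rmorphM mulVf ?rmorph1// two_neq0.
Qed.

Definition sone : sext C R := sext_in R (hone C).

Definition svsval : {linear skewAlgebra C -> C} :=
  mklin (linearP (vsval : {linear skew_carrier C -> C})).

(** The splitting of [C ⊗ R] into [R 1] and [C_0 ⊗ R], with projections [str] and [sskew]. *)
Definition smk (a : R) (x : sext (skewAlgebra C) R) : sext C R :=
  a *: sone + sext_map R svsval x.

Definition str (w : sext C R) : R :=
  sext_lift (W := R^o) (fun v => calg_struct R (htr v)) w.

Lemma str_scalar : scalar str.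
Proof. by move=> a x y; exact: (sext_lift_is_linear (W := R^o)). Qed.

Lemma str_in v : str (sext_in R v) = calg_struct R (htr v).
Proof.
have htrD (x y : C) : htr (x + y) = htr x + htr y.
  by rewrite -[x]scale1r htrP mul1r scale1r.
have htr0 : htr (0 : C) = 0 by apply: (addrI (htr (0 : C))); rewrite -htrD !addr0.
apply: (sext_lift_in (W := R^o) (h := fun v : C => calg_struct R (htr v))) => [x y|a x].
  by rewrite htrD rmorphD.
by rewrite -[a *: x]addr0 htrP htr0 addr0 rmorphM.
Qed.

(** [skew_part] is defined for families, so [C] is seen as a constant family with one member. *)
Definition sskew : {linear sext C R -> sext (skewAlgebra C) R} :=
  sext_map R (mklin (@skew_part_linear F 1 (fun=> C) charF ord0)).

Lemma smkK w : smk (str w) (sskew w) = w.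
Proof.
move: w; apply: sext_lin_ext => [||v].
- apply: lin_add; first exact: lin_form str_scalar.
  by do 2!apply: lin_comp; exact: lin_id.
- exact: lin_id.
by rewrite /smk str_in /sskew /= !sext_map_in -sext_inZ -sext_inD /= addrC subrK.
Qed.

Lemma str_mk a x : str (smk a x) = a.
Proof.
have L := str_scalar.
rewrite /smk (linearD_of (V := R^o) _ _ L) (linearZ_of (V := R^o) _ _ L).
rewrite str_in htr1// rmorph1 [_ *: _]mulr1.
suff -> : str (sext_map R svsval x) = 0 by rewrite addr0.
move: x; apply: (sext_lin_ext (M := R^o)) => [||x].
- by move=> b u v; rewrite linearP; exact: L.
- exact: (@lin_0 R _ R^o).
by rewrite sext_map_in str_in htr_skew ?rmorph0//; exact: (valP x).
Qed.

Lemma sskew_mk a x : sskew (smk a x) = x.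
Proof.
rewrite /smk linearD linearZ /sskew /= sext_map_in -(sext_map_comp (g := idfun)) => [|v].
  rewrite sext_map_id// [X in sext_in R X](_ : _ = 0) ?sext_in0 ?scaler0 ?add0r//.
  by apply/val_inj; rewrite /= htr1// scale1r subrr.
by apply/esym; exact: (@skew_part_vsval F 1 (fun=> C) charF ord0).
Qed.

Lemma smkD a b x y : smk a x + smk b y = smk (a + b) (x + y).
Proof. by rewrite /smk linearD scalerDl addrACA. Qed.

Lemma smk0 : smk 0 0 = 0. Proof. by rewrite /smk linear0 scale0r addr0. Qed.

Lemma smkZ c a x : c *: smk a x = smk (c * a) (c *: x).
Proof. by rewrite /smk linearZ scalerDr scalerA. Qed.

Lemma smk_sum (I : finType) (a : I -> R) (x : I -> sext (skewAlgebra C) R) :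
  \sum_i smk (a i) (x i) = smk (\sum_i a i) (\sum_i x i).
Proof. by rewrite /smk scaler_suml linear_sum -big_split. Qed.

Lemma sone_mul w : sext_mul sone w = w.
Proof.
move: w; apply: sext_lin_ext => [||w]; [exact: sext_mul_linearr|exact: lin_id|].
by rewrite sext_mul_in hmul1l.
Qed.
Lemma mul_sone w : sext_mul w sone = w.
Proof.
move: w; apply: sext_lin_ext => [||w]; [exact: sext_mul_linearl|exact: lin_id|].
by rewrite sext_mul_in hmul1r.
Qed.

Lemma svsval_mul x y :
  sext_mul (sext_map R svsval x) (sext_map R svsval y) =
  smk (- (shalf * skew_form x y)) (shalf *: sext_mul x y).
Proof.
rewrite /smk linearZ scaleNr -scalerA; move: x; apply: sext_lin_ext => [||x].
- by apply: lin_mull; exact: linearP.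
- apply: lin_add; first by apply: lin_opp; apply: lin_scale; apply: lin_forml; exact: lin_id.
  by apply: lin_scale; apply: lin_comp; exact: sext_mul_linearl.
move: y; apply: sext_lin_ext => [||y].
- by apply: lin_mulr; exact: linearP.
- apply: lin_add; first by apply: lin_opp; apply: lin_scale; apply: lin_formr; exact: lin_id.
  by apply: lin_scale; apply: lin_comp; exact: sext_mul_linearr.
rewrite !sext_map_in !sext_mul_in skew_form_in /= sext_map_in.
rewrite scalerA -rmorphM -!sext_inZ -scaleN1r -(rmorphN1 (calg_struct R)) -sext_inZ -sext_inD.
congr sext_in; rewrite /= mul_skewE//; [|exact: valP|exact: valP].
by rewrite scaleN1r addrC.
Qed.

(** The product is recovered from the bracket and the form on skew elements, so a map respecting
    both extends multiplicatively. *)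
Lemma smkM a b x y : sext_mul (smk a x) (smk b y) =
  smk (a * b - shalf * skew_form x y) (a *: y + b *: x + shalf *: sext_mul x y).
Proof.
have E : smk (a * b - shalf * skew_form x y) (a *: y + b *: x + shalf *: sext_mul x y) =
   a *: smk b y + b *: smk 0 x + smk (- (shalf * skew_form x y)) (shalf *: sext_mul x y).
  by rewrite !smkZ !smkD mulr0 addr0.
rewrite E -svsval_mul {1 2}/smk sext_mulDl !sext_mulDr !sext_mulZl !sext_mulZr !sone_mul
  mul_sone.
by rewrite [smk 0 x]/smk scale0r add0r /smk scalerDr !addrA.
Qed.

Definition sconj : {linear sext C R -> sext C R} :=
  sext_map R (@hconj F C : {linear C -> C}).

Lemma sconj_mk a x : sconj (smk a x) = smk a (- x).
Proof.
rewrite /smk linearD linearZ /= linearN; congr (_ *: _ + _).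
  rewrite sext_map_in; congr sext_in.
  by rewrite /= (hconj_htr charF) htr1// scale1r subrr subr0.
move: x; apply: sext_lin_ext => [||x].
- by do 2!apply: lin_comp; exact: lin_id.
- by apply: lin_opp; exact: linearP.
rewrite /= !sext_map_in -scaleN1r -(rmorphN1 (calg_struct R)) -sext_inZ scaleN1r.
congr sext_in; apply/eqP; rewrite -mem_skew_space; exact: (valP x).
Qed.

End CayleySext.

(** * Extension to the product of the Cayley algebras *)

Section Extension.
Variables (F : fieldType) (n : nat) (C : 'I_n -> cayleyAlgebra F).
Hypothesis charF : 2%N \notin [pchar F].
Variable R : commAlgebra F.
Local Notation A := (cayleyProd C).
Local Notation L := (cayleySkewProd C).
Local Notation S := (fun i => skewAlgebra (C i)).
Local Notation skewA := (sext_map R (skew_incl (C := C))).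

Definition sblocks := forall i j, sext (S j) R -> sext (S i) R.

(** One-sided data, so that the construction applies both to the blocks of an automorphism and, with
    the transposed matrix, to those of its inverse. *)
Record goodBlocks (f : sblocks) (e : 'I_n -> 'I_n -> R) : Prop := GoodBlocks {
  gb_linear : forall i j, linear (f i j);
  gb_mul : forall i j x y, f i j (sext_mul x y) = sext_mul (f i j x) (f i j y);
  gb_orth : forall i j k x y, j != k -> sext_mul (f i j x) (f i k y) = 0;
  gb_row : forall i j k, j != k -> e i j * e i k = 0;
  gb_row1 : forall i, \sum_j e i j = 1;
  gb_e : forall i j x, e i j *: f i j x = f i j x;
  gb_form : forall i j x y,
    skew_form (f i j x) (f i j y) = e i j * skew_form x y }.

Section Fhat.
Variables (f : sblocks) (e : 'I_n -> 'I_n -> R).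
Hypothesis gb : goodBlocks f e.
Arguments f : clear implicits.

(* Maps [1_j] to [e i j *: 1_i] and extends [f i j]. *)
Definition blk i j (w : sext (C j) R) : sext (C i) R :=
  smk (e i j * str w) (f i j (sskew R (C j) charF w)).
Arguments blk : clear implicits.

Definition fhat (z : sext A R) : sext A R :=
  \sum_i sinj i (\sum_j blk i j (sproj j z)).

Lemma sproj_fhat i z : sproj i (fhat z) = \sum_j blk i j (sproj j z).
Proof. exact: sproj_sum. Qed.

Lemma blk_linear i j : linear (blk i j).
Proof.
move=> a x y; rewrite /blk str_scalar linearP (gb_linear gb) smkZ smkD.
by congr smk; ring.
Qed.

Lemma blk_mk i j a x : blk i j (smk a x) = smk (e i j * a) (f i j x).
Proof. by rewrite /blk str_mk// sskew_mk. Qed.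

Lemma fhat_linear : linear fhat.
Proof.
move=> a x y; apply: sprodP => i; rewrite linearP !sproj_fhat scaler_sumr -big_split.
by apply: eq_bigr => j _; rewrite linearP blk_linear.
Qed.

Lemma e_idem i j : e i j * e i j = e i j.
Proof.
rewrite -[RHS]mulr1 -(gb_row1 gb i) mulr_sumr (bigD1 j)//= big1 ?addr0// => k kj.
by rewrite (gb_row gb)// eq_sym.
Qed.

Lemma e_f0 i j k x : j != k -> e i j *: f i k x = 0.
Proof. by move=> jk; rewrite -(gb_e gb) scalerA (gb_row gb)// scale0r. Qed.

Lemma e_blk i j w : e i j *: blk i j w = blk i j w.
Proof. by rewrite /blk smkZ mulrA e_idem (gb_e gb). Qed.

Lemma e_blk0 i j k w : j != k -> e i j *: blk i k w = 0.
Proof. by move=> jk; rewrite /blk smkZ mulrA (gb_row gb)// e_f0// mul0r smk0. Qed.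

(** In [smkM] the scalar part is where [gb_form] enters; idempotency of [e i j] absorbs the repeated
    factor. *)
Lemma blkM i j v w : blk i j (sext_mul v w) = sext_mul (blk i j v) (blk i j w).
Proof.
rewrite -(smkK charF v) -(smkK charF w); move: (str v) (str w) (sskew _ _ _ v) (sskew _ _ _
  w) => a b x y.
rewrite smkM// !blk_mk smkM//; congr smk.
  by rewrite (gb_form gb) [e i j * a * _]mulrACA e_idem; ring.
have fL := @gb_linear f e gb i j.
rewrite !(linearD_of _ _ fL) !(linearZ_of _ _ fL) (gb_mul gb).
by rewrite -!scalerA ![e i j *: (_ *: _)]scalerA ![e i j * _]mulrC -!scalerA !(gb_e gb).
Qed.

Lemma blkM0 i j k v w : j != k -> sext_mul (blk i j v) (blk i k w) = 0.
Proof.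
move=> jk; rewrite /blk smkM// -smk0 (gb_orth gb)// mulrACA (gb_row gb)// mul0r.
rewrite -[f i j _](gb_e gb) -[f i k _](gb_e gb).
have fl a x y : skew_form (a *: x) y = a * skew_form (x : sext (S i) R) y.
  exact: (linearZ_of (V := R^o) _ _ (@sext_form_scalarl _ _ R (@skew_polar _ (C i)) y)).
have fr a x y : skew_form y (a *: x) = a * skew_form (y : sext (S i) R) x.
  exact: (linearZ_of (V := R^o) _ _ (@sext_form_scalarr _ _ R (@skew_polar _ (C i)) y)).
rewrite fl fr mulrA (gb_row gb)// mul0r mulr0 subrr scaler0 addr0.
rewrite !scalerA ![e i _ * str _ * _]mulrAC !(gb_row gb)// 1?eq_sym//.
by rewrite !mul0r !scale0r addr0.
Qed.

Lemma fhat_mul x y : fhat (sext_mul x y) = sext_mul (fhat x) (fhat y).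
Proof.
apply: sprodP => i; rewrite sproj_mul !sproj_fhat.
rewrite (linear_sum_of _ _ (sext_mul_linearl _)); apply: eq_bigr => j _.
rewrite (linear_sum_of _ _ (sext_mul_linearr _)) (bigD1 j)//= big1 => [|k kj].
  by rewrite addr0 sproj_mul blkM.
by rewrite blkM0// eq_sym.
Qed.

Definition prod_conj : {linear sext A R -> sext A R} :=
  mklin (@lin_sum R (sext A R) (sext A R) 'I_n
    (fun i z => sinj i (sconj R (C i) (sproj i z)))
    (fun i => lin_comp (sinj i) (lin_comp (sconj R (C i)) (linearP (sproj i))))).

Lemma sproj_conj i z : sproj i (prod_conj z) = sconj R (C i) (sproj i z).
Proof. exact: (sproj_sum (fun i => sconj R (C i) (sproj i z))). Qed.

Lemma fhat_conj z : fhat (prod_conj z) = prod_conj (fhat z).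
Proof.
apply: sprodP => i; rewrite sproj_conj !sproj_fhat linear_sum.
apply: eq_bigr => j _; rewrite sproj_conj; move: (sproj j z) => w.
rewrite -(smkK charF w); move: (str w) (sskew _ _ _ w) => a x.
by rewrite sconj_mk// !blk_mk sconj_mk// -scaleN1r (linearZ_of _ _ (@gb_linear f e gb i j))
  scaleN1r.
Qed.

Lemma sproj_skewA i x : sproj i (skewA x) = sext_map R (svsval (C i)) (sproj i x).
Proof.
move: x; apply: sext_lin_ext => [||x].
- by do 2!apply: lin_comp; exact: lin_id.
- by do 2!apply: lin_comp; exact: lin_id.
rewrite /sproj /= !sext_map_in; congr sext_in.
by rewrite /= /dproj_fun ffunE.
Qed.

Lemma fhat_skew x : fhat (skewA x) = skewA (\sum_i sinj i (\sum_j f i j (sproj j x))).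
Proof.
apply: sprodP => i; rewrite sproj_fhat sproj_skewA sproj_sum linear_sum.
apply: eq_bigr => j _; rewrite sproj_skewA.
have E (k : 'I_n) (y : sext (S k) R) : sext_map R (svsval (C k)) y = smk 0 y.
  by rewrite /smk scale0r add0r.
by rewrite /= !E blk_mk mulr0.
Qed.

End Fhat.

(** Off the diagonal, the scalar parts vanish by orthogonality of the columns and the skew parts by
    [fg0]. On the diagonal, the squares [e i j * e i j = e i j] sum to 1 along the row. *)
Lemma fhatK (f g : sblocks) (e d : 'I_n -> 'I_n -> R) :
    goodBlocks f e -> (forall i j, d j i = e i j) ->
    (forall i j k, i != k -> e i j * e k j = 0) ->
    (forall i j k x, i != k -> f i j (g j k x) = 0) ->
    (forall i x, \sum_j f i j (g j i x) = x) ->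
  cancel (fhat g d) (fhat f e).
Proof.
move=> gf de ecol fg0 fgK z; apply: sprodP => i; rewrite sproj_fhat.
under eq_bigr => j _ do rewrite sproj_fhat (linear_sum_of _ _ (@blk_linear f e gf i j)).
rewrite exchange_big (bigD1 i)//= [X in _ + X]big1 => [|k ki].
  rewrite addr0; under eq_bigr => j _ do rewrite blk_mk de mulrA (e_idem gf).
  by rewrite smk_sum -mulr_suml (gb_row1 gf) mul1r fgK smkK.
rewrite big1// => j _; rewrite blk_mk de mulrA ecol 1?eq_sym// mul0r.
by rewrite fg0 ?smk0// eq_sym.
Qed.

Definition aut_blocks (h : sext L R -> sext L R) : sblocks :=
  fun i j x => sproj (A := S) i (h (sinj (A := S) j x)).

Arguments aut_blocks : clear implicits.

Section AutBlocks.
Variable h : algAut L R.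

Lemma aut_blocks_linear i j : linear (aut_blocks h i j).
Proof. by move=> a x y; rewrite /aut_blocks linearP aut_linear linearP. Qed.

Lemma aut_blocks_mul i j x y : aut_blocks h i j (sext_mul x y) =
  sext_mul (aut_blocks h i j x) (aut_blocks h i j y).
Proof. by rewrite /aut_blocks sinj_mul aut_mul sproj_mul. Qed.

Lemma aut_blocks_orth i j k (x : sext (S j) R) (y : sext (S k) R) : j != k ->
  sext_mul (aut_blocks h i j x) (aut_blocks h i k y) = 0.
Proof.
move=> jk; rewrite /aut_blocks -sproj_mul -aut_mul sinj_mul0//.
by rewrite (linear0_of (aut_linear h)) linear0.
Qed.

End AutBlocks.

Lemma aut_blocks_sum (h : algAut L R) z i :
  sproj (A := S) i (h z) = \sum_j aut_blocks h i j (sproj (A := S) j z).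
Proof.
rewrite -{1}(sinj_sum (A := S) z) (linear_sum_of _ _ (aut_linear h)) linear_sum.
by [].
Qed.

Lemma aut_blocksK (h h' : algAut L R) i k (x : sext (S k) R) : cancel h' h ->
  \sum_j aut_blocks h i j (aut_blocks h' j k x) =
  sproj (A := S) i (sinj (A := S) k x).
Proof. by move=> hK; rewrite -aut_blocks_sum hK. Qed.

(* [g] sends [1_j] to [\sum_i e i j *: 1_i], with orthogonal idempotents [e i j]. *)
Definition monomial (g : sext A R -> sext A R) :=
  exists (e : 'I_n -> 'I_n -> R) (b : forall i j, sext (C j) R -> sext (C i) R),
  [/\ (forall i z, sproj i (g z) = \sum_j b i j (sproj j z)),
      (forall i j, linear (b i j)),
      (forall i j w, e i j *: b i j w = b i j w) /\
      (forall i j k w, j != k -> e i j *: b i k w = 0),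
      (forall j, \sum_i e i j = 1)
    & (forall i j k, i != k -> e i j * e k j = 0)].

Lemma extend_aut (h : algAut L R) : exists g : algAut A R,
  [/\ restricts_to (skew_incl (C := C)) g h,
      (forall z, g (prod_conj z) = prod_conj (g z)),
      monomial g & monomial (aut_inv g)].
Proof.
pose f := aut_blocks h; pose f' := aut_blocks (aut_opp h).
have hK : cancel (aut_opp h) h by exact: aut_invK.
have hK' : cancel h (aut_opp h) by exact: aut_funK.
have cp i := skew_crossProduct (C i) R charF.
have [||||||||||e [[er ec] [er1 ec1] [ef eg] [fg0 gf0] [formf formg]]] :=
  @block_matrix R n (fun i => sext (S i) R) _ _ cp (shalf R) (shalf2 R charF) f f'.
- exact: aut_blocks_linear.
- exact: aut_blocks_mul.
- exact: aut_blocks_orth.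
- by move=> i x; rewrite aut_blocksK// sproj_inj.
- by move=> i k x ik; rewrite aut_blocksK// sproj_inj0.
- exact: aut_blocks_linear.
- exact: aut_blocks_mul.
- exact: aut_blocks_orth.
- by move=> i x; rewrite aut_blocksK// sproj_inj.
- by move=> i k x ik; rewrite aut_blocksK// sproj_inj0.
(* As for permutation matrices, the inverse of this matrix of idempotents is its transpose. *)
pose d i j := e j i.
have gf : goodBlocks f e.
  by split=> //; [exact: aut_blocks_linear|exact: aut_blocks_mul|exact: aut_blocks_orth].
have gf' : goodBlocks f' d.
  split=> //; rewrite /d //; [exact: aut_blocks_linear|exact: aut_blocks_mul|exact:
    aut_blocks_orth| ].
  by move=> i j k jk; exact: ec.
have K1 : cancel (fhat f e) (fhat f' d).
  apply: fhatK => //; first by move=> i j k ik; exact: er.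
  by move=> i x; rewrite aut_blocksK// sproj_inj.
have K2 : cancel (fhat f' d) (fhat f e).
  by apply: fhatK => // i x; rewrite aut_blocksK// sproj_inj.
exists (AlgAut (fhat_linear gf) (fhat_mul gf) K1 K2); split.
- move=> x /=; rewrite fhat_skew; congr (sext_map _ _ _).
  by apply: (sprodP (A := S)) => i; rewrite sproj_sum aut_blocks_sum.
- exact: fhat_conj.
- exists e, (blk f e); split=> //.
  + exact: sproj_fhat.
  + exact: blk_linear.
  + by split; [exact: e_blk|exact: e_blk0].
- exists d, (blk f' d); split=> //.
  + exact: sproj_fhat.
  + exact: blk_linear.
  + by split; [exact: e_blk|exact: e_blk0].
  + by move=> i j k ik; exact: er.
Qed.

End Extension.

(** * Extension to the tensor product *)

Section PureR.
Variables (F : fieldType) (R : commAlgebra F) (n : nat) (V : 'I_n -> vectType F).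
Local Notation family := (forall i, sext (V i) R).

Definition multilinearR (W : lmodType R) (m : family -> W) : Prop :=
  forall (z : family) i, linear (fun v : sext (V i) R => m (dfwith z v)).

Definition sbasis_at (k : mindex V) : family := fun i => sext_in R (basis_at k i).

Lemma multilinearR_ext (W : lmodType R) (m m' : family -> W) :
  multilinearR m -> multilinearR m' ->
  (forall k, m (sbasis_at k) = m' (sbasis_at k)) -> forall z, m z = m' z.
Proof.
move=> mL m'L mm' z.
suff H (s : seq 'I_n) : forall z : family, (forall i, i \notin s ->
    exists k : 'I_(\dim {: V i}), z i = sext_in R (vbasis {: V i})`_k) -> m z = m' z.
  by apply: (H (enum 'I_n)) => i; rewrite mem_enum.
elim: s => [|i s IH] {}z zs.
  have c i : {k : 'I_(\dim {: V i}) | z i = sext_in R (vbasis {: V i})`_k}.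
    by apply: cid; exact: zs.
  have -> : z = sbasis_at [ffun i => sval (c i)].
    apply: functional_extensionality_dep => i.
    by rewrite /sbasis_at /basis_at ffunE; exact: (svalP (c i)).
  exact: mm'.
rewrite -(dfwith_id z i) (sext_sum (z i)) /sext_lift.
rewrite (linear_sum_of _ _ (mL z i)) (linear_sum_of _ _ (m'L z i)).
apply: eq_bigr => k _; rewrite (linearZ_of _ _ (mL z i)) (linearZ_of _ _ (m'L z i)).
congr (_ *: _); apply: IH => j js.
have [ij|ij] := eqVneq i j; first by subst j; rewrite dfwith_in; exists k.
by rewrite dfwith_out//; apply: zs; rewrite inE negb_or eq_sym ij.
Qed.

(** The tensor [z_1 ⊗ ... ⊗ z_n] under the identification of the tensor product over [R] of the
    [V_i ⊗ R] with the scalar extension of the tensor product of the [V_i]. *)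
Definition pureR (z : family) : sext (tensor V) R :=
  \sum_(k : mindex V) (\prod_i z i 0 (k i)) *: sext_in R (pure (basis_at k)).

Lemma pureR_multilinear : multilinearR pureR.
Proof.
move=> z i a u v; rewrite /pureR scaler_sumr -big_split; apply: eq_bigr => k _ /=.
rewrite scalerA -scalerDl; congr (_ *: _).
have E w : \prod_j (dfwith z w j) 0 (k j) = w 0 (k i) * \prod_(j | j != i) z j 0 (k j).
  rewrite (bigD1 i)//= dfwith_in; congr (_ * _).
  by apply: eq_bigr => j ji; rewrite dfwith_out// eq_sym.
by rewrite !E !mxE mulrDl mulrA.
Qed.

Lemma pureR_in x : pureR (fun i => sext_in R (x i)) = sext_in R (pure x).
Proof.
rewrite [in RHS](tensor_sum (pure x)) /tensor_lift sext_in_sum; apply: eq_bigr => k _.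
rewrite sext_inZ; congr (_ *: _); rewrite ffunE rmorph_prod.
by apply: eq_bigr => i _; rewrite mxE.
Qed.

(** The factors are replaced one at a time, each replacement borrowing the common scalar [c]. *)
Lemma scale_pureR_eq c z z' : (forall i, c *: z i = c *: z' i) ->
  c *: pureR z = c *: pureR z'.
Proof.
move=> zz'; rewrite /pureR !scaler_sumr; apply: eq_bigr => k _.
rewrite !scalerA; congr (_ *: _).
have zz i : c * z i 0 (k i) = c * z' i 0 (k i).
  by have /rowP/(_ (k i)) := zz' i; rewrite !mxE.
elim/big_rec2: _ => // i a b _ E.
by rewrite mulrA zz mulrAC E mulrAC -mulrA.
Qed.

Definition liftR (W : lmodType R) (m : family -> W) (t : sext (tensor V) R) : W :=
  sext_lift (fun t : tensor V => \sum_k calg_struct R (t k) *: m (sbasis_at k)) t.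

Lemma liftR_linear (W : lmodType R) (m : family -> W) : linear (liftR m).
Proof. exact: sext_lift_is_linear. Qed.

Lemma liftR_pureR (W : lmodType R) (m : family -> W) z : multilinearR m ->
  liftR m (pureR z) = m z.
Proof.
move=> mL; move: z; apply: multilinearR_ext => // [z i a u v|k].
  by rewrite pureR_multilinear liftR_linear.
rewrite pureR_in /liftR sext_lift_in => [|s t|a s].
- rewrite (bigD1 k)//= pure_basis_at eqxx rmorph1 scale1r big1 ?addr0// => l lk.
  by rewrite pure_basis_at (negPf lk) rmorph0 scale0r.
- by rewrite -big_split; apply: eq_bigr => l _; rewrite tensorDE rmorphD scalerDl.
- by rewrite scaler_sumr; apply: eq_bigr => l _; rewrite tensorZE rmorphM scalerA.
Qed.

Lemma pureR_ext (W : lmodType R) (h h' : sext (tensor V) R -> W) :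
  linear h -> linear h' -> (forall z, h (pureR z) = h' (pureR z)) ->
  forall t, h t = h' t.
Proof.
by move=> hL h'L hh'; apply: sext_tensor_ext => // x; rewrite -pureR_in.
Qed.

End PureR.

(** * From monomial automorphisms of the product to the tensor product *)

Section Lift.
Variables (F : fieldType) (n : nat) (C : 'I_n -> cayleyAlgebra F).
Hypothesis charF : 2%N \notin [pchar F].
Variable R : commAlgebra F.
Local Notation T := (cayleyTensor C).
Local Notation A := (cayleyProd C).
Local Notation L := (cayleySkewProd C).
Local Notation skewA := (sext_map R (skew_incl (C := C))).
Local Notation skewT := (sext_map R (skew_tensor (C := C))).
Local Notation pureR := (pureR (V := C)).
Local Notation family := (forall i, sext (C i) R).

Lemma pureR_mul (z w : family) :
  sext_mul (pureR z : sext T R) (pureR w) = pureR (fun i => sext_mul (z i) (w i)).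
Proof.
move: z; apply: (multilinearR_ext (V := C)) => [z i a u v|z i a u v|k].
- by rewrite pureR_multilinear sext_mul_linearl.
- have E y : (fun j => sext_mul (dfwith z y j) (w j)) =
      dfwith (fun j => sext_mul (z j) (w j)) (sext_mul y (w i)).
    exact: (dfwith_map (fun j y => sext_mul y (w j))).
  by rewrite !E sext_mul_linearl pureR_multilinear.
move: w; apply: (multilinearR_ext (V := C)) => [z i a u v|z i a u v|l].
- by rewrite pureR_multilinear sext_mul_linearr.
- have E y : (fun j => sext_mul (sbasis_at R k j) (dfwith z y j)) =
      dfwith (fun j => sext_mul (sbasis_at R k j) (z j)) (sext_mul (sbasis_at R k i) y).
    exact: (dfwith_map (fun j y => sext_mul (sbasis_at R k j) y)).
  by rewrite !E sext_mul_linearr pureR_multilinear.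
rewrite !pureR_in sext_mul_in tensor_mulE -pureR_in; congr pureR.
by apply: functional_extensionality_dep => i; rewrite /sbasis_at sext_mul_in.
Qed.

(** A multiplicative but nonlinear map from the product to the tensor product. Its values span, so
    identities between linear maps are checked on them. *)
Definition ptens (z : sext A R) : sext T R := pureR (fun i => sproj i z).

Lemma ptens_inj (z : family) : ptens (\sum_i sinj i (z i)) = pureR z.
Proof.
by congr pureR; apply: functional_extensionality_dep => i; rewrite sproj_sum.
Qed.

Lemma ptens_ext (W : lmodType R) (h h' : sext T R -> W) :
  linear h -> linear h' -> (forall z, h (ptens z) = h' (ptens z)) ->
  forall t, h t = h' t.
Proof.
by move=> hL h'L hh'; apply: (pureR_ext (V := C)) => // z; rewrite -ptens_inj.
Qed.

Lemma ptens_mul z w : sext_mul (ptens z) (ptens w) = ptens (sext_mul z w).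
Proof.
rewrite /ptens pureR_mul; congr pureR.
by apply: functional_extensionality_dep => i; rewrite sproj_mul.
Qed.

Section Monomial.
Variables (g : sext A R -> sext A R) (e : 'I_n -> 'I_n -> R).
Variable b : forall i j, sext (C j) R -> sext (C i) R.
Arguments b : clear implicits.
Hypothesis gE : forall i z, sproj i (g z) = \sum_j b i j (sproj j z).
Hypothesis b_linear : forall i j, linear (b i j).
Hypothesis eb : forall i j w, e i j *: b i j w = b i j w.
Hypothesis eb0 : forall i j k w, j != k -> e i j *: b i k w = 0.
Hypothesis e1 : forall j, \sum_i e i j = 1.
Hypothesis ee0 : forall i j k, i != k -> e i j * e k j = 0.

Definition mono_pure (z : family) : sext T R := pureR (fun i => \sum_j b i j (z j)).

(* Multiplied by [e i l], the factors other than the [i]-th forget [w]. *)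
Lemma mono_pureE (z : family) l (w : sext (C l) R) : mono_pure (dfwith z w) =
  \sum_i e i l *: pureR (dfwith (fun k => \sum_(j | j != l) b k j (z j)) (b i l w)).
Proof.
rewrite -[LHS]scale1r -(e1 l) scaler_suml; apply: eq_bigr => i _.
apply: scale_pureR_eq => k.
rewrite (bigD1 l)//= dfwith_in; under eq_bigr => j jl do rewrite dfwith_out 1?eq_sym//.
rewrite scalerDr; case: (dfwithP (T := fun i => sext (C i) R)) => [|k' ik].
  rewrite [X in _ + X]scaler_sumr [X in _ + X]big1 ?addr0// => j jl.
  by rewrite eb0// eq_sym.
by rewrite -[b k' l w]eb scalerA ee0// scale0r add0r.
Qed.

Lemma mono_pure_multilinear : multilinearR mono_pure.
Proof.
move=> z l a u v; rewrite !mono_pureE scaler_sumr -big_split; apply: eq_bigr => i _ /=.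
by rewrite b_linear pureR_multilinear scalerDr !scalerA mulrC.
Qed.

Lemma lift_mono_ptens z : liftR mono_pure (ptens z) = ptens (g z).
Proof.
rewrite /ptens (liftR_pureR (V := C))//; last exact: mono_pure_multilinear.
by congr pureR; apply: functional_extensionality_dep => i; rewrite gE.
Qed.

Definition stensor_at i (w : sext (C i) R) : sext T R :=
  pureR (dfwith (fun j => sone R (C j)) w).

Lemma stensor_at_linear i : linear (@stensor_at i).
Proof. exact: (pureR_multilinear (V := C)). Qed.

Definition prod_one : A := [ffun i => hone (C i)] : dprod C.

Lemma sproj_one i : sproj i (sext_in R prod_one) = sone R (C i).
Proof. by rewrite /sproj /= sext_map_in /= /dproj_fun ffunE. Qed.

(** In position [k] other than [i], since [g] fixes the unit, the blocks [b k j] applied to units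
    sum to 1. Multiplication by [e i l] kills the term [j = l], so the remaining sum acts as 1. *)
Lemma mono_pure_at l (w : sext (C l) R) : g (sext_in R prod_one) = sext_in R prod_one ->
  mono_pure (dfwith (fun j => sone R (C j)) w) = \sum_k stensor_at (b k l w).
Proof.
move=> g1; rewrite mono_pureE; apply: eq_bigr => i _.
rewrite -[in RHS]eb (linearZ_of _ _ (@stensor_at_linear i)).
apply: scale_pureR_eq => k; case: (dfwithP (T := fun i => sext (C i) R)) => [|k' ik].
  by rewrite dfwith_in.
rewrite dfwith_out//; have := gE k' (sext_in R prod_one).
under eq_bigr do rewrite sproj_one.
rewrite g1 sproj_one (bigD1 l)//= => ->.
by rewrite scalerDr -[X in _ = _ *: X + _]eb scalerA ee0// scale0r add0r.
Qed.

Lemma lift_mono_sum z : g (sext_in R prod_one) = sext_in R prod_one ->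
  liftR mono_pure (\sum_i stensor_at (sproj i z)) = \sum_i stensor_at (sproj i (g z)).
Proof.
move=> g1; rewrite (linear_sum_of _ _ (liftR_linear _)).
under eq_bigr => i _ do rewrite (liftR_pureR (V := C) _ mono_pure_multilinear) mono_pure_at//.
rewrite exchange_big; apply: eq_bigr => k _.
by rewrite gE (linear_sum_of _ _ (@stensor_at_linear k)).
Qed.

End Monomial.

Lemma skewT_sum x : skewT x = \sum_i stensor_at (sproj i (skewA x)).
Proof.
move: x; apply: sext_lin_ext => [||v].
- exact: linearP.
- apply: lin_sum => i; apply: (lin_comp' (@stensor_at_linear i)).
  by do 2!apply: lin_comp; exact: lin_id.
rewrite sext_map_in /= /skew_tensor sext_in_sum; apply: eq_bigr => i _.
rewrite /tensor_at -pureR_in sext_map_in /sproj /= sext_map_in /= /dproj_fun ffunE.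
congr pureR; exact: (dfwith_map (fun j y => sext_in R (y : C j))).
Qed.

Lemma monomial_lift (g : algAut A R) : monomial g ->
  exists G : sext T R -> sext T R, [/\ linear G,
    (forall z, G (ptens z) = ptens (g z)) &
    (forall x y, g (skewA x) = skewA y -> G (skewT x) = skewT y)].
Proof.
move=> [e [b [gE bL [eb eb0] e1 ee0]]].
exists (liftR (mono_pure b)); split.
- exact: liftR_linear.
- exact: lift_mono_ptens gE bL eb eb0 e1 ee0.
move=> x y gx; rewrite !skewT_sum (lift_mono_sum gE bL eb eb0 e1 ee0) ?gx//.
apply: aut_unit => z; apply/dprodP => i; rewrite !ffunE.
  exact: hmul1l.
exact: hmul1r.
Qed.

Lemma tensor_conj_pureR (w : family) : sext_map R (tensor_conj C) (pureR w) =
  pureR (fun i => sconj R (C i) (w i)).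
Proof.
move: w; apply: (multilinearR_ext (V := C)) => [z i a u v|z i a u v|k].
- by rewrite pureR_multilinear linearP.
- have E y : (fun j => sconj R (C j) (dfwith z y j)) =
      dfwith (fun j => sconj R (C j) (z j)) (sconj R (C i) y).
    exact: (dfwith_map (fun j y => sconj R (C j) y)).
  by rewrite !E linearP pureR_multilinear.
rewrite pureR_in sext_map_in /= tensor_map_pure -pureR_in; congr pureR.
by apply: functional_extensionality_dep => i; rewrite /sbasis_at /sconj /= sext_map_in.
Qed.

Lemma tensor_conj_ptens z :
  sext_map R (tensor_conj C) (ptens z) = ptens (prod_conj C R z).
Proof.
rewrite /ptens tensor_conj_pureR; congr pureR.
by apply: functional_extensionality_dep => i; rewrite sproj_conj.
Qed.

Lemma extend_aut_tensor (h : algAut L R) : exists f : algAut T R,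
  restricts_to (skew_tensor (C := C)) f h /\
  forall t, f (sext_map R (tensor_conj C) t) = sext_map R (tensor_conj C) (f t).
Proof.
have [g [gh gconj gmono gVmono]] := extend_aut charF h.
have [G [GL GE GS]] := monomial_lift gmono.
(* The inverse of [g] is also monomial, and its lift inverts [G] because it does so on the values of
   [ptens]. *)
have [G' [G'L G'E _]] := @monomial_lift (aut_opp g) gVmono.
have GM x y : G (sext_mul x y) = sext_mul (G x) (G y).
  move: x; apply: ptens_ext => [||x].
  - by apply: (lin_comp' GL); exact: sext_mul_linearl.
  - exact: lin_mull.
  move: y; apply: ptens_ext => [||y].
  - by apply: (lin_comp' GL); exact: sext_mul_linearr.
  - exact: lin_mulr.
  by rewrite ptens_mul !GE ptens_mul aut_mul.
have K : cancel G G'.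
  apply: ptens_ext => [||z]; [exact: (lin_comp' G'L)|exact: lin_id|].
  by rewrite GE G'E /= aut_funK.
have K' : cancel G' G.
  apply: ptens_ext => [||z]; [exact: (lin_comp' GL)|exact: lin_id|].
  by rewrite G'E GE /= aut_invK.
exists (AlgAut GL GM K K'); split; first by move=> x; exact/GS/gh.
apply: ptens_ext => [||z].
- by apply: (lin_comp' GL); exact: linearP.
- by apply: lin_comp.
by rewrite /= tensor_conj_ptens !GE gconj tensor_conj_ptens.
Qed.

End Lift.

Theorem theorem3p6 (F : fieldType) (n : nat) (C : 'I_n -> cayleyAlgebra F)
    (charF : 2%N \notin [pchar F]) (n_gt0 : (0 < n)%N) :
  [/\ identifies (skew_tensor (C := C)) (Nalt' (cayleyTensor C)) /\
      exists Phi : groupFunctorIso (AutScheme (cayleyTensor C))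
                                   (AutScheme (cayleySkewProd C)),
        forall (R : commAlgebra F) (f : AutScheme (cayleyTensor C) R),
          restricts_to (skew_tensor (C := C)) f (Phi R f),
      identifies (skew_incl (C := C)) (comm_span [set: cayleyProd C]) /\
      exists phi : groupFunctorIso (AutScheme (cayleyProd C))
                                   (AutScheme (cayleySkewProd C)),
        forall (R : commAlgebra F) (g : AutScheme (cayleyProd C) R),
          restricts_to (skew_incl (C := C)) g (phi R g)
    & forall R : commAlgebra F,
        AutInvol (tensor_conj C) R = [set: AutScheme (cayleyTensor C) R]].
Proof.
have [Phi PhiE] : exists Phi : groupFunctorIso (AutScheme (cayleyTensor C))
                                               (AutScheme (cayleySkewProd C)),
    forall (R : commAlgebra F) (f : AutScheme (cayleyTensor C) R),
      restricts_to (skew_tensor (C := C)) f (Phi R f).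
  apply: restriction_iso.
  - exact: skew_tensor_inj.
  - exact: skew_tensorM.
  - by move=> R f x; exact: cayleyTensor_stable.
  - by move=> R f; exact: cayleyTensor_faithful.
  - by move=> R h; have [f [fh _]] := extend_aut_tensor charF h; exists f.
split.
- by split; [exact: skew_tensor_identifies|exists Phi].
- split; first exact: skew_incl_identifies.
  apply: restriction_iso.
  + exact: skew_incl_inj.
  + exact: skew_inclM.
  + by move=> R f x; exact: cayleyProd_stable.
  + by move=> R f; exact: cayleyProd_faithful.
  + by move=> R h; have [g [gh _ _ _]] := extend_aut charF h; exists g.
move=> R; apply/seteqP; split=> // f _ t.
(* [f'] has the same restriction as [f] and commutes with the involution by construction;
   faithfulness gives [f = f']. *)
have [f' [f'h f'conj]] := extend_aut_tensor charF (Phi R f).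
suff -> : f = f' by exact: f'conj.
apply: (mulgI (f'^-1)%g); rewrite mulVg; apply: algAutP.
apply: (cayleyTensor_faithful charF) => x /=.
by rewrite PhiE -f'h aut_funK.
Qed.
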